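(* Let $\Gamma$ be a finite group and let $\xi\in R(\Gamma)$ be a self-dual class function. Then the characteristic map $\mathrm{ch}$ is an isometry from the space $(R_\Gamma,\langle\ ,\ \rangle_\xi)$ to the space $(S_\Gamma,\langle\ ,\ \rangle'_\xi)$.
   Context: $\Gamma$ is a finite group; $\Gamma^*=\{\gamma_0,\dots,\gamma_r\}$ is its set of complex irreducible characters ($\gamma_0$ trivial); $\Gamma_*$ is its set of conjugacy classes; $c^{-1}=\{x^{-1}:x\in c\}$; $\zeta_c$ is the order of the centralizer of an element of $c$; $R(\Gamma)=\bigoplus_i\mathbb C\gamma_i$ is the space of class functions. For a finite group $G$ the standard bilinear form on class functions is $\langle f,g\rangle_G=\frac1{|G|}\sum_{x\in G}f(x)g(x^{-1})$; $*$ denotes pointwise multiplication of class functions (tensor product). $\xi$ is self-dual if $\xi(x)=\xi(x^{-1})$ for all $x$. The weighted form on $R(\Gamma)$ is $\langle f,g\rangle_\xi=\langle\xi*f,g\rangle_\Gamma$. Wreath products: $\Gamma_n=\Gamma^n\rtimes S_n$ with $(g,\sigma)(h,\tau)=(g\,\sigma(h),\sigma\tau)$, where $\sigma(g_1,\dots,g_n)=(g_{\sigma^{-1}(1)},\dots,g_{\sigma^{-1}(n)})$. $\mathcal P_n(\Gamma_* )$ is the set of families $\rho=(\rho(c))_{c\in\Gamma_*}$ of partitions with total size $\|\rho\|=\sum_c|\rho(c)|=n$, and $\mathcal P(\Gamma_* )=\bigcup_n\mathcal P_n(\Gamma_* )$. The type of $(g,\sigma)\in\Gamma_n$ is the $\rho$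 for which the number of parts equal to $i$ in $\rho(c)$ is the number of $i$-cycles $(i_1\,i_2\cdots i_k)$ ($k=i$) of $\sigma$ whose cycle-product $g_{i_k}g_{i_{k-1}}\cdots g_{i_1}$ lies in $c$. Two elements are conjugate iff they have the same type, and the centralizer of an element of type $\rho$ has order $Z_\rho=\prod_c z_{\rho(c)}\zeta_c^{l(\rho(c))}$, where $l$ denotes length and $z_\lambda=\prod_i i^{m_i}m_i!$ for $\lambda=(1^{m_1}2^{m_2}\cdots)$. $R(\Gamma_n)$ is the space of complex class functions on $\Gamma_n$ and $R_\Gamma=\bigoplus_{n\ge0}R(\Gamma_n)$. For a representation $V$ of $\Gamma$ with character $\gamma$, $\eta_n(\gamma)$ is the character of the $\Gamma_n$-module $V^{\otimes n}$ ($\Gamma^n$ acting factor by factor, $S_n$ permuting factors), and $\varepsilon_n(\gamma)$ is the character of $V^{\otimes n}$ tensored with the sign representation of $S_n$. The map $\eta_n$ is extended to virtual characters by $\eta_n(\beta-\gamma)=\sum_{m=0}^n(-1)^m\mathrm{Ind}_{\Gamma_{n-m}\times\Gamma_m}^{\Gamma_n}[\eta_{n-m}(\beta)\otimes\varepsilon_m(\gamma)]$, and to all of $R(\Gamma)$ as the unique map that is polynomial in the coordinates with respect to the $\gamma_i$. The weighted form on $R(\Gamma_n)$ is $\langle f,g\rangle_{\xi,\Gamma_n}=\langle\eta_n(\xi)*f,g\rangle_{\Gamma_n}$, and on $R_\Gamma$ it is $\langle u,v\rangle_\xi=\sum_n\langle u_n,v_n\rangle_{\xi,\Gamma_n}$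 for $u=\sum u_n$, $v=\sum v_n$ with $u_n,v_n\in R(\Gamma_n)$. $S_\Gamma$ is the symmetric (polynomial) algebra over $\mathbb C$ on generators $a_{-n}(\gamma)$, $n\ge1$, $\gamma\in\Gamma^*$, extended linearly to $\gamma\in R(\Gamma)$. For $n>0$, $a_{-n}(\gamma)$ acts on $S_\Gamma$ by multiplication, and $a_n(\gamma)$ acts as the derivation with $a_n(\gamma)\cdot a_{-m}(\beta)=n\,\delta_{n,m}\langle\gamma,\beta\rangle_\xi$. The form $\langle\ ,\ \rangle'_\xi$ on $S_\Gamma$ is the bilinear form characterized by $\langle1,1\rangle'_\xi=1$ and $a_n(\gamma)^*=a_{-n}(\gamma)$ (adjoint) for $n\in\mathbb Z\setminus\{0\}$. For $c\in\Gamma_*$, $a_{-n}(c)=\sum_{\gamma\in\Gamma^*}\gamma(c^{-1})a_{-n}(\gamma)$; for $\rho\in\mathcal P(\Gamma_* )$, $a'_{-\rho}=\prod_c\prod_i a_{-\rho(c)_i}(c)$ (product over the parts of $\rho(c)$). The characteristic map $\mathrm{ch}:R_\Gamma\to S_\Gamma$ is the linear map with $\mathrm{ch}(f)=\sum_{\rho\in\mathcal P_n(\Gamma_* )}Z_\rho^{-1}f_\rho\,a'_{-\rho}$ for $f\in R(\Gamma_n)$, where $f_\rho$ is the value of $f$ at elements of type $\rho$. *)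

(* Defs.v *)
From HB Require Import structures.
From mathcomp Require Import all_boot all_order all_algebra all_fingroup.
From mathcomp Require Import mxrepresentation.
From mathcomp Require Import finmap monalg.
From mathcomp Require Import boolp classical_sets fsbigop reals.
From mathcomp Require Import complex.

Set Implicit Arguments.
Unset Strict Implicit.
Unset Printing Implicit Defensive.

Import Order.TTheory GRing.Theory Num.Theory.
Local Open Scope ring_scope.

(* The type 'CF(G) of classfun.v only has values in algC, which is too small  *)
(* for class functions with arbitrary complex values.                         *)

Section ClassFunctions.
Variables (C : numClosedFieldType) (gT : finGroupType).

Definition class_invariant : {pred {ffun gT -> C^o}} :=
  fun f => [forall x, forall y, f (x ^ y)%g == f x].

Lemma class_invariantP (f : {ffun gT -> C^o}) :
  reflect (forall x y, f (x ^ y)%g = f x) (f \in class_invariant).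
Proof.
apply: (iffP forallP) => [H x y|H x]; first by have /forallP/(_ y)/eqP := H x.
by apply/forallP => y; rewrite H.
Qed.

Fact class_invariant_submod : submod_closed class_invariant.
Proof.
split=> [|a f g /class_invariantP Hf /class_invariantP Hg].
  by apply/class_invariantP => x y; rewrite !ffunE.
by apply/class_invariantP => x y; rewrite !ffunE Hf Hg.
Qed.

HB.instance Definition _ :=
  GRing.isSubmodClosed.Build C {ffun gT -> C^o} class_invariant
    class_invariant_submod.

Record classfun := ClassFun {
  cf_val : {ffun gT -> C^o};
  _ : cf_val \in class_invariant
}.

HB.instance Definition _ := [isSub for cf_val].
HB.instance Definition _ := [Choice of classfun by <:].
HB.instance Definition _ := [SubChoice_isSubLmodule of classfun by <:].

Definition cf_fun (f : classfun) (x : gT) : C := cf_val f x.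
Coercion cf_fun : classfun >-> Funclass.

Lemma cfJ (f : classfun) (x y : gT) : f (x ^ y)%g = f x.
Proof. by case: f => f Hf; exact: (class_invariantP _ Hf). Qed.

Fact mkcf_subproof (f : gT -> C) :
  (forall x y, f (x ^ y)%g = f x) -> finfun f \in class_invariant.
Proof. by move=> H; apply/class_invariantP => x y; rewrite !ffunE. Qed.

Definition mkcf (f : gT -> C) (H : forall x y, f (x ^ y)%g = f x) : classfun :=
  ClassFun (mkcf_subproof H).

Lemma mkcfE (f : gT -> C) H x : @mkcf f H x = f x.
Proof. by rewrite /cf_fun /= ffunE. Qed.

Fact cf_mul_subproof (f g : classfun) x y :
  f (x ^ y)%g * g (x ^ y)%g = f x * g x.
Proof. by rewrite !cfJ. Qed.

Definition cf_mul (f g : classfun) : classfun := mkcf (cf_mul_subproof f g).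

Definition cf_form (f g : classfun) : C :=
  #|gT|%:R^-1 * \sum_(x : gT) f x * g x^-1%g.

Definition self_dual (f : classfun) : Prop := forall x, f x = f x^-1%g.

Fact repr_char_subproof d (rG : mx_representation C [set: gT] d) x y :
  \tr (rG (x ^ y)%g) = \tr (rG x).
Proof.
by rewrite /conjg !repr_mxM ?inE // mxtrace_mulC -mulmxA -repr_mxM ?inE //
           mulgV repr_mx1 mulmx1.
Qed.

Definition repr_char d (rG : mx_representation C [set: gT] d) : classfun :=
  mkcf (repr_char_subproof rG).

(* A finite type indexing the isomorphism classes of irreducible              *)
(* representations, namely the components of the regular representation.      *)
Definition Irr : irrType C [set: gT] :=
  DecSocleType (regular_repr C [set: gT]%G).

Definition irr_char (i : Irr) : classfun := repr_char (irr_repr i).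

(* The class function with coordinates x in the basis of irreducibles. *)
Definition cf_of_coords (x : {ffun Irr -> C}) : classfun :=
  \sum_i x i *: irr_char i.

End ClassFunctions.

Arguments Irr : clear implicits.
Arguments irr_char {C gT}.

(* Induction along an embedding of a group H into G: for an injective group   *)
(* morphism iota this is the character induced from the subgroup iota(H).     *)
Section Induction.
Variables (C : numClosedFieldType) (H : finType) (G : finGroupType).
Variables (iota : H -> G) (f : H -> C).

Definition ind_fun (x : G) : C :=
  #|H|%:R^-1 * \sum_(y : G) \sum_(h | iota h == (x ^ y)%g) f h.

Fact ind_subproof x z : ind_fun (x ^ z)%g = ind_fun x.
Proof.
rewrite /ind_fun; congr (_ * _).
rewrite [RHS](reindex_inj (mulgI z)); apply: eq_bigr => y _.
by apply: eq_bigl => h; rewrite conjgM.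
Qed.

Definition cf_ind : classfun C G := mkcf ind_subproof.

End Induction.

Section Wreath.
Variables (gT : finGroupType) (n : nat).

Record wreath := Wreath { wpair : {ffun 'I_n -> gT} * 'S_n }.

HB.instance Definition _ := [isNew for wpair].
HB.instance Definition _ := [Finite of wreath by <:].

Definition wbase (x : wreath) : {ffun 'I_n -> gT} := (wpair x).1.
Definition wperm (x : wreath) : 'S_n := (wpair x).2.

(* The product of permutations in 'S_n is (s * t) i = t (s i), so that the    *)
(* composite of functions wperm x \o wperm y is wperm y * wperm x.            *)
Definition wmul (x y : wreath) : wreath :=
  Wreath ([ffun i => (wbase x i * wbase y ((wperm x)^-1 i))%g],
          (wperm y * wperm x)%g).
Definition wone : wreath := Wreath ([ffun=> 1%g], 1%g).
Definition winv (x : wreath) : wreath :=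
  Wreath ([ffun i => (wbase x (wperm x i))^-1%g], (wperm x)^-1%g).

Fact wmulA : associative wmul.
Proof.
move=> x y z; apply: val_inj => /=; rewrite /wmul /wbase /wperm /=.
congr (_, _); last by rewrite mulgA.
by apply/ffunP => i; rewrite !ffunE mulgA invMg permM.
Qed.

Fact wmul1 : left_id wone wmul.
Proof.
case=> -[g s]; apply: val_inj => /=; rewrite /wbase /wperm /=.
congr (_, _); last by rewrite mulg1.
by apply/ffunP => i; rewrite !ffunE mul1g invg1 perm1.
Qed.

Fact wmulV : left_inverse wone winv wmul.
Proof.
case=> -[g s]; apply: val_inj => /=; rewrite /wbase /wperm /=.
congr (_, _); last by rewrite mulgV.
by apply/ffunP => i; rewrite !ffunE invgK mulVg.
Qed.

HB.instance Definition _ := Finite_isGroup.Build wreath wmulA wmul1 wmulV.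

End Wreath.

(* The embedding of wreath k * wreath m into wreath n for k + m = n: the      *)
(* first factor acts on the first k indices, the second on the last m ones.   *)
Section Embedding.
Variables (gT : finGroupType) (k m n : nat) (e : (k + m)%N = n).

Definition isplit (i : 'I_n) : 'I_k + 'I_m := split (cast_ord (esym e) i).
Definition ijoin (j : 'I_k + 'I_m) : 'I_n := cast_ord e (unsplit j).

Lemma isplitK : cancel isplit ijoin.
Proof. by move=> i; rewrite /ijoin /isplit splitK cast_ordKV. Qed.
Lemma ijoinK : cancel ijoin isplit.
Proof. by move=> j; rewrite /ijoin /isplit cast_ordK unsplitK. Qed.

Definition sum_perm (s : 'S_k) (t : 'S_m) (j : 'I_k + 'I_m) : 'I_k + 'I_m :=
  match j with inl a => inl (s a) | inr b => inr (t b) end.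

Fact sum_perm_inj s t : injective (ijoin \o sum_perm s t \o isplit).
Proof.
apply: inj_comp (can_inj isplitK); apply: inj_comp (can_inj ijoinK) _.
by move=> [a|b] [a'|b'] //= [/perm_inj->].
Qed.

Definition wembed (p : wreath gT k * wreath gT m) : wreath gT n :=
  Wreath ([ffun i => match isplit i with
                     | inl a => wbase p.1 a
                     | inr b => wbase p.2 b
                     end],
          perm (@sum_perm_inj (wperm p.1) (wperm p.2))).

Lemma wembedM p q : wembed (p.1 * q.1, p.2 * q.2)%g = (wembed p * wembed q)%g.
Proof.
have pE (s : 'S_k) (t : 'S_m) i :
    perm (@sum_perm_inj s t) i = ijoin (sum_perm s t (isplit i)).
  by rewrite permE.
have pV (s : 'S_k) (t : 'S_m) i :
    (perm (@sum_perm_inj s t))^-1%g i = ijoin (sum_perm s^-1 t^-1 (isplit i)).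
  apply: (@perm_inj _ (perm (@sum_perm_inj s t))).
  rewrite permKV pE ijoinK -[LHS]isplitK; congr ijoin.
  by case: (isplit i) => j /=; rewrite permKV.
apply: val_inj; congr (_, _); last first.
  apply/permP => i; rewrite permM !pE ijoinK /=; congr ijoin.
  by case: (isplit i) => j /=; rewrite permM.
apply/ffunP => i; rewrite !ffunE /= [wperm (wembed p)]/wperm /= pV ijoinK.
by case: (isplit i) => j /=; rewrite /wbase /= ffunE.
Qed.

Lemma wembed_inj : injective wembed.
Proof.
case=> -[[g s]] [[h t]] [[[g' s']] [[h' t']]] [/ffunP E /permP F].
have {}E j := E (ijoin j); have {}F j := F (ijoin j).
congr (Wreath _, Wreath _); congr (_, _).
- by apply/ffunP => a; have := E (inl a); rewrite !ffunE ijoinK.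
- apply/permP => a; have := F (inl a); rewrite !permE /= ijoinK.
  by move/(can_inj ijoinK) => [].
- by apply/ffunP => b; have := E (inr b); rewrite !ffunE ijoinK.
- apply/permP => b; have := F (inr b); rewrite !permE /= ijoinK.
  by move/(can_inj ijoinK) => [].
Qed.

End Embedding.

Section TensorPower.
Variables (C : numClosedFieldType) (gT : finGroupType) (n d : nat).
Variable rG : mx_representation C [set: gT] d.

Definition tens_basis (a : 'I_#|{: {ffun 'I_n -> 'I_d}}|) :
  {ffun 'I_n -> 'I_d} := enum_val a.

(* The matrix, in the basis e_(b 1) (x) .. (x) e_(b n) indexed by             *)
(* b : {ffun 'I_n -> 'I_d}, of the operator                                   *)
(*   v_1 (x) .. (x) v_n |-> g_1 v_(s^-1 1) (x) .. (x) g_n v_(s^-1 n)          *)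
(* where gT acts on column vectors through rG, and x = (g, s).                *)
Definition tens_mx (x : wreath gT n) : 'M[C]_#|{: {ffun 'I_n -> 'I_d}}| :=
  \matrix_(a, b) \prod_i rG (wbase x i) (tens_basis a i)
                                        (tens_basis b ((wperm x)^-1%g i)).

Fact tens_mx_repr : mx_repr [set: wreath gT n] tens_mx.
Proof.
split=> [|x y _ _]; apply/matrixP => a b; rewrite !mxE.
  under eq_bigr => i _ do
    rewrite /wbase /wperm /= ffunE invg1 perm1 repr_mx1 mxE.
  case: (eqVneq a b) => [->|nab]; first by rewrite big1 // => i _; rewrite eqxx.
  have /existsP[i ni] : [exists i, tens_basis a i != tens_basis b i].
    apply: contraR nab => /existsPn H; apply/eqP/enum_val_inj/ffunP => i.
    by apply/eqP; have := H i; rewrite negbK.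
  by rewrite (bigD1 i) //= (negbTE ni) mul0r.
under eq_bigr => i _ do
  rewrite /wbase /wperm /= ffunE invMg permM repr_mxM ?inE // mxE.
rewrite bigA_distr_bigA /=.
pose s := wperm x; pose h (c : {ffun 'I_n -> 'I_d}) := [ffun i => c (s i)].
rewrite [RHS](reindex_onto (fun c => enum_rank (h c))
  (fun j => [ffun i => enum_val j (s^-1%g i)])) /=; last first.
  move=> j _; apply: enum_val_inj; rewrite enum_rankK.
  by apply/ffunP => i; rewrite !ffunE permK.
apply: eq_big => [c|c _].
  by apply/esym/eqP/ffunP => i; rewrite !ffunE enum_rankK ffunE permKV.
rewrite !mxE [X in _ = _ * X](reindex_inj (@perm_inj _ s^-1%g)) /= -big_split.
by apply: eq_bigr => i _; rewrite /= /tens_basis enum_rankK !ffunE permKV.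
Qed.

Definition tens_repr : mx_representation C [set: wreath gT n] _ :=
  MxRepresentation tens_mx_repr.

Definition eta_char : classfun C (wreath gT n) := repr_char tens_repr.

Fact sign_subproof (x y : wreath gT n) :
  (-1) ^+ odd_perm (wperm (x ^ y)%g) = (-1) ^+ odd_perm (wperm x) :> C.
Proof.
rewrite /wperm /= !odd_permM odd_permV /=.
by do 2!case: (odd_perm _).
Qed.

Definition eps_char : classfun C (wreath gT n) :=
  cf_mul (mkcf sign_subproof) eta_char.

End TensorPower.

Arguments tens_mx {C gT} n {d}.
Arguments tens_repr {C gT} n {d}.
Arguments eta_char {C gT} n {d}.
Arguments eps_char {C gT} n {d}.

Section Eta.
Variables (C : numClosedFieldType) (gT : finGroupType) (n : nat).

Definition polynomial_map (F : classfun C gT -> classfun C (wreath gT n)) :=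
  forall x : wreath gT n, exists p : {malg C[{cmonom (Irr C gT)}]},
  forall a : {ffun Irr C gT -> C},
    F (cf_of_coords a) x =
      mmap idfun (fun m : {cmonom (Irr C gT)} => \prod_i a i ^+ m i) p.

Definition virtual_eta d1 d2 (rB : mx_representation C [set: gT] d1)
    (rG : mx_representation C [set: gT] d2) : classfun C (wreath gT n) :=
  \sum_(m < n.+1) (-1) ^+ m *:
     cf_ind (wembed (gT := gT) (subnK (leq_ord m)))
            (fun p => eta_char (n - m) rB p.1 * eps_char m rG p.2).

Definition is_eta (F : classfun C gT -> classfun C (wreath gT n)) : Prop :=
  [/\ polynomial_map F,
      forall d (rG : mx_representation C [set: gT] d),
        F (repr_char rG) = eta_char n rG
    & forall d1 d2 (rB : mx_representation C [set: gT] d1)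
             (rG : mx_representation C [set: gT] d2),
        F (repr_char rB - repr_char rG) = virtual_eta rB rG].

(* The map is determined uniquely by is_eta, and xget selects it; the value 0 *)
(* is what xget would return if there were no such map.                       *)
Definition eta : classfun C gT -> classfun C (wreath gT n) :=
  xget (fun=> 0) is_eta.

End Eta.

Arguments eta {C gT} n.

Section Types.
Variable gT : finGroupType.

Definition cclass : Type := {c : {set gT} | c \in classes [set: gT]}.
HB.instance Definition _ := Finite.on cclass.

Definition cent_order (c : cclass) : nat := #|'C[repr (val c)]%g|.

Definition cycle_prod n (x : wreath gT n) (i : 'I_n) : gT :=
  (\prod_(j <- rev (traject (wperm x) i #|porbit (wperm x) i|)) wbase x j)%g.

(* Families of partitions with parts of size at most n, given by their        *)
(* multiplicities: rho c k is the number of parts of rho(c) equal to k.+1.    *)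
Definition pfamily n : Type := {ffun cclass -> {ffun 'I_n -> 'I_n.+1}}.
HB.instance Definition _ n := Finite.on (pfamily n).

Definition psize n (rho : pfamily n) : nat :=
  (\sum_c \sum_(k < n) k.+1 * rho c k)%N.

(* The choice of a point in each cycle is irrelevant, since the corresponding *)
(* cycle-products are conjugate.                                              *)
Definition wtype n (x : wreath gT n) : pfamily n :=
  [ffun c : cclass => [ffun k : 'I_n => inord
    #|[set o in porbits (wperm x) |
        (#|o| == k.+1) && [exists i in o, cycle_prod x i \in val c]]|]].

Definition plength n (lam : {ffun 'I_n -> 'I_n.+1}) : nat := (\sum_k lam k)%N.
Definition zpart n (lam : {ffun 'I_n -> 'I_n.+1}) : nat :=
  (\prod_(k < n) (k.+1 ^ lam k * (lam k)`!))%N.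
Definition Zpart n (rho : pfamily n) : nat :=
  (\prod_c (zpart (rho c) * cent_order c ^ plength (rho c)))%N.

End Types.

Definition value_at_type (C : numClosedFieldType) (gT : finGroupType) n
    (f : classfun C (wreath gT n)) (rho : pfamily gT n) : C :=
  if [pick x | wtype x == rho] is Some x then f x else 0.

Section RGamma.
Variables (C : numClosedFieldType) (gT : finGroupType).

Record RGamma := MkRGamma {
  rg_comp :> forall n, classfun C (wreath gT n);
  rg_fin : exists N, forall n, (N <= n)%N -> rg_comp n = 0
}.

HB.instance Definition _ := gen_eqMixin RGamma.
HB.instance Definition _ := gen_choiceMixin RGamma.

Lemma rg_ext (u v : RGamma) : (forall n, u n = v n) -> u = v.
Proof.
case: u v => [u Hu] [v Hv] /= E.
have {E} E : u = v by apply: functional_extensionality_dep.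
by rewrite E in Hu *; rewrite (Prop_irrelevance Hu Hv).
Qed.

Fact rg_zero_fin : exists N, forall n, (N <= n)%N ->
  (fun n => 0 : classfun C (wreath gT n)) n = 0.
Proof. by exists 0%N. Qed.
Definition rg_zero := MkRGamma rg_zero_fin.

Fact rg_lin_fin a (u v : RGamma) : exists N, forall n, (N <= n)%N ->
  (fun n => a *: u n + v n) n = 0.
Proof.
case: (rg_fin u) (rg_fin v) => [N HN] [M HM]; exists (maxn N M) => n.
by rewrite geq_max => /andP[/HN-> /HM->]; rewrite scaler0 addr0.
Qed.
Definition rg_lin a u v := MkRGamma (rg_lin_fin a u v).

Definition rg_add u v := rg_lin 1 u v.
Definition rg_opp u := rg_lin (-1) u rg_zero.
Definition rg_scale a u := rg_lin a u rg_zero.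

Fact rg_addA : associative rg_add.
Proof. by move=> u v w; apply: rg_ext => n /=; rewrite !scale1r addrA. Qed.
Fact rg_addC : commutative rg_add.
Proof. by move=> u v; apply: rg_ext => n /=; rewrite !scale1r addrC. Qed.
Fact rg_add0 : left_id rg_zero rg_add.
Proof. by move=> u; apply: rg_ext => n /=; rewrite scale1r add0r. Qed.
Fact rg_addN : left_inverse rg_zero rg_opp rg_add.
Proof.
by move=> u; apply: rg_ext => n /=; rewrite scale1r scaleN1r addr0 addNr.
Qed.

HB.instance Definition _ :=
  GRing.isZmodule.Build RGamma rg_addA rg_addC rg_add0 rg_addN.

Fact rg_scaleA a b u : rg_scale a (rg_scale b u) = rg_scale (a * b) u.
Proof. by apply: rg_ext => n /=; rewrite !addr0 scalerA. Qed.
Fact rg_scale1 : left_id 1 rg_scale.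
Proof. by move=> u; apply: rg_ext => n /=; rewrite addr0 scale1r. Qed.
Fact rg_scaleDr : right_distributive rg_scale +%R.
Proof.
by move=> a u v; apply: rg_ext => n /=; rewrite !addr0 !scale1r scalerDr.
Qed.
Fact rg_scaleDl u : {morph rg_scale^~ u : a b / a + b}.
Proof.
by move=> a b; apply: rg_ext => n /=; rewrite !addr0 scale1r scalerDl.
Qed.

HB.instance Definition _ :=
  GRing.Zmodule_isLmodule.Build C RGamma
    rg_scaleA rg_scale1 rg_scaleDr rg_scaleDl.

End RGamma.

Section AlgebraIdentities.
Variables (C : comNzRingType) (A : comAlgType C).

Fact scale_natM_eq n (c : C) (x y z : A) : (n != 0%N -> z = x * y) ->
  (n%:R * c) *: z = (n%:R * c) *: x * y.
Proof.
case: n => [_|n ->] //; first by rewrite mul0r !scale0r mul0r.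
by rewrite scalerAl.
Qed.

Fact leibniz_lin_l a (m p q dm dp dq : A) :
  a *: (dm * q + m * dq) + (dp * q + p * dq) =
  (a *: dm + dp) * q + (a *: m + p) * dq.
Proof. by rewrite scalerDr !mulrDl !scalerAl addrACA. Qed.

Fact leibniz_lin_r b (m k r dm dk dr : A) :
  b *: (dm * k + m * dk) + (dm * r + m * dr) =
  dm * (b *: k + r) + m * (b *: dk + dr).
Proof. by rewrite scalerDr !mulrDr !scalerAr addrACA. Qed.

Fact add_scale_nat n1 n2 (c : C) (x : A) :
  ((n1 + n2)%:R * c) *: x = (n1%:R * c) *: x + (n2%:R * c) *: x.
Proof. by rewrite natrD mulrDl scalerDl. Qed.

End AlgebraIdentities.

Section Derivation.
Variables (C : comNzRingType) (I : choiceType) (d : I -> C).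
Local Notation S := {malg C[{cmonom I}]}.

Definition mon_deriv (m : {cmonom I}) : S :=
  \sum_(i <- finsupp m) ((m i)%:R * d i) *: << divcm m (ucm i) >>.

(* The derivation taking the value d i on the variable i (see derivationM and *)
(* derivation_var below).                                                     *)
Definition derivation (p : S) : S := \sum_(m <- msupp p) p@_m *: mon_deriv m.

Lemma scale_mon (c : C) (m : {cmonom I}) : c *: << m >> = << c *g m >>.
Proof.
apply/malgP => k; rewrite mcoeffZ [RHS]mcoeffU [X in _ * X]mcoeffU.
by case: (m == k); rewrite ?mulr1 ?mulr0.
Qed.

Lemma derivationEw (D : {fset {cmonom I}}) p : (msupp p `<=` D)%fset ->
  derivation p = \sum_(m <- D) p@_m *: mon_deriv m.
Proof.
move=> sD; rewrite /derivation (big_fset_incl _ sD) //= => m _ Hm.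
by rewrite mcoeff_outdom // scale0r.
Qed.

Lemma derivation_linear : linear derivation.
Proof.
move=> a p q; pose D := (msupp (a *: p + q) `|` (msupp p `|` msupp q))%fset.
have s1 : (msupp (a *: p + q) `<=` D)%fset by exact: fsubsetUl.
have s2 : (msupp p `<=` D)%fset.
  exact: fsubset_trans (fsubsetUl _ _) (fsubsetUr _ _).
have s3 : (msupp q `<=` D)%fset.
  exact: fsubset_trans (fsubsetUr _ _) (fsubsetUr _ _).
rewrite (derivationEw s1) (derivationEw s2) (derivationEw s3).
rewrite scaler_sumr -big_split; apply: eq_bigr => m _ /=.
by rewrite mcoeffD mcoeffZ scalerDl scalerA.
Qed.

Lemma derivationU m : derivation << m >> = mon_deriv m.
Proof.
by rewrite (derivationEw msuppU_le) big_seq_fset1 mcoeffUU scale1r.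
Qed.

Lemma mon_derivEw (D : {fset I}) (m : {cmonom I}) : (finsupp m `<=` D)%fset ->
  mon_deriv m = \sum_(i <- D) ((m i)%:R * d i) *: << divcm m (ucm i) >>.
Proof.
move=> sD; rewrite /mon_deriv (big_fset_incl _ sD) //= => i _.
by rewrite -cmE_eq0 => /eqP->; rewrite mul0r scale0r.
Qed.

Lemma derivation_var i : derivation << ucm i >> = (d i)%:MP.
Proof.
rewrite derivationU /mon_deriv mdomU big_seq_fset1 cmUU mul1r.
have -> : divcm (ucm i) (ucm i) = mone.
  by apply/eqP/cmP => j; rewrite divcmE subnn cm1.
exact: scale_mon.
Qed.

Lemma monM (a b : {cmonom I}) : << a >> * << b >> = << mulcm a b >> :> S.
Proof. by rewrite malgM_def fgmulUU mulr1. Qed.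

Lemma divcmM (m1 m2 : {cmonom I}) i : m1 i != 0%N ->
  divcm (mulcm m1 m2) (ucm i) = mulcm (divcm m1 (ucm i)) m2.
Proof.
move=> m1i; apply/eqP/cmP => j; rewrite !(divcmE, mulcmE, ucmE).
by case: eqVneq => [<-|_]; rewrite ?subn0 // addnBAC // lt0n.
Qed.

Lemma mon_deriv_term (m1 m2 : {cmonom I}) i :
  ((m1 i)%:R * d i) *: << divcm (mulcm m1 m2) (ucm i) >> =
  ((m1 i)%:R * d i) *: << divcm m1 (ucm i) >> * << m2 >> :> S.
Proof.
apply: (scale_natM_eq (A := S)) => m1i; rewrite divcmM //.
by apply/esym; apply: monM.
Qed.

Lemma mon_derivM (m1 m2 : {cmonom I}) : mon_deriv (mulcm m1 m2) =
  mon_deriv m1 * << m2 >> + << m1 >> * mon_deriv m2.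
Proof.
rewrite [<< m1 >> * _]mulrC.
rewrite (mon_derivEw (fsubsetUl (finsupp m1) (finsupp m2))).
rewrite (mon_derivEw (fsubsetUr (finsupp m1) (finsupp m2))).
rewrite (@mon_derivEw (finsupp m1 `|` finsupp m2)%fset (mulcm m1 m2)); last first.
  by rewrite (mdomD m1 m2).
rewrite [X in _ = X + _]mulr_suml [X in _ = _ + X]mulr_suml -big_split /=.
apply: eq_bigr => i _.
have E2 := mon_deriv_term m2 m1 i.
have E : mulcm m2 m1 = mulcm m1 m2 by apply: mulcmC.
rewrite {}E in E2.
apply: etrans (congr2 (@GRing.add S) (mon_deriv_term m1 m2 i) E2).
have -> : mulcm m1 m2 i = (m1 i + m2 i)%N by apply: mulcmE.
exact: (add_scale_nat (A := S)).
Qed.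

Lemma malg_lin_ind (P : S -> Prop) : P 0 ->
  (forall a m p, P p -> P (a *: << m >> + p)) -> forall p, P p.
Proof.
move=> P0 Pl p; rewrite [p]monalgE; elim: (enum_fset _) => [|m r IH].
  by rewrite big_nil.
by rewrite big_cons -scale_mon; exact: Pl.
Qed.

Lemma derivationM p q :
  derivation (p * q) = derivation p * q + p * derivation q.
Proof.
have D0 : derivation 0 = 0.
  by rewrite (derivationEw (fsubset_refl _)) msupp0 big_nil.
have monE m r : derivation (<< m >> * r) =
    mon_deriv m * r + << m >> * derivation r.
  elim/malg_lin_ind: r => [|b k r IH].
    by rewrite [_ * 0]mulr0 D0 !mulr0 addr0.
  have -> : << m >> * (b *: << k >> + r) =
      b *: << mulcm m k >> + << m >> * r :> S.
    by rewrite mulrDr -monM; congr (_ + _); rewrite -scalerAr.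
  have Er : derivation (b *: << k >> + r) = b *: mon_deriv k + derivation r.
    apply: etrans (derivation_linear b _ _) _.
    exact: (congr1 (fun v => b *: v + derivation r) (derivationU k)).
  apply: etrans (derivation_linear b _ _) _.
  apply: etrans (congr2 (fun u v => b *: u + v)
    (etrans (derivationU _) (mon_derivM m k)) IH) _.
  apply: etrans (leibniz_lin_r (A := S) b _ _ _ _ _ _) _.
  exact: (congr1 (fun v => mon_deriv m * _ + << m >> * v) (esym Er)).
elim/malg_lin_ind: p => [|a m p IH].
  by rewrite [0 * _]mul0r D0 !mul0r addr0.
have -> : (a *: << m >> + p) * q = a *: (<< m >> * q) + p * q :> S.
  by rewrite mulrDl; congr (_ + _); rewrite -scalerAl.
have Ep : derivation (a *: << m >> + p) = a *: mon_deriv m + derivation p.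
  apply: etrans (derivation_linear a _ _) _.
  exact: (congr1 (fun v => a *: v + derivation p) (derivationU m)).
apply: etrans (derivation_linear a _ _) _.
apply: etrans (congr2 (fun u v => a *: u + v) (monE m q) IH) _.
apply: etrans (leibniz_lin_l (A := S) a _ _ _ _ _ _) _.
exact: (congr1 (fun v => v * q + _ * derivation q) (esym Ep)).
Qed.

End Derivation.

(* The variable (k, i) stands for the generator a_{-(k+1)}(gamma_i): here and *)
(* below the index k : nat represents the positive integer k + 1.             *)
Notation SGamma C gT := {malg C[{cmonom (nat * Irr C gT)%type}]}.

Section CharacteristicMap.
Variables (C : numClosedFieldType) (gT : finGroupType).
Local Notation RG := (classfun C gT).
Local Notation SG := (SGamma C gT).
Local Notation coords := {ffun Irr C gT -> C}.

Definition a_neg (k : nat) (x : coords) : SG :=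
  \sum_i x i *: << ucm (k, i) >>.

Definition wform (xi f g : RG) : C := cf_form (cf_mul xi f) g.

Definition a_pos (xi : RG) (k : nat) (gamma : RG) : SG -> SG :=
  derivation (fun v : nat * Irr C gT =>
    k.+1%:R * (k == v.1)%:R * wform xi gamma (irr_char v.2)).

Definition is_fock_form (xi : RG) (B : SG -> SG -> C) : Prop :=
  [/\ forall v, scalar (B^~ v), forall u, scalar (B u), B 1 1 = 1,
      forall k (x : coords) u v,
        B (a_pos xi k (cf_of_coords x) u) v = B u (a_neg k x * v)
    & forall k (x : coords) u v,
        B (a_neg k x * u) v = B u (a_pos xi k (cf_of_coords x) v)].

(* Here too is_fock_form has at most one solution; it has one when wform xi   *)
(* is symmetric, hence when xi is self-dual.                                  *)
Definition fock_form (xi : RG) : SG -> SG -> C :=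
  xget (fun _ _ => 0) (is_fock_form xi).

Definition wreath_form (xi : RG) n (f g : classfun C (wreath gT n)) : C :=
  cf_form (cf_mul (eta n xi) f) g.

Definition RGamma_form (xi : RG) (u v : RGamma C gT) : C :=
  \sum_(n \in [set: nat]%classic) wreath_form xi (u n) (v n).

Definition a_class (k : nat) (c : cclass gT) : SG :=
  a_neg k [ffun i => irr_char i (repr (val c)^-1%g)].

Definition a_prime n (rho : pfamily gT n) : SG :=
  \prod_c \prod_(k < n) a_class k c ^+ rho c k.

Definition ch_n n (f : classfun C (wreath gT n)) : SG :=
  \sum_(rho : pfamily gT n | psize rho == n)
     ((Zpart rho)%:R^-1 * value_at_type f rho) *: a_prime rho.

Definition ch (u : RGamma C gT) : SG :=
  \sum_(n \in [set: nat]%classic) ch_n (u n).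

End CharacteristicMap.

Arguments ch {C gT}.

(* Main.v *)
From HB Require Import structures.
Require Import Defs.
From mathcomp Require Import all_boot all_order all_algebra all_fingroup.
From mathcomp Require Import mxrepresentation.
From mathcomp Require Import finmap monalg.
From mathcomp Require Import boolp classical_sets fsbigop reals.
From mathcomp Require Import complex.
From mathcomp Require Import ring.
From mathcomp Require character.

(** The characteristic map turns the type of an element of a wreath product
    into a monomial, and both weighted forms are diagonal, up to inversion of
    classes, in the resulting bases.  Write C for the coefficient field and
    Gamma_n for the n-th wreath product.

    Let P be the polynomial algebra over C on variables indexed by the pairs
    (k, c), with k a natural number standing for the cycle length k + 1 and c
    a conjugacy class of Gamma.  Each element x of Gamma_n has a cycle monomial
    in P, the product over its cycles of the variable indexed by the length
    and the class of the cycle-product.  Three facts of combinatorial nature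
    are needed: elements with the same cycle monomial are conjugate
    ([cycle_monom_conj]); the number of elements with a given monomial of
    weighted degree n is |Gamma_n| / Z ([count_cycle_monom]); and inversion in
    Gamma_n inverts the classes of the variables ([cycle_monom_inv]).  The first
    two are proved by splitting off one cycle: if an orbit of x has m elements,
    x is conjugate to an element of Gamma_(n-m) * Gamma_m whose second
    component is a single cycle ([block_isolate]).  The counting goes through
    the functions induced from Gamma_(n-m) * Gamma_m, which are sums over the
    x-stable subsets of size m ([ind_fun_stable]).

    The value of eta_n(xi) at x is the product over the cycles of x of the
    values of xi at the cycle-products ([etaE]).  For a representation this is
    the trace of a tensor power, computed by the same induction
    ([eta_char_eq]); for a difference beta - gamma it is the expansion of a
    product of binomials over the stable subsets ([eta_cf_virtual]); and the
    extension to all class functions is unique because a polynomial vanishing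
    at all points with natural coordinates is zero ([is_eta_unique]).

    The orthogonality relations for irreducible characters show that the
    substitution of a_{-k-1}(c) for the variable (k, c) is an isomorphism
    [theta] from P to S_Gamma.  In P, the annihilation operators become
    derivations, a_{k+1} of the class c differentiating with respect to the
    variable of the inverse class; hence the form on S_Gamma pairs a monomial
    with the monomial of the inverse classes only, the value being the product
    of the m_j! q_j^(m_j) with q_(k, c) = (k + 1) zeta_c xi(c) ([pairing],
    [fock_formE]).  Finally ch(f) is the image under [theta] of the average over
    x in Gamma_n of f(x) times the cycle monomial of x ([ch_nE]).  Comparing
    coefficients gives bijectivity, and since Z_rho times the product of the
    values of xi over the cycles is exactly the value of the pairing,
    the isometry reduces to the formula for the sizes of the classes. *)

Set Implicit Arguments.
Unset Strict Implicit.
Unset Printing Implicit Defensive.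

Import fintype finset.
Import GRing.Theory Num.Theory.

(** * Cycle types in wreath products *)

Section CycleTypes.
Local Open Scope group_scope.
Variable gT : finGroupType.
Local Notation G n := (wreath gT n).

Fact conj_class_subproof (g : gT) : g ^: [set: gT] \in classes [set: gT].
Proof. by rewrite mem_classes ?inE. Qed.

(** The conjugacy class of an element. *)
Definition conj_class (g : gT) : cclass gT :=
  exist _ (g ^: [set: gT]) (conj_class_subproof g).

Lemma cclass_inj : injective (fun c : cclass gT => val c).
Proof. exact: val_inj. Qed.

Lemma mem_cclass (g : gT) (c : cclass gT) : (g \in val c) = (conj_class g == c).
Proof.
apply/idP/eqP => [gc|<-]; last by rewrite /= class_refl.
apply: cclass_inj => /=; have /imsetP[h _ ch] := valP c.
by change (g ^: [set: gT] = val c); rewrite ch in gc *; apply/class_eqP.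
Qed.

Lemma conj_classJ (g h : gT) : conj_class (g ^ h) = conj_class g.
Proof. by apply: cclass_inj; rewrite /= classGidl ?inE. Qed.

Lemma conj_class_eq (g h : gT) :
  conj_class g = conj_class h -> exists u, h = g ^ u.
Proof.
move/eqP; rewrite -mem_cclass /= => /imsetP[u _ ->].
by exists u^-1; rewrite conjgK.
Qed.

Lemma conj_class_repr (c : cclass gT) : conj_class (repr (val c)) = c.
Proof.
apply/eqP; rewrite -mem_cclass; have /imsetP[h _ ch] := valP c.
by rewrite /= in ch *; rewrite ch; apply: mem_repr (class_refl _ h).
Qed.

Section Action.
Variable n : nat.
Implicit Types x y z : G n.

(** The action of the wreath product on 'I_n * gT: the element (g, s) maps
    (i, a) to (s i, g_(s i) a).  It is faithful, and it commutes with the right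
    translations of the second component. *)
Definition wact x (p : 'I_n * gT) : 'I_n * gT :=
  (wperm x p.1, wbase x (wperm x p.1) * p.2).

Lemma wpermM x y i : wperm (x * y) i = wperm x (wperm y i).
Proof. by rewrite /wperm /= permM. Qed.

Lemma wbaseM x y i : wbase (x * y) i = wbase x i * wbase y ((wperm x)^-1 i).
Proof. by rewrite /wbase /= ffunE. Qed.

Lemma wperm1 i : wperm (1 : G n) i = i.
Proof. by rewrite /wperm /= perm1. Qed.

Lemma wbase1 i : wbase (1 : G n) i = 1.
Proof. by rewrite /wbase /= ffunE. Qed.

Lemma wpermV x : wperm x^-1 = (wperm x)^-1.
Proof. by []. Qed.

Lemma wactM x y p : wact (x * y) p = wact x (wact y p).
Proof.
case: p => i a; rewrite /wact /= wpermM; congr (_, _).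
by rewrite wbaseM permK mulgA.
Qed.

Lemma wact1 p : wact 1 p = p.
Proof. by case: p => i a; rewrite /wact /= wperm1 wbase1 mul1g. Qed.

Lemma wact_ext x y : (forall i, wact x (i, 1) = wact y (i, 1)) -> x = y.
Proof.
case: x => -[g s]; case: y => -[h t] E.
have Es : s = t by apply/permP => i; have := E i;
  rewrite /wact /wperm /= => -[].
rewrite {}Es in E *; congr (Wreath (_, _)); apply/ffunP => i.
have := E (t^-1 i); rewrite /wact /wperm /wbase /= permKV !mulg1.
by case.
Qed.

Lemma wact_mulr x i a b :
  wact x (i, a * b) = ((wact x (i, a)).1, (wact x (i, a)).2 * b).
Proof. by rewrite /wact /= mulgA. Qed.

Lemma iter_wact_mulr x k i a b :
  iter k (wact x) (i, a * b) =
  ((iter k (wact x) (i, a)).1, (iter k (wact x) (i, a)).2 * b).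
Proof.
by elim: k => //= k ->; rewrite wact_mulr; case: (iter _ _ _).
Qed.

Lemma iter_wact1 x k p : (iter k (wact x) p).1 = iter k (wperm x) p.1.
Proof. by elim: k => //= k ->. Qed.

(** The group element accumulated along the cycle of i.  It is conjugate to the
    cycle-product, and is easier to transport than the latter. *)
Definition cycle_elt x i : gT :=
  (iter #|porbit (wperm x) i| (wact x) (i, 1)).2.

Lemma iter_wact_cycle x i a :
  iter #|porbit (wperm x) i| (wact x) (i, a) = (i, cycle_elt x i * a).
Proof.
rewrite -{1}[a]mul1g iter_wact_mulr; congr (_, _).
by rewrite iter_wact1 iter_porbit.
Qed.

Lemma iter_wact_prod x k i : (iter k (wact x) (i, 1)).2 =
  \prod_(j <- rev (traject (wperm x) (wperm x i) k)) wbase x j.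
Proof.
elim: k => [|k IH]; first by rewrite big_nil.
by rewrite trajectSr rev_rcons big_cons /= IH iter_wact1 -iterSr.
Qed.

Lemma cycle_elt_prod x i : cycle_prod x i = cycle_elt x i ^ wbase x i.
Proof.
rewrite /cycle_elt iter_wact_prod /cycle_prod.
have: (0 < #|porbit (wperm x) i|)%N.
  by apply/card_gt0P; exists i; apply: porbit_id.
have := iter_porbit (wperm x) i; case: #|_| => // k.
rewrite iterSr => E _.
rewrite trajectS rev_cons trajectSr rev_rcons E big_cons big_rcons /= conjgE.
by rewrite mulgA mulKg.
Qed.

(** The type of the cycle through i: its length minus one, and the class of its
    cycle-product. *)
Definition cycle_type x i : nat * cclass gT :=
  (#|porbit (wperm x) i|.-1, conj_class (cycle_elt x i)).

Lemma card_porbit_gt0 (s : 'S_n) i : (0 < #|porbit s i|)%N.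
Proof. by apply/card_gt0P; exists i; apply: porbit_id. Qed.

Lemma cycle_type_card x i : #|porbit (wperm x) i| = (cycle_type x i).1.+1.
Proof. by rewrite prednK // card_porbit_gt0. Qed.

End Action.

(** The map (i, a) |-> (f i, b i * a) intertwines the action of x with that
    of X.  Conjugation, the embeddings of the two factors of a product, and
    their composites are all of this kind. *)
Definition intertwines m n (x : G m) (X : G n) (f : 'I_m -> 'I_n)
    (b : 'I_m -> gT) :=
  forall i, wact X (f i, b i) = (f (wperm x i),
    b (wperm x i) * wbase x (wperm x i)).

Section Intertwiners.
Variables (m n : nat) (x : G m) (X : G n) (f : 'I_m -> 'I_n) (b : 'I_m -> gT).
Hypotheses (injf : injective f) (xX : intertwines x X f b).

Lemma intertwines_perm i : wperm X (f i) = f (wperm x i).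
Proof. by have := xX i; rewrite /wact /= => -[]. Qed.

Lemma intertwines_iter k i a : iter k (wact X) (f i, b i * a) =
  (f (iter k (wact x) (i, a)).1,
   b (iter k (wact x) (i, a)).1 * (iter k (wact x) (i, a)).2).
Proof.
elim: k => //= k ->; case: (iter _ _ _) => i' a' /=.
by rewrite wact_mulr xX /= mulgA.
Qed.

Lemma intertwines_porbit i : porbit (wperm X) (f i) = f @: porbit (wperm x) i.
Proof.
have E k : iter k (wperm X) (f i) = f (iter k (wperm x) i).
  by elim: k => //= k ->; rewrite intertwines_perm.
apply/setP => j; apply/porbitP/imsetP => [[k ->]|[i' /porbitP[k ->] ->]].
  by exists ((wperm x ^+ k) i); rewrite ?mem_porbit // !permX.
by exists k; rewrite !permX.
Qed.

Lemma intertwines_type i : cycle_type X (f i) = cycle_type x i.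
Proof.
have cE : #|porbit (wperm X) (f i)| = #|porbit (wperm x) i|.
  by rewrite intertwines_porbit card_imset.
rewrite /cycle_type cE; congr (_, _).
have := intertwines_iter #|porbit (wperm x) i| i 1.
rewrite mulg1 -{1}cE !iter_wact_cycle /= mulg1 => -[] E.
by rewrite -[RHS](conj_classJ _ (b i)^-1) conjgE invgK mulgA -E mulgK.
Qed.

End Intertwiners.

Lemma cycle_type_perm n (x : G n) i : cycle_type x (wperm x i) = cycle_type x i.
Proof.
apply: (@intertwines_type n n x x (wperm x) (fun i => wbase x (wperm x i))).
  exact: perm_inj.
by move=> j; rewrite /wact.
Qed.

Lemma cycle_type_porbit n (x : G n) i j :
  j \in porbit (wperm x) i -> cycle_type x j = cycle_type x i.
Proof.
case/porbitP => k ->; rewrite permX.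
by elim: k => //= k <-; rewrite cycle_type_perm.
Qed.

(** The type of an orbit, read off at any of its points. *)
Definition orbit_type n (x : G n) (o : {set 'I_n}) : nat * cclass gT :=
  if [pick i in o] is Some i then cycle_type x i else (0%N, conj_class 1).

Lemma orbit_type_porbit n (x : G n) i :
  orbit_type x (porbit (wperm x) i) = cycle_type x i.
Proof.
rewrite /orbit_type; case: pickP => [j /cycle_type_porbit //|/(_ i)].
by rewrite porbit_id.
Qed.

Lemma mem_orbit_type n (x : G n) o i :
  o \in porbits (wperm x) -> i \in o -> orbit_type x o = cycle_type x i.
Proof.
case/imsetP => j _ -> /cycle_type_porbit ->.
exact: orbit_type_porbit.
Qed.

Lemma orbit_type_card n (x : G n) o :
  o \in porbits (wperm x) -> #|o| = (orbit_type x o).1.+1.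
Proof.
by case/imsetP => i _ ->; rewrite orbit_type_porbit -cycle_type_card.
Qed.

Lemma conj_intertwines n (x y : G n) :
  intertwines (x ^ y) x (wperm y) (fun i => wbase y (wperm y i)).
Proof.
move=> i.
have E j : (wperm y j, wbase y (wperm y j)) = wact y (j, 1).
  by rewrite /wact /= mulg1.
by rewrite E -wactM {1}conjgC wactM /wact /= !mulg1.
Qed.

Lemma intertwines_comp m n p (x : G m) (y : G n) (z : G p) f b f' b' :
  intertwines x y f b -> intertwines y z f' b' ->
  intertwines x z (f' \o f) (fun i => b' (f i) * b i).
Proof.
move=> xy yz i; rewrite /= wact_mulr yz /=.
by have := xy i; rewrite /wact /= => -[-> E]; rewrite -mulgA E mulgA.
Qed.

Section OrbitProducts.
Variables (T : Type) (idx : T) (op : Monoid.com_law idx).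
Variable F : nat * cclass gT -> T.

(** An intertwining map carries the orbits of x, with their types, to the orbits
    of X contained in its image. *)
Lemma big_orbits_intertwines m n (x : G m) (X : G n) f b :
  injective f -> intertwines x X f b ->
  \big[op/idx]_(o in porbits (wperm x)) F (orbit_type x o) =
  \big[op/idx]_(o in porbits (wperm X) | o \subset f @: 'I_m)
     F (orbit_type X o).
Proof.
move=> injf xX.
transitivity (\big[op/idx]_(o in (fun o : {set _} => f @: o) @: porbits
  (wperm x))
     F (orbit_type X o)).
  rewrite [RHS]big_imset /=; last by move=> o1 o2 _ _; apply: (imset_inj injf).
  apply: eq_bigr => o /imsetP[i _ ->].
  by rewrite -(intertwines_porbit xX) !orbit_type_porbit
    (intertwines_type injf xX).
apply: eq_bigl => o; apply/imsetP/andP => [[_ /imsetP[i _ ->] ->] /=|].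
  split; last exact/imsetS/subset_predT.
  by rewrite -(intertwines_porbit xX) imset_f.
case=> /imsetP[j _ ->] /subsetP/(_ _ (porbit_id _ _))/imsetP[i _ ->].
exists (porbit (wperm x) i); first exact: imset_f.
exact: intertwines_porbit.
Qed.

Lemma big_orbits_conj n (x y : G n) :
  \big[op/idx]_(o in porbits (wperm (x ^ y))) F (orbit_type (x ^ y) o) =
  \big[op/idx]_(o in porbits (wperm x)) F (orbit_type x o).
Proof.
rewrite (big_orbits_intertwines (@perm_inj _ _) (conj_intertwines x y)).
apply: eq_bigl => o; rewrite (_ : o \subset _) ?andbT //.
by apply/subsetP => i _; rewrite -(permKV (wperm y) i) imset_f.
Qed.

Lemma wembed_intertwines_l k m n (e : (k + m)%N = n) (p : G k * G m) :
  intertwines p.1 (wembed e p) (ijoin e \o inl) (fun=> 1).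
Proof.
move=> i; rewrite /wact /=.
have sE : wperm (wembed e p) (ijoin e (inl i)) = ijoin e (inl (wperm p.1 i)).
  by rewrite {1}/wperm /= permE /= ijoinK.
by rewrite sE; congr (_, _); rewrite {1}/wbase /= ffunE ijoinK mulg1 mul1g.
Qed.

Lemma wembed_intertwines_r k m n (e : (k + m)%N = n) (p : G k * G m) :
  intertwines p.2 (wembed e p) (ijoin e \o inr) (fun=> 1).
Proof.
move=> i; rewrite /wact /=.
have sE : wperm (wembed e p) (ijoin e (inr i)) = ijoin e (inr (wperm p.2 i)).
  by rewrite {1}/wperm /= permE /= ijoinK.
by rewrite sE; congr (_, _); rewrite {1}/wbase /= ffunE ijoinK mulg1 mul1g.
Qed.

Lemma ijoin_inl_inj k m n (e : (k + m)%N = n) : injective (ijoin e \o inl).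
Proof. by move=> i j /(can_inj (ijoinK e)) []. Qed.

Lemma ijoin_inr_inj k m n (e : (k + m)%N = n) : injective (ijoin e \o inr).
Proof. by move=> i j /(can_inj (ijoinK e)) []. Qed.

Lemma big_orbits_wembed k m n (e : (k + m)%N = n) (p : G k * G m) :
  \big[op/idx]_(o in porbits (wperm (wembed e p))) F
    (orbit_type (wembed e p) o) =
  op (\big[op/idx]_(o in porbits (wperm p.1)) F (orbit_type p.1 o))
     (\big[op/idx]_(o in porbits (wperm p.2)) F (orbit_type p.2 o)).
Proof.
have iL := wembed_intertwines_l e p; have iR := wembed_intertwines_r e p.
rewrite (big_orbits_intertwines (@ijoin_inl_inj _ _ _ e) iL).
rewrite (big_orbits_intertwines (@ijoin_inr_inj _ _ _ e) iR).
rewrite (bigID (fun o : {set 'I_n} => o \subset (ijoin e \o inl) @: 'I_k)) /=.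
congr (op _ _); apply: eq_bigl => o; apply: andb_id2l => /imsetP[i _ ->].
rewrite -(isplitK e i); case: (isplit e i) => a.
  have := intertwines_porbit iL a; rewrite /= => ->.
  rewrite imsetS ?subset_predT //=; apply/esym/negP => /subsetP.
  move=> /(_ _ (imset_f _ (porbit_id (wperm p.1) a)))/imsetP[b _] /=.
  by move/(can_inj (ijoinK e)).
have := intertwines_porbit iR a; rewrite /= => ->.
rewrite [RHS]imsetS ?subset_predT //=; apply/negP => /subsetP.
move=> /(_ _ (imset_f _ (porbit_id (wperm p.2) a)))/imsetP[b _] /=.
by move/(can_inj (ijoinK e)).
Qed.

Lemma big_orbits0 (x : G 0) :
  \big[op/idx]_(o in porbits (wperm x)) F (orbit_type x o) = idx.
Proof. by apply: big1 => o /imsetP[[]]. Qed.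

End OrbitProducts.
End CycleTypes.

(** * Cycle monomials and stable blocks *)

(** The type of x, encoded as a monomial whose exponent at (k, c) is the number
    of cycles of length k + 1 with cycle-product in c.  The encoding does not
    depend on n, so types for different n can be compared and multiplied. *)
HB.lock Definition cycle_monom (gT : finGroupType) n (x : wreath gT n) :
    {cmonom (nat * cclass gT)%type} :=
  \big[mmul/mone]_(o in porbits (wperm x)) ucm (orbit_type x o).

Section Blocks.
Local Open Scope group_scope.
Variable gT : finGroupType.
Local Notation G n := (wreath gT n).
Local Notation J := (nat * cclass gT)%type.

Lemma wpermE n (g : {ffun 'I_n -> gT}) s : wperm (Wreath (g, s)) = s.
Proof. by []. Qed.

Lemma wbaseE n (g : {ffun 'I_n -> gT}) s : wbase (Wreath (g, s)) = g.
Proof. by []. Qed.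

Lemma cycle_monomJ n (x y : G n) : cycle_monom (x ^ y) = cycle_monom x.
Proof. by rewrite cycle_monom.unlock; apply: big_orbits_conj. Qed.

Lemma cycle_monom_wembed k m n (e : (k + m)%N = n) (p : G k * G m) :
  cycle_monom (wembed e p) = mulcm (cycle_monom p.1) (cycle_monom p.2).
Proof. by rewrite cycle_monom.unlock; apply: big_orbits_wembed. Qed.

Lemma cycle_monom0 (x : G 0) : cycle_monom x = onecm _.
Proof. by rewrite cycle_monom.unlock; apply: big_orbits0. Qed.

Lemma cycle_monomE n (x : G n) j :
  cycle_monom x j = #|[set o in porbits (wperm x) | orbit_type x o == j]|.
Proof.
rewrite cycle_monom.unlock.
rewrite (big_morph (fun m : {cmonom J} => m j) (cmM j) (cm1 j)).
rewrite cardsE -sum1_card [RHS](eq_bigl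
  (fun o => (o \in porbits (wperm x)) && (orbit_type x o == j))) //.
by rewrite big_mkcondr; apply: eq_bigr => o _; rewrite cmU; case: eqP.
Qed.

(** Invariance of a subset under the permutation underlying x. *)
Definition stable n (x : G n) (A : {set 'I_n}) :=
  [forall i in A, wperm x i \in A].

Lemma stableP n (x : G n) (A : {set 'I_n}) :
  reflect (forall i, i \in A -> wperm x i \in A) (stable x A).
Proof. exact: forall_inP. Qed.

Lemma stable_im n (x : G n) (A : {set 'I_n}) : stable x A -> wperm x @: A = A.
Proof.
move/stableP => H; apply/eqP; rewrite eqEcard card_imset ?leqnn ?andbT;
  last first.
  exact: perm_inj.
by apply/subsetP => _ /imsetP[i iA ->]; exact: H.
Qed.

Lemma stable_mem n (x : G n) (A : {set 'I_n}) i : stable x A ->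
  (wperm x i \in A) = (i \in A).
Proof.
move=> sA; rewrite -{1}(stable_im sA) mem_imset //; exact: perm_inj.
Qed.

Lemma stable_porbit n (x : G n) (A : {set 'I_n}) i :
  stable x A -> i \in A -> porbit (wperm x) i \subset A.
Proof.
move=> /stableP sA iA; apply/subsetP => _ /porbitP[k ->]; rewrite permX.
by elim: k => //= k; apply: sA.
Qed.

Lemma stable_conj n (x y : G n) (A : {set 'I_n}) : stable (x ^ y) A =
  stable x (wperm y @: A).
Proof.
have E i : wperm y (wperm (x ^ y) i) = wperm x (wperm y i).
  by rewrite -!wpermM -conjgC.
apply/stableP/stableP => H => [_ /imsetP[i iA ->]|i iA].
  by rewrite -E imset_f ?H.
have := H _ (imset_f (wperm y) iA); rewrite -E mem_imset //; exact: perm_inj.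
Qed.

Lemma wpermM_imset n (x y : G n) (A : {set 'I_n}) :
  wperm (x * y) @: A = wperm x @: (wperm y @: A).
Proof. by rewrite -imset_comp; apply: eq_imset => i; rewrite /= wpermM. Qed.

Section Block.
Variables (k m n : nat) (e : (k + m)%N = n).

(** The last m indices, on which the second factor of wembed acts. *)
Definition block : {set 'I_n} := (ijoin e \o inr) @: 'I_m.

Lemma mem_block i : (ijoin e i \in block) =
  (if i is inr _ then true else false).
Proof.
apply/imsetP/idP => [[b _ /= /(can_inj (ijoinK e)) -> //]|].
by case: i => // b _; exists b.
Qed.

Lemma card_block : #|block| = m.
Proof. by rewrite card_imset ?card_ord //; apply: ijoin_inr_inj. Qed.

Lemma setC_block : ~: block = (ijoin e \o inl) @: 'I_k.
Proof.
apply/setP => i; rewrite inE -(isplitK e i) mem_block.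
apply/idP/imsetP => [|[a _ /= /(can_inj (ijoinK e)) -> //]].
by case: (isplit e i) => // a _; exists a.
Qed.

Lemma wembed_stable h : stable (wembed (gT := gT) e h) block.
Proof.
apply/stableP => _ /imsetP[b _ ->].
by rewrite (intertwines_perm (wembed_intertwines_r e h)) imset_f.
Qed.

Lemma stable_wembed (z : G n) : stable z block -> exists h, wembed e h = z.
Proof.
move=> sz; pose s := wperm z.
pose fL a := if isplit e (s (ijoin e (inl a))) is inl a' then a' else a.
pose fR b := if isplit e (s (ijoin e (inr b))) is inr b' then b' else b.
have sL a : s (ijoin e (inl a)) = ijoin e (inl (fL a)).
  have := stable_mem (ijoin e (inl a)) sz; rewrite -/s /fL.
  case E: (isplit e (s (ijoin e (inl a)))) => [a'|b'];
  by rewrite -(isplitK e (s _)) E !mem_block.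
have sR b : s (ijoin e (inr b)) = ijoin e (inr (fR b)).
  have := stable_mem (ijoin e (inr b)) sz; rewrite -/s /fR.
  case E: (isplit e (s (ijoin e (inr b)))) => [a'|b'];
  by rewrite -(isplitK e (s _)) E !mem_block.
have iL : injective fL.
  move=> a a' E; have := sL a; rewrite E -sL => /perm_inj.
  by move/(can_inj (ijoinK e)) => [].
have iR : injective fR.
  move=> a a' E; have := sR a; rewrite E -sR => /perm_inj.
  by move/(can_inj (ijoinK e)) => [].
exists (Wreath ([ffun a => wbase z (ijoin e (inl a))], perm iL),
        Wreath ([ffun b => wbase z (ijoin e (inr b))], perm iR)).
apply: wact_ext => i; rewrite -(isplitK e i).
case: (isplit e i) => a.
  have := wembed_intertwines_l e _ a; rewrite /= => ->.
  by rewrite wpermE wbaseE permE ffunE mul1g /wact /= -/s sL mulg1.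
have := wembed_intertwines_r e _ a; rewrite /= => ->.
by rewrite wpermE wbaseE permE ffunE mul1g /wact /= -/s sR mulg1.
Qed.

Lemma block_transport (A : {set 'I_n}) :
  #|A| = m -> exists y : G n, wperm y @: block = A.
Proof.
move=> cA.
have pe : perm_eq (enum (~: block) ++ enum block) (enum (~: A) ++ enum A).
  apply: uniq_perm.
  - rewrite cat_uniq !enum_uniq andbT /=; apply/hasPn => i.
    by rewrite !mem_enum inE negbK.
  - rewrite cat_uniq !enum_uniq andbT /=; apply/hasPn => i.
    by rewrite !mem_enum inE negbK.
  by move=> i; rewrite !mem_cat !mem_enum !inE !orNb.
have cB := card_block.
have cC (B : {set 'I_n}) : #|B| = m -> #|~: B| = k.
  by move=> cB'; apply/eqP; rewrite -(eqn_add2l m) -{1}cB' cardsC card_ord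
    addnC e.
pose S (B : {set 'I_n}) := enum (~: B) ++ enum B.
have zS (B : {set 'I_n}) : size (S B) = n.
  by rewrite size_cat -!cardE addnC cardsC card_ord.
have uS (B : {set 'I_n}) : uniq (S B).
  rewrite cat_uniq !enum_uniq andbT /=; apply/hasPn => i.
  by rewrite !mem_enum inE negbK.
have mS (B : {set 'I_n}) i : i \in S B by rewrite mem_cat !mem_enum inE orNb.
pose f i := nth i (S A) (index i (S block)).
have ltn i : (index i (S block) < n)%N.
  by have := mS block i; rewrite -index_mem zS.
have injf : injective f.
  move=> i j; rewrite /f (set_nth_default j) ?zS //.
  move/eqP; rewrite nth_uniq ?uS ?zS //.
  by move/eqP => E; rewrite -(nth_index i (mS block i)) E nth_index.
exists (Wreath ([ffun=> 1], perm injf)).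
apply/eqP; rewrite eqEcard card_imset; last exact: perm_inj.
rewrite cA cB leqnn andbT; apply/subsetP => _ /imsetP[i ib ->].
rewrite /wperm /= permE /f !index_cat mem_enum inE ib /=.
rewrite nth_cat -!cardE !(cC _ cA) !(cC _ cB) ltnNge leq_addr /= addKn.
rewrite -mem_enum mem_nth // -cardE cA -cB cardE index_mem mem_enum.
by [].
Qed.

(** The elements moving the block to a given set of the same size form a left
    coset of the subgroup embedded by wembed. *)
Lemma card_transport (A : {set 'I_n}) : #|A| = m ->
  #|[set y : G n | wperm y @: block == A]| = #|{: G k * G m}|.
Proof.
move=> cA; have [y0 y0A] := block_transport cA.
transitivity #|y0 *: (wembed e @: [set: G k * G m])|.
  apply: eq_card => y; rewrite inE mem_lcoset.
  apply/eqP/imsetP => [yA|[h _ E]]; last first.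
    by rewrite -y0A -(mulKVg y0 y) E wpermM_imset (stable_im (wembed_stable h)).
  have sz : stable (y0^-1 * y) block.
    apply/stableP => i ib; rewrite wpermM.
    have : wperm y i \in A by rewrite -yA imset_f.
    by rewrite -y0A => /imsetP[j jb ->]; rewrite wpermV permK.
  by have [h <-] := stable_wembed sz; exists h.
by rewrite card_lcoset card_imset ?cardsT //; apply: wembed_inj.
Qed.

End Block.
End Blocks.

(** * Functions induced from a product of wreath products *)

Section InducedFunctions.
Local Open Scope group_scope.
Variable gT : finGroupType.
Local Notation G n := (wreath gT n).
Local Notation J := (nat * cclass gT)%type.

Section Induced.
Local Open Scope ring_scope.
Variables (C : numClosedFieldType) (k m n : nat) (e : (k + m)%N = n).
Variable f : G k * G m -> C.

(** An induced function as a sum over stable subsets: the value of f at a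
    component of a conjugate of x only has to depend on the subset of indices
    on which the second factor acts. *)
Lemma ind_fun_stable (x : G n) (F : {set 'I_n} -> C) :
  (forall y h, wembed e h = (x ^ y)%g -> f h = F (wperm y @: block e)) ->
  ind_fun (wembed e) f x = \sum_(A : {set 'I_n} | stable x A && (#|A| == m)) F
    A.
Proof.
move=> fF; rewrite /ind_fun.
move cE: #|{: G k * G m}| => c.
have c0 : c%:R != 0 :> C.
  by rewrite -cE pnatr_eq0 -lt0n; apply/card_gt0P; exists (1%g, 1%g).
transitivity (c%:R^-1 * \sum_(y : G n | stable x (wperm y @: block e))
    F (wperm y @: block e)).
  congr (_ * _); rewrite [RHS]big_mkcond; apply: eq_bigr => y _.
  rewrite -stable_conj; case: ifP => [/stable_wembed[h hE]|/negP ns].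
    rewrite (big_pred1 h) ?(fF y) // => h'; apply/eqP/eqP => [|->//].
    by rewrite -hE => /wembed_inj.
  by rewrite big1 // => h /eqP hE; case: ns; rewrite -hE wembed_stable.
rewrite (partition_big (fun y : G n => wperm y @: block e)
   (fun A => stable x A && (#|A| == m))) /=; last first.
  by move=> y ->; rewrite card_imset ?card_block ?eqxx //; apply: perm_inj.
rewrite mulr_sumr; apply: eq_bigr => A /andP[sA /eqP cA].
rewrite (eq_bigr (fun=> F A)); last by move=> y /andP[_ /eqP->].
move: c0; have <- : #|[pred y : G n | stable x (wperm y @: block e) &&
                    (wperm y @: block e == A)]| = c.
  rewrite -cE -(card_transport gT e cA); apply: eq_card => y.
  by rewrite !inE; case: eqP => [->|]; rewrite ?sA ?andbF.
move=> c0; rewrite sumr_const -[F A *+ _]mulr_natl mulKf //.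
Qed.

(** Frobenius reciprocity, for summation against a class function u. *)
Lemma sum_ind_fun (u : G n -> C) : (forall x y, u (x ^ y)%g = u x) ->
  \sum_(x : G n) u x * ind_fun (wembed e) f x =
  #|{: G n}|%:R / #|{: G k * G m}|%:R * \sum_h u (wembed e h) * f h.
Proof.
move=> uJ.
under eq_bigr => x _ do rewrite /ind_fun mulrCA.
rewrite -mulr_sumr [_ / _]mulrC -mulrA; congr (_ * _).
under eq_bigr => x _ do rewrite mulr_sumr.
rewrite exchange_big /= (eq_bigr (fun=> \sum_h u (wembed e h) * f h)).
  by rewrite sumr_const mulr_natl.
move=> y _; under eq_bigr => x _ do rewrite mulr_sumr.
rewrite (exchange_big_dep xpredT) //=; apply: eq_bigr => h _.
rewrite (big_pred1 (wembed e h ^ y^-1)%g) ?uJ // => x.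
by apply/eqP/eqP => [->|->]; rewrite ?conjgK ?conjgKV.
Qed.

End Induced.

Lemma perm_imsetC (T : finType) (s : {perm T}) (A : {set T}) :
  s @: (~: A) = ~: (s @: A).
Proof.
apply/setP => i; rewrite inE -(permKV s i) !mem_imset ?inE //; exact: perm_inj.
Qed.

Lemma big_orbits_l (T : Type) (idx : T) (op : Monoid.com_law idx)
    (F : J -> T) k m n (e : (k + m)%N = n) (x y : G n) h :
  wembed e h = x ^ y ->
  \big[op/idx]_(o in porbits (wperm h.1)) F (orbit_type h.1 o) =
  \big[op/idx]_(o in porbits (wperm x) | o \subset ~: (wperm y @: block e))
    F (orbit_type x o).
Proof.
move=> hE; have := conj_intertwines x y; rewrite -hE => xy.
have hx := intertwines_comp (wembed_intertwines_l e h) xy.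
rewrite (big_orbits_intertwines _ _
  (inj_comp perm_inj (@ijoin_inl_inj _ _ _ e)) hx).
by apply: eq_bigl => o; rewrite -perm_imsetC setC_block -imset_comp.
Qed.

Lemma big_orbits_r (T : Type) (idx : T) (op : Monoid.com_law idx)
    (F : J -> T) k m n (e : (k + m)%N = n) (x y : G n) h :
  wembed e h = x ^ y ->
  \big[op/idx]_(o in porbits (wperm h.2)) F (orbit_type h.2 o) =
  \big[op/idx]_(o in porbits (wperm x) | o \subset (wperm y @: block e))
    F (orbit_type x o).
Proof.
move=> hE; have := conj_intertwines x y; rewrite -hE => xy.
have hx := intertwines_comp (wembed_intertwines_r e h) xy.
rewrite (big_orbits_intertwines _ _
  (inj_comp perm_inj (@ijoin_inr_inj _ _ _ e)) hx).
by apply: eq_bigl => o; rewrite -imset_comp.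
Qed.

(** An orbit of x can be moved to the last indices by a conjugation, which then
    splits x into a product with a single cycle as second component. *)
Lemma block_isolate n (x : G n) o j k (e : (k + j.1.+1)%N = n) :
  o \in porbits (wperm x) -> orbit_type x o = j ->
  exists y h, wembed e h = x ^ y /\ cycle_monom h.2 = ucm j.
Proof.
move=> oP oj.
have co : #|o| = j.1.+1 by rewrite (orbit_type_card oP) oj.
have [y yo] := block_transport gT e co; exists y.
have [|h hE] := @stable_wembed _ _ _ _ e (x ^ y).
  rewrite stable_conj yo; case/imsetP: oP => i _ ->; apply/stableP => i'.
  by rewrite -!eq_porbit_mem => /eqP <-;
    rewrite -[wperm x i']/((wperm x ^+ 1) i') porbit_perm.
exists h; split=> //.
rewrite cycle_monom.unlock (big_orbits_r _ _ hE) yo.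
rewrite (big_pred1 o) ?oj // => o' /=.
apply/andP/eqP => [[o'P]|->//].
case/imsetP: oP o'P => i _ -> /imsetP[i' _ ->] /subsetP/(_ _ (porbit_id _ _)).
by rewrite -eq_porbit_mem => /eqP.
Qed.

End InducedFunctions.

(** * Standard cycles and conjugacy *)

Section StandardCycles.
Local Open Scope group_scope.
Variable gT : finGroupType.
Local Notation G n := (wreath gT n).
Local Notation J := (nat * cclass gT)%type.

Section StandardCycle.
Variable k : nat.

(** The standard cycle: the cyclic shift of the indices, with g at the index 0
    and 1 elsewhere. *)
Definition std_cycle (g : gT) : G k.+1 :=
  Wreath ([ffun i => if i == ord0 then g else 1], perm (@ordS_inj k.+1)).

Lemma wact_std_lt g (j : 'I_k.+1) a : (j < k)%N ->
  wact (std_cycle g) (j, a) = (inord j.+1, a).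
Proof.
move=> jk; rewrite /wact wpermE wbaseE /= permE.
have -> : ordS j = inord j.+1.
  by apply: val_inj; rewrite /= inordK ?modn_small.
by rewrite ffunE -val_eqE /= inordK // mul1g.
Qed.

Lemma wact_std_max g a :
  wact (std_cycle g) (ord_max, a) = (ord0, g * a).
Proof.
rewrite /wact wpermE wbaseE /= permE.
have -> : ordS ord_max = ord0 :> 'I_k.+1 by apply: val_inj; rewrite /= modnn.
by rewrite ffunE eqxx.
Qed.

Lemma iter_wact_std g j : (j <= k)%N ->
  iter j (wact (std_cycle g)) (ord0, 1) = (inord j, 1).
Proof.
elim: j => [_|j IH jk] /=.
  by congr (_, _); apply: val_inj; rewrite /= inordK.
by rewrite IH ?(ltnW jk) // wact_std_lt inordK // ltnW.
Qed.

Lemma iter_wact_std_full g a :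
  iter k.+1 (wact (std_cycle g)) (ord0, a) = (ord0, g * a).
Proof.
rewrite -[a in LHS]mul1g iter_wact_mulr iterS iter_wact_std //.
have -> : inord k = ord_max :> 'I_k.+1 by apply: val_inj; rewrite /= inordK.
by rewrite wact_std_max /= mulg1.
Qed.

Lemma std_porbit g i : porbit (wperm (std_cycle g)) i = [set: 'I_k.+1].
Proof.
have H j : j \in porbit (wperm (std_cycle g)) ord0.
  apply/porbitP; exists j; rewrite permX -(iter_wact1 _ _ (ord0, 1)).
  by rewrite iter_wact_std ?inord_val // -ltnS.
apply/setP => j; rewrite inE; have := H i; have := H j.
by rewrite -!eq_porbit_mem => /eqP-> /eqP->; rewrite eqxx.
Qed.

Lemma std_cycle_type g i : cycle_type (std_cycle g) i = (k, conj_class g).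
Proof.
have -> : cycle_type (std_cycle g) i = cycle_type (std_cycle g) ord0.
  by apply: cycle_type_porbit; rewrite std_porbit inE.
rewrite /cycle_type /cycle_elt std_porbit cardsT card_ord.
by rewrite iter_wact_std_full mulg1.
Qed.

Lemma big_orbits_std (T : Type) (idx : T) (op : Monoid.com_law idx)
    (F : J -> T) g :
  \big[op/idx]_(o in porbits (wperm (std_cycle g)))
     F (orbit_type (std_cycle g) o) = F (k, conj_class g).
Proof.
rewrite (big_pred1 (porbit (wperm (std_cycle g)) ord0)).
  by rewrite orbit_type_porbit std_cycle_type.
move=> o /=; apply/imsetP/eqP => [[i _ ->]|->]; last by exists ord0.
by rewrite !std_porbit.
Qed.

Lemma cycle_monom_std g : cycle_monom (std_cycle g) = ucm (k, conj_class g).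
Proof. by rewrite cycle_monom.unlock (big_orbits_std _ (fun j => ucm j)). Qed.

Lemma cycle_type_single (x : G k.+1) c i :
  cycle_monom x = ucm (k, c) -> cycle_type x i = (k, c).
Proof.
move=> xm; have : cycle_monom x (cycle_type x i) != 0%N.
  rewrite cycle_monomE -lt0n; apply/card_gt0P.
  by exists (porbit (wperm x) i); rewrite inE imset_f //= orbit_type_porbit.
by rewrite xm cmU; case: (_ =P cycle_type x i) => [<-|].
Qed.

(** A single cycle x is conjugate to a standard one, and the conjugator can be
    chosen to map (0, 1) to any point (i, a) at which a conjugates the cycle
    element of i to g. *)
Lemma single_conj (x : G k.+1) (i : 'I_k.+1) a g :
  #|porbit (wperm x) i| = k.+1 -> cycle_elt x i ^ a = g ->
  exists y, x ^ y = std_cycle g /\ wact y (ord0, 1) = (i, a).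
Proof.
move=> ci ag.
(* The conjugator maps the successive images of (0, 1) under the standard
   cycle to those of (i, a) under x. *)
pose f (j : 'I_k.+1) := iter j (wperm x) i.
have injf : injective f.
  move=> j j' E; apply/val_inj/eqP.
  rewrite -(nth_uniq i _ _ (uniq_traject_porbit (wperm x) i)) ?size_traject ?ci
    ?ltn_ord //.
  by rewrite !nth_traject ?ci ?ltn_ord //; apply/eqP; exact: E.
pose p := perm injf.
pose y : G k.+1 := Wreath ([ffun i' => (iter (p^-1 i') (wact x) (i, a)).2], p).
have yE (j : 'I_k.+1) : wact y (j, 1) = iter j (wact x) (i, a).
  rewrite /wact /y wpermE wbaseE /= ffunE permK mulg1 permE /f.
  by rewrite [RHS]surjective_pairing iter_wact1.
exists y; split; last by rewrite yE.
suff E : x * y = y * std_cycle g by rewrite /conjg E mulKg.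
apply: wact_ext => j; rewrite !wactM yE.
have := ltn_ord j; rewrite ltnS leq_eqVlt => /orP[/eqP jk|jk]; last first.
  by rewrite wact_std_lt // yE inordK.
have -> : j = ord_max by apply: val_inj.
rewrite wact_std_max mulg1 -{1}[g]mul1g wact_mulr yE /= -iterS.
have -> : iter k.+1 (wact x) (i, a) = (i, cycle_elt x i * a).
  by rewrite -iter_wact_cycle ci.
by rewrite -ag conjgE mulKVg.
Qed.

Lemma single_class (x : G k.+1) g :
  cycle_monom x = ucm (k, conj_class g) -> exists y, x ^ y = std_cycle g.
Proof.
move=> /(cycle_type_single ord0) xt.
have [a ag] : exists a, g = cycle_elt x ord0 ^ a.
  by apply: conj_class_eq; exact: (congr1 snd xt).
have [|y [yE _]] := @single_conj x ord0 a g _ (esym ag); last by exists y.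
by rewrite cycle_type_card xt.
Qed.

(** The centralizer acts freely on the points, and the orbit of (0, 1) consists
    of the points (i, a) such that a conjugates the cycle element at i to g. *)
Lemma card_cent_std g : #|'C[std_cycle g]| = (k.+1 * #|'C[g]|)%N.
Proof.
pose S := std_cycle g.
transitivity #|[set p : 'I_k.+1 * gT | cycle_elt S p.1 ^ p.2 == g]|.
  rewrite -(card_in_imset (f := fun y => wact y (ord0, 1))); last first.
    move=> y z /cent1P yS /cent1P zS E.
    have H (j : 'I_k.+1) : (j, 1) = iter j (wact S) (ord0, 1).
      by rewrite iter_wact_std ?inord_val // -ltnS.
    apply: wact_ext => j; rewrite H.
    elim: (val j) => [//|l IH] /=.
    by rewrite -!wactM yS zS !wactM IH.
  apply: eq_card => -[i a]; rewrite inE /=.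
  have cS (j : 'I_k.+1) : #|porbit (wperm S) j| = k.+1.
    by rewrite std_porbit cardsT card_ord.
  apply/imsetP/eqP => [[y /cent1P yS yE]|].
    have H l p : iter l (wact S) (wact y p) = wact y (iter l (wact S) p).
      by elim: l => //= l ->; rewrite -!wactM yS.
    have := H k.+1 (ord0, 1); rewrite iter_wact_std_full -yE.
    have -> : iter k.+1 (wact S) (i, a) = (i, cycle_elt S i * a).
      by rewrite -iter_wact_cycle cS.
    rewrite mulg1 -[g in RHS]mul1g wact_mulr -yE /=.
    by case=> E; rewrite conjgE E mulKg.
  case/(single_conj (cS i)) => y [yS yE]; exists y => //.
  by apply/cent1P; rewrite /commute -{1}yS -conjgC.
rewrite -sum1_card.
rewrite (eq_bigl (fun p : 'I_k.+1 * gT =>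
  true && (cycle_elt S p.1 ^ p.2 == g))); last first.
  by move=> p; rewrite inE.
rewrite -(pair_big_dep xpredT (fun i a => cycle_elt S i ^ a == g)
  (fun _ _ => 1%N)) /=.
transitivity (\sum_(i < k.+1) #|'C[g]|)%N;
  last by rewrite sum_nat_const card_ord.
apply: eq_bigr => i _.
have [u ug] : exists u, g = cycle_elt S i ^ u.
  by apply: conj_class_eq; exact: (congr1 snd (std_cycle_type g i)).
rewrite -(card_lcoset _ u) -sum1_card; apply: eq_bigl => a.
rewrite mem_lcoset -{1}[a](mulKVg u) conjgM -ug.
apply/eqP/cent1P => [E|E]; first exact/commute_sym/commgP/conjg_fixP.
exact/conjg_fixP/commgP/commute_sym.
Qed.

Lemma card_single c :
  (#|[set x : G k.+1 | cycle_monom x == ucm (k, c)]| * (k.+1 * cent_order c) =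
   #|{: G k.+1}|)%N.
Proof.
rewrite -card_cent_std.
have -> : [set x : G k.+1 | cycle_monom x == ucm (k, c)] =
          std_cycle (repr (val c)) ^: [set: G k.+1].
  apply/setP => x; rewrite inE; apply/eqP/imsetP => [|[y _ ->]]; last first.
    by rewrite cycle_monomJ cycle_monom_std conj_class_repr.
  rewrite -{1}(conj_class_repr c) => /single_class[y <-].
  by exists y^-1; rewrite ?inE // conjgK.
rewrite -index_cent1 finset.setTI mulnC Lagrange ?finset.subsetT //.
by rewrite cardsT.
Qed.

End StandardCycle.

(** Every element is conjugate to an iterated product of standard cycles. *)
Lemma wreath_ind (P : forall n, G n -> Prop) :
  (forall n (x y : G n), P n x -> P n (x ^ y)) ->
  (forall x : G 0, P 0%N x) ->
  (forall k m n (e : (k + m.+1)%N = n) x g,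
     P k x -> P m.+1 (std_cycle m g) -> P n (wembed e (x, std_cycle m g))) ->
  (forall m g, P m.+1 (std_cycle m g)) ->
  forall n x, P n x.
Proof.
move=> PJ P0 PE PS n; elim/ltn_ind: n => -[|n] IH x; first exact: P0.
have [o oP] : exists o, o \in porbits (wperm x).
  by exists (porbit (wperm x) ord0); apply: imset_f.
case oj : (orbit_type x o) => [l c].
have jn : (l.+1 <= n.+1)%N.
  have := orbit_type_card oP; rewrite oj /= => <-.
  by rewrite -[X in (_ <= X)%N]card_ord max_card.
have e := subnK jn.
have [y [h [hE h2]]] := block_isolate (j := (l, c)) e oP oj.
rewrite -[c]conj_class_repr in h2.
have [z zE] := single_class h2.
rewrite -(conjgK (y * (wembed e (1, z))) x); apply: PJ.
rewrite conjgM -hE.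
have -> : wembed e h ^ wembed e (1, z) = wembed e (h.1, h.2 ^ z).
  apply: (mulgI (wembed e (1, z))); rewrite -conjgC.
  by rewrite -!wembedM /= -conjgC mulg1 mul1g.
rewrite zE; apply: PE => //; apply: IH.
by rewrite subSS ltnS leq_subr.
Qed.

Lemma cycle_monom_block k n (x : G n) j (e : (k + j.1.+1)%N = n) :
  cycle_monom x j != 0%N ->
  exists y h, wembed e h = x ^ y /\ cycle_monom h.2 = ucm j.
Proof.
rewrite cycle_monomE -lt0n => /card_gt0P[o]; rewrite inE => /andP[oP /eqP oj].
exact: block_isolate oP oj.
Qed.

Lemma cycle_monom_split k m n (e : (k + m)%N = n) (x y : G n) h :
  wembed e h = x ^ y ->
  cycle_monom x = mulcm (cycle_monom h.1) (cycle_monom h.2).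
Proof. by move=> hE; rewrite -(cycle_monom_wembed e) hE cycle_monomJ. Qed.

Lemma cycle_type_neq0 n (x : G n) i : cycle_monom x (cycle_type x i) != 0%N.
Proof.
rewrite cycle_monomE -lt0n; apply/card_gt0P.
by exists (porbit (wperm x) i); rewrite inE imset_f //= orbit_type_porbit.
Qed.

Lemma mulcm_injl (m : {cmonom J}) : injective (fun p => mulcm p m).
Proof.
move=> p q /eqP/cmP H; apply/eqP/cmP => i.
by have := H i; rewrite !mulcmE => /eqP; rewrite eqn_add2r => /eqP.
Qed.

(** The type determines the conjugacy class: by induction on n, split off from
    both elements a cycle of the same type. *)
Lemma cycle_monom_conj n (x x' : G n) :
  cycle_monom x = cycle_monom x' -> exists y, x' = x ^ y.
Proof.
elim/ltn_ind: n x x' => -[|n] IH x x' E.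
  by exists 1; apply: wact_ext => -[].
have := cycle_type_neq0 x ord0; have := cycle_type_card x ord0.
case: (cycle_type x ord0) => l c /= lE xj.
have jn : (l.+1 <= n.+1)%N.
  by rewrite -lE -[X in (_ <= X)%N]card_ord max_card.
have e := subnK jn.
have [y [h [hE h2]]] := cycle_monom_block (j := (l, c)) e xj.
rewrite E in xj; have [y' [h' [hE' h2']]] :=
  cycle_monom_block (j := (l, c)) e xj.
have [||z1 z1E] := IH _ _ h.1 h'.1.
- by rewrite subSS ltnS leq_subr.
- apply: (@mulcm_injl (ucm (l, c))).
  have := cycle_monom_split hE; have := cycle_monom_split hE'.
  by rewrite h2 h2' E => <- <-.
rewrite -[c]conj_class_repr in h2 h2'.
have [z2 z2E] : exists z, h'.2 = h.2 ^ z.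
  have [u uE] := single_class h2; have [v vE] := single_class h2'.
  by exists (u * v^-1); rewrite conjgM uE -vE conjgK.
exists (y * wembed e (z1, z2) * y'^-1).
rewrite !conjgM -hE.
have -> : wembed e h ^ wembed e (z1, z2) = wembed e (h.1 ^ z1, h.2 ^ z2).
  apply: (mulgI (wembed e (z1, z2))); rewrite -conjgC.
  by rewrite -!wembedM /= -!conjgC.
by rewrite -z1E -z2E -surjective_pairing hE' conjgK.
Qed.

End StandardCycles.

(** * Class sizes *)

Section ClassSizes.
Variable gT : finGroupType.
Local Notation G n := (wreath gT n).
Local Notation J := (nat * cclass gT)%type.
Implicit Type m : {cmonom J}.

(** Only variables (k, c) with k < n occur in m.  This holds for the cycle
    monomials in the n-th wreath product, and allows products over the variables
    of m to be written as products over 'I_n and the classes. *)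
Definition bounded_monom n m := forall j, m j != 0%N -> (j.1 < n)%N.

Lemma cycle_monom_bounded n (x : G n) : bounded_monom n (cycle_monom x).
Proof.
move=> j; rewrite cycle_monomE -lt0n => /card_gt0P[o];
  rewrite inE => /andP[oP /eqP <-].
by rewrite -(orbit_type_card oP) -[X in (_ <= X)%N]card_ord max_card.
Qed.

Lemma big_bounded_monom (T : Type) (idx : T) (op : Monoid.com_law idx) n m
    (F : J -> T) : bounded_monom n m -> (forall j, m j = 0%N -> F j = idx) ->
  \big[op/idx]_(j <- finsupp m) F j =
  \big[op/idx]_c \big[op/idx]_(k < n) F (val k, c).
Proof.
move=> bm F0.
pose D : {fset J} := [fset (val p.1, p.2) | p in {: 'I_n * cclass gT}]%fset.
rewrite (@big_fset_incl _ _ _ _ _ D).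
- rewrite big_imfset /=; last by move=> [k c] [k' c'] _ _ /= [/val_inj-> ->].
  rewrite exchange_big pair_big /=.
  by rewrite big_enum /=; apply: eq_bigr => -[k c].
- apply/fsubsetP => j; rewrite -cmE_neq0 => mj; apply/imfsetP => /=.
  by exists (Ordinal (bm j mj), j.2) => //=; rewrite -surjective_pairing.
by move=> j _; rewrite -cmE_eq0 => /eqP/F0.
Qed.

(** The weighted degree of m, the variable (k, c) having weight k + 1; only the
    indices k < B are taken into account. *)
Definition monom_weight B m : nat :=
  (\sum_(c : cclass gT) \sum_(k < B) k.+1 * m (val k, c)%type)%N.

(** The integer Z of the centralizer order, restricted to the indices k < B. *)
Definition monom_cent B m : nat :=
  (\prod_(c : cclass gT) \prod_(k < B)
     (k.+1 ^ m (val k, c) * (m (val k, c))`! * cent_order c ^ m (val k, c)))%N.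

Lemma monom_weightM B m m' :
  monom_weight B (mulcm m m') = (monom_weight B m + monom_weight B m')%N.
Proof.
rewrite /monom_weight -big_split; apply: eq_bigr => c _ /=.
by rewrite -big_split; apply: eq_bigr => k _ /=; rewrite mulcmE mulnDr.
Qed.

Lemma monom_weight1 B : monom_weight B (onecm _) = 0%N.
Proof.
by rewrite /monom_weight big1 // => c _; rewrite big1 // => k _;
  rewrite onecmE muln0.
Qed.

Lemma monom_weightU B k c : (k < B)%N -> monom_weight B (ucm (k, c)) = k.+1.
Proof.
move=> kB; rewrite /monom_weight (bigD1 c) //= addnC big1 ?add0n; last first.
  move=> c' nc; rewrite big1 // => l _;
    rewrite ucmE xpair_eqE eq_sym [c == _]eq_sym.
  by rewrite (negbTE nc) andbF muln0.
rewrite (bigD1 (Ordinal kB)) //= addnC big1 ?add0n; last first.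
  move=> l nl; rewrite ucmE xpair_eqE eqxx andbT eq_sym.
  by move: nl; rewrite -val_eqE /= => /negbTE->; rewrite muln0.
by rewrite ucmE eqxx muln1.
Qed.

Lemma monom_cent1 B : monom_cent B (onecm _) = 1%N.
Proof.
by rewrite /monom_cent big1 // => c _; rewrite big1 // => k _; rewrite onecmE.
Qed.

Lemma monom_centU B k c m : (k < B)%N ->
  monom_cent B (mulcm m (ucm (k, c))) =
  (monom_cent B m * ((m (k, c)).+1 * (k.+1 * cent_order c)))%N.
Proof.
move=> kB; rewrite /monom_cent (bigD1 c) //= [in RHS](bigD1 c) //=.
rewrite (bigD1 (Ordinal kB)) //= [in RHS](bigD1 (Ordinal kB)) //=.
rewrite mulcmE ucmE eqxx addn1 factS !expnS.
set X := (\prod_(i < B | _) _)%N; set Y := (\prod_(c' | _) _)%N.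
set X' := (\prod_(i < B | _) _)%N; set Y' := (\prod_(c' | _) _)%N.
have -> : X = X'.
  apply: eq_bigr => l; rewrite -val_eqE /= => nl.
  by rewrite mulcmE ucmE xpair_eqE eqxx andbT eq_sym (negbTE nl) addn0.
have -> : Y = Y'.
  apply: eq_bigr => c' nc; apply: eq_bigr => l _.
  by rewrite mulcmE ucmE xpair_eqE [c == _]eq_sym (negbTE nc) andbF addn0.
by rewrite [LHS]muln.[AC (2*2*2*1*1) (2*4*6*7*8*(3*(1*5)))%AC].
Qed.

Lemma cycle_monom_weight n (x : G n) B :
  (n <= B)%N -> monom_weight B (cycle_monom x) = n.
Proof.
move: B; elim/(@wreath_ind gT): n / x =>
  [n x y IH|x|k m n e x g IH IHs|m g] B nB.
- by rewrite cycle_monomJ IH.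
- by rewrite cycle_monom0 monom_weight1.
- rewrite cycle_monom_wembed monom_weightM IH ?IHs //.
    by apply: leq_trans nB; rewrite -e leq_addl.
  by apply: leq_trans nB; rewrite -e leq_addr.
by rewrite cycle_monom_std monom_weightU.
Qed.

(** The second component of a conjugate of x is a single cycle if and only if
    the corresponding subset is an orbit of x. *)
Lemma single_block k c (m : nat) n (e : (k + m.+1)%N = n) (x y : G n) h :
  wembed e h = (x ^ y)%g ->
  (cycle_monom h.2 == ucm (m, c)) =
  (wperm y @: block e \in porbits (wperm x)) &&
  (orbit_type x (wperm y @: block e) == (m, c)).
Proof.
move=> hE; apply/eqP/andP => [h2|[oP /eqP oj]]; last first.
  rewrite cycle_monom.unlock (big_orbits_r _ _ hE)
    (big_pred1 (wperm y @: block e)) ?oj //.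
  move=> o' /=; apply/andP/eqP => [[o'P]|->//].
  case/imsetP: oP o'P => i _ -> /imsetP[i' _ ->] /subsetP/(_ _ (porbit_id _ _)).
  by rewrite -eq_porbit_mem => /eqP.
have := conj_intertwines x y; rewrite -hE => xy.
have hx := intertwines_comp (wembed_intertwines_r e h) xy.
have h0 := cycle_type_single ord0 h2.
have oE := intertwines_porbit hx ord0.
have oT : porbit (wperm h.2) ord0 = [set: 'I_m.+1].
  apply/eqP; rewrite eqEcard finset.subsetT cardsT card_ord /=.
  by rewrite cycle_type_card h0.
have bE : wperm y @: block e = porbit (wperm x)
  ((wperm y \o (ijoin e \o inr)) ord0).
  by rewrite oE oT -imset_comp; apply/setP => i;
  apply/imsetP/imsetP => -[b _ ->]; exists b; rewrite ?inE.
rewrite bE imset_f // orbit_type_porbit.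
by rewrite (intertwines_type (inj_comp perm_inj (@ijoin_inr_inj _ _ _ e)) hx)
  h0.
Qed.

Section Count.
Local Open Scope ring_scope.
Variable C : numClosedFieldType.

Lemma card_wreath_neq0 n : #|{: G n}|%:R != 0 :> C.
Proof. by rewrite pnatr_eq0 -lt0n; apply/card_gt0P; exists 1%g. Qed.

(** Both sides count, up to normalization, the pairs of an element of type
    M * (m, c) and a cycle of type (m, c) in it: the left-hand side directly,
    the right-hand side by Frobenius reciprocity. *)
Lemma count_recursion k c (m : nat) n (e : (k + m.+1)%N = n) (M : {cmonom J}) :
  #|[set x : G n | cycle_monom x == mulcm M (ucm (m, c))]|%:R *
    (M (m, c)).+1%:R =
  #|{: G n}|%:R / (#|{: G k}|%:R * #|{: G m.+1}|%:R) *
  (#|[set x : G k | cycle_monom x == M]|%:R *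
   #|[set x : G m.+1 | cycle_monom x == ucm (m, c)]|%:R) :> C.
Proof.
pose M' := mulcm M (ucm (m, c)).
pose u (x : G n) : C := (cycle_monom x == M')%:R.
pose f (h : G k * G m.+1) : C := (cycle_monom h.2 == ucm (m, c))%:R.
have := @sum_ind_fun gT C _ _ _ e f u; rewrite card_prod natrM => E.
rewrite -[X in _ = _ * X]natrM -cardsX;
  transitivity (\sum_(x : G n) u x * ind_fun (wembed e) f x); last first.
  rewrite E => [|x y]; last by rewrite /u cycle_monomJ.
  congr (_ * _); rewrite -sum1_card natr_sum [RHS]big_mkcond;
    apply: eq_bigr => h _ /=.
  rewrite /u /f /M' inE cycle_monom_wembed.
  rewrite -natrM mulnb !inE.
  have [->|_] := eqVneq (cycle_monom h.2) (ucm (m, c)); last by rewrite !andbF.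
  rewrite !andbT (inj_eq (@mulcm_injl _ _)).
  by case: eqP.
rewrite -sum1_card natr_sum mulr_suml big_mkcond; apply: eq_bigr => x _.
rewrite inE /u -/M'; case: eqP => [xM|_]; last by rewrite mul0r.
rewrite (ind_fun_stable (F := fun A =>
  ((A \in porbits (wperm x)) && (orbit_type x A == (m, c)))%:R)); last first.
  by move=> y h hE; rewrite /f (single_block c hE).
have -> : (M (m, c)).+1 = M' (m, c) by rewrite mulcmE ucmE eqxx addn1.
rewrite -xM cycle_monomE !mul1r -sum1_card natr_sum [LHS]big_mkcond
  [RHS]big_mkcond.
apply: eq_bigr => A _; rewrite inE.
case: (boolP (A \in porbits (wperm x))) => [AP|_] /=; last by case: ifP.
case: eqP => [At|_] /=; last by case: ifP.
rewrite (orbit_type_card AP) At eqxx andbT ifT //.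
case/imsetP: AP => i _ ->; apply/stableP => i'.
by rewrite -!eq_porbit_mem => /eqP <-;
  rewrite -[wperm x i']/((wperm x ^+ 1)%g i') porbit_perm.
Qed.

Lemma monom_divK m j : m j != 0%N -> m = mulcm (divcm m (ucm j)) (ucm j).
Proof.
move=> mj; apply/eqP/cmP => i; rewrite mulcmE divcmE ucmE.
by case: eqP => [<-|_]; rewrite ?subn0 ?addn0 // subnK // lt0n.
Qed.

(** The number of elements of type m is |Gamma_n| / Z.  In particular it is not
    zero, so that every type of the right degree occurs. *)
Lemma count_cycle_monom B n m : (n <= B)%N -> bounded_monom B m ->
  monom_weight B m = n ->
  #|[set x : G n | cycle_monom x == m]|%:R * (monom_cent B m)%:R =
  #|{: G n}|%:R :> C.
Proof.
elim/ltn_ind: n m => n IH m nB bm wm.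
have [m1|] := eqVneq m (onecm _).
  move: wm; rewrite m1 monom_weight1 => n0; rewrite -{}n0 in nB *.
  rewrite monom_cent1 mulr1; congr (_%:R); apply: eq_card => x.
  by rewrite !inE cycle_monom0 eqxx.
move=> m1; have [[k c] mj] : exists j, m j != 0%N.
  apply/not_existsP => H; case/negP: m1; apply/cmP => j.
  by rewrite onecmE; have /negP := H j; rewrite negbK => /eqP.
have kB : (k < B)%N := bm (k, c) mj.
have mE := monom_divK mj; set m' := divcm _ _ in mE.
have wE : (monom_weight B m' + k.+1)%N = n.
  by rewrite -wm [in RHS]mE monom_weightM monom_weightU.
have bm' : bounded_monom B m'.
  move=> j; rewrite divcmE => H; apply: bm; apply: contraNneq H => ->.
  by rewrite sub0n.
have n'n : (monom_weight B m' < n)%N by rewrite -wE addnS ltnS leq_addr.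
have := count_recursion c wE m'; rewrite -mE => rec.
have := IH _ n'n m' (ltnW (leq_trans n'n nB)) bm' erefl => IHm.
have := card_single k c => /(congr1 (fun i => i%:R : C)); rewrite natrM => S1.
rewrite [in monom_cent _ _]mE monom_centU //.
move: (k.+1 * cent_order c)%N S1 => z S1; rewrite !natrM.
transitivity (#|[set x : G n | cycle_monom x == m]|%:R * (m' (k, c)).+1%:R *
  ((monom_cent B m')%:R * z%:R) : C); first by ring.
have := card_wreath_neq0 k.+1; have := card_wreath_neq0 (monom_weight B m').
rewrite -IHm -S1 !mulf_eq0 !negb_or => /andP[a1 a2] /andP[a3 a4].
rewrite rec -IHm -S1.
by field; rewrite a1 a2 a3 a4.
Qed.

End Count.

(** The monomial of a family of partitions. *)
Definition pf_monom n (rho : Defs.pfamily gT n) : {cmonom J} :=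
  [cmonom (if insub j.1 is Some k then val (rho j.2 k) else 0%N)
   | j in [fset (val p.1, p.2) | p in {: 'I_n * cclass gT}]%fset]%M.

Lemma pf_monomE n (rho : Defs.pfamily gT n) (k : 'I_n) c :
  pf_monom rho (val k, c) = rho c k.
Proof.
rewrite /pf_monom cmE fsfunE ifT ?valK //.
by apply/imfsetP; exists (k, c).
Qed.

Lemma pf_monom_bounded n (rho : Defs.pfamily gT n) :
  bounded_monom n (pf_monom rho).
Proof.
move=> j; rewrite /pf_monom cmE fsfunE; case: ifP => // /imfsetP[p _ ->] _.
exact: (ltn_ord p.1).
Qed.

Lemma bounded_monom_eq n m m' : bounded_monom n m -> bounded_monom n m' ->
  (forall (k : 'I_n) c, m (val k, c) = m' (val k, c)) -> m = m'.
Proof.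
move=> bm bm' E; apply/eqP/cmP => -[k c].
have [kn|nk] := ltnP k n; first exact: (E (Ordinal kn)).
have Z p : bounded_monom n p -> p (k, c) = 0%N.
  by move=> bp; apply/eqP; apply: contraTT nk => /bp; rewrite -ltnNge.
by rewrite !Z.
Qed.

Lemma pf_monom_inj n : injective (@pf_monom n).
Proof.
move=> r r' E; apply/ffunP => c; apply/ffunP => k; apply: val_inj.
by rewrite /= -!pf_monomE E.
Qed.

(** The type of x as a family of partitions and as a monomial agree. *)
Lemma pf_monom_wtype n (x : G n) : pf_monom (wtype x) = cycle_monom x.
Proof.
apply: (@bounded_monom_eq n); [exact: pf_monom_bounded|exact:
  cycle_monom_bounded|].
move=> k c; rewrite pf_monomE !ffunE.
have -> : [set o in porbits (wperm x) |
        (#|o| == k.+1) && [exists i in o, cycle_prod x i \in val c]] =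
   [set o in porbits (wperm x) | orbit_type x o == (val k, c)].
  apply/setP => o; rewrite !inE; apply: andb_id2l => oP.
  rewrite (orbit_type_card oP) eqSS; case dE: (orbit_type x o) => [l d] /=.
  rewrite xpair_eqE; apply: andb_id2l => _.
  have mE i : i \in o -> (cycle_prod x i \in val c) = (d == c).
    move=> io; rewrite mem_cclass cycle_elt_prod conj_classJ.
    by have := mem_orbit_type oP io; rewrite dE => /(congr1 snd) /= ->.
  apply/exists_inP/idP => [[i io]|H]; first by rewrite mE.
  by case/imsetP: (oP) => i _ oE; exists i; rewrite ?mE // oE porbit_id.
rewrite inordK -?cycle_monomE //= cycle_monomE ltnS.
apply: leq_trans (_ : #|porbits (wperm x)| <= n)%N.
  by apply/subset_leq_card/subsetP => o; rewrite inE => /andP[].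
by rewrite -[X in (_ <= X)%N]card_ord leq_imset_card.
Qed.

Lemma wtype_eq n (x : G n) rho : (wtype x == rho) =
  (cycle_monom x == pf_monom rho).
Proof. by rewrite -pf_monom_wtype (inj_eq (@pf_monom_inj n)). Qed.

Lemma psize_weight n (rho : Defs.pfamily gT n) : psize rho =
  monom_weight n (pf_monom rho).
Proof.
by apply: eq_bigr => c _; apply: eq_bigr => k _; rewrite pf_monomE.
Qed.

Lemma Zpart_cent n (rho : Defs.pfamily gT n) : Zpart rho =
  monom_cent n (pf_monom rho).
Proof.
apply: eq_bigr => c _; rewrite /plength expn_sum -big_split;
  apply: eq_bigr => k _ /=.
by rewrite pf_monomE.
Qed.

End ClassSizes.

(** * Irreducible characters *)

Local Open Scope ring_scope.

Section Irreducibles.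
Variables (C : numClosedFieldType) (gT : finGroupType).
Local Notation G := [set: gT]%G.
Local Notation Irr := (Irr C gT).
Implicit Type i j : Irr.

Lemma pchar'_group : pgroup.pgroup ([pchar C]^')%N G.
Proof.
apply: sub_in_pnat (pnat_pi (cardG_gt0 _)) => p _ _.
by rewrite inE /= pchar_num.
Qed.

Lemma irr_mx_irr i : mx_irreducible (irr_repr i).
Proof. exact: socle_irr. Qed.

(** Schur's lemma for non-isomorphic irreducible representations. *)
Lemma intertwiner_eq0 i j (T : 'M[C]_(irr_degree i, irr_degree j)) :
  (forall x, irr_repr i x *m T = T *m irr_repr j x) -> i != j -> T = 0.
Proof.
move=> TJ; apply: contraNeq => T0.
have /mx_irrP[ni Hi] := irr_mx_irr i; have /mx_irrP[nj Hj] := irr_mx_irr j.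
have kT : kermx T = 0.
  apply: contraNeq T0 => k0.
  have := Hi (kermx T) _ k0; rewrite -sub1mx => /(_ _)/sub_kermxP.
  rewrite mul1mx => -> //; apply/mxmoduleP => x _.
  by apply/sub_kermxP; rewrite -mulmxA TJ mulmxA mulmx_ker mul0mx.
have fT : row_free T by rewrite -kermx_eq0 kT.
have rT : row_full T.
  rewrite /row_full -(genmxE T) -/(row_full _); apply: Hj; last first.
    by rewrite -mxrank_eq0 genmxE mxrank_eq0.
  rewrite (eqmx_module _ (genmxE _)); apply/mxmoduleP => x _.
  by rewrite -TJ submxMl.
have sim : mx_rsim (irr_repr i) (irr_repr j).
  apply: (MxReprSim (B := T)) => //.
    by rewrite -(eqP fT) (eqP rT).
apply/eqP; have := irr_comp_rsim_pchar Irr pchar'_group sim.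
by rewrite !irr_reprK_pchar //; apply: pchar'_group.
Qed.

Lemma average_intertwines i j (A : 'M[C]_(irr_degree i, irr_degree j)) y :
  irr_repr i y *m (\sum_x irr_repr i x *m A *m irr_repr j x^-1%g) =
  (\sum_x irr_repr i x *m A *m irr_repr j x^-1%g) *m irr_repr j y.
Proof.
rewrite mulmx_sumr mulmx_suml.
rewrite [RHS](reindex_inj (mulgI y)); apply: eq_bigr => x _.
rewrite invMg -[in RHS]mulmxA -[in RHS]repr_mxM ?inE // mulgKV.
by rewrite [in RHS]repr_mxM ?inE // !mulmxA.
Qed.

Lemma sum_irr_entries i j a b :
  \sum_x irr_repr i x a a * irr_repr j x^-1%g b b =
  (\sum_x irr_repr i x *m delta_mx a b *m irr_repr j x^-1%g) a b.
Proof.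
rewrite summxE; apply: eq_bigr => x _.
move: (irr_repr i x) (irr_repr j x^-1%g) => A B.
rewrite mxE (bigD1 b) //= mxE (bigD1 a) //= mxE !eqxx mulr1.
rewrite big1 ?addr0 => [|k /negbTE ka]; last by rewrite mxE ka mulr0.
rewrite big1 ?addr0 // => l /negbTE lb.
by rewrite mxE big1 ?mul0r // => k _; rewrite mxE lb andbF mulr0.
Qed.

Lemma card_gT_neq0 : #|gT|%:R != 0 :> C.
Proof. by rewrite pnatr_eq0 -lt0n; apply/card_gt0P; exists 1%g. Qed.

(** The first orthogonality relation. *)
Lemma irr_orthonormal i j : cf_form (irr_char i) (irr_char j) = (i == j)%:R.
Proof.
rewrite /cf_form.
transitivity (#|gT|%:R^-1 * \sum_a \sum_b
    (\sum_x irr_repr i x *m delta_mx a b *m irr_repr j x^-1%g) a b).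
  congr (_ * _).
  transitivity (\sum_x \sum_a \sum_b irr_repr i x a a * irr_repr j x^-1%g b b).
    apply: eq_bigr => x _; rewrite !mkcfE /mxtrace mulr_suml.
    by apply: eq_bigr => a _; rewrite mulr_sumr.
  rewrite exchange_big; apply: eq_bigr => a _.
  rewrite exchange_big; apply: eq_bigr => b _; exact: sum_irr_entries.
case: (eqVneq i j) => [<-{j}|ij] /=; last first.
  rewrite big1 ?mulr0 // => a _; rewrite big1 // => b _.
  by rewrite (intertwiner_eq0 (@average_intertwines i j (delta_mx a b)) ij) mxE.
have ni : (irr_degree i)%:R != 0 :> C.
  by rewrite pnatr_eq0 -lt0n irr_degree_gt0.
have E a b : \sum_x irr_repr i x *m delta_mx a b *m irr_repr i x^-1%g =
    (#|gT|%:R * (a == b)%:R / (irr_degree i)%:R)%:M.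
  have /is_scalar_mxP[c cE] : is_scalar_mx
      (\sum_x irr_repr i x *m delta_mx a b *m irr_repr i x^-1%g).
    apply: (mx_abs_irr_cent_scalar (rG := irr_repr i)).
      by apply: group_closure_closed_field; apply: irr_mx_irr.
    apply/centgmxP => x _; exact/esym/average_intertwines.
  rewrite cE; congr (_%:M).
  have: \tr (\sum_x irr_repr i x *m delta_mx a b *m irr_repr i x^-1%g) =
        #|gT|%:R * (a == b)%:R.
    rewrite raddf_sum (eq_bigr (fun=> (a == b)%:R)) => [|x _ /=].
      by rewrite sumr_const mulr_natl.
    rewrite mxtrace_mulC mulmxA -repr_mxM ?inE // mulVg repr_mx1 mul1mx
      /mxtrace.
    rewrite (bigD1 a) //= mxE eqxx big1 ?addr0 //= => k /negbTE ka.
    by rewrite mxE ka.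
  rewrite cE mxtrace_scalar => <-.
  by rewrite -[c *+ _]mulr_natr mulfK.
under eq_bigr => a _ do under eq_bigr => b _ do rewrite E mxE.
rewrite (eq_bigr (fun=> #|gT|%:R / (irr_degree i)%:R)) => [|a _]; last first.
  rewrite (bigD1 a) //= eqxx mulr1 mulr1n big1 ?addr0 // => b /negbTE ba.
  by rewrite eq_sym ba mulr0n.
rewrite sumr_const card_ord -[_ *+ irr_degree i]mulr_natr divfK // mulVf //.
exact: card_gT_neq0.
Qed.

(** The number of elements of a conjugacy class. *)
Definition cclass_size (c : cclass gT) : nat := #|val c|.

Lemma cclass_sizeM (c : cclass gT) : (cclass_size c * cent_order c = #|gT|)%N.
Proof.
have cE : val c = (repr (val c) ^: [set: gT])%g.
  by have := congr1 (fun c => val c) (conj_class_repr c).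
by rewrite /cclass_size {1}cE -index_cent1 finset.setTI mulnC Lagrange
  ?finset.subsetT // cardsT.
Qed.

Lemma cent_order_neq0 (c : cclass gT) : (cent_order c)%:R != 0 :> C.
Proof.
have := card_gT_neq0; rewrite -(cclass_sizeM c) natrM mulf_eq0 negb_or.
by case/andP.
Qed.

Lemma cclass_size_ratio (c : cclass gT) :
  (cclass_size c)%:R / #|gT|%:R = (cent_order c)%:R^-1 :> C.
Proof.
have := card_gT_neq0; rewrite -(cclass_sizeM c) natrM mulf_eq0 negb_or.
by case/andP => a b; field; rewrite a b.
Qed.

Lemma cf_reprE (f : classfun C gT) x : f (repr (val (conj_class x))) = f x.
Proof.
have [u uE] := conj_class_eq (esym (conj_class_repr (conj_class x))).
by rewrite uE cfJ.
Qed.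

Lemma sum_cclass (f : gT -> C) : (forall x y, f (x ^ y)%g = f x) ->
  #|gT|%:R^-1 * \sum_x f x = \sum_c (cent_order c)%:R^-1 * f (repr (val c)).
Proof.
move=> fJ; rewrite (partition_big (@conj_class gT) xpredT) //= mulr_sumr.
apply: eq_bigr => c _; rewrite (eq_bigr (fun=> f (repr (val c)))) =>
  [|x /eqP <-].
  move: (f _) => z; rewrite sumr_const -[z *+ _]mulr_natl mulrA.
  rewrite -cclass_size_ratio [_^-1 * _]mulrC.
  congr (_%:R / _ * _); apply: eq_card => x; rewrite mem_cclass.
  by [].
have [u uE] := conj_class_eq (esym (conj_class_repr (conj_class x))).
by rewrite uE fJ.
Qed.

Lemma irr_orthonormal_classes i j :
  \sum_c (cent_order c)%:R^-1 *
     (irr_char i (repr (val c)) * irr_char j (repr (val c))^-1%g) = (i == j)%:R.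
Proof.
rewrite -irr_orthonormal -(sum_cclass
  (f := fun x => irr_char i x * irr_char j x^-1%g)) //.
by move=> x y; rewrite -conjVg !cfJ.
Qed.

Lemma card_Irr : #|{: Irr}| = #|{: cclass gT}|.
Proof.
rewrite card_irr_pchar.
- by rewrite card_sig; apply: eq_card.
- exact: pchar'_group.
exact: group_closure_closed_field.
Qed.

(** The second orthogonality relation: a square matrix with a right inverse has
    it as a left inverse, and there are as many irreducible characters as
    classes. *)
Lemma second_orthogonality (c c' : cclass gT) :
  \sum_(i : Irr) irr_char i (repr (val c)) * irr_char i (repr (val c'))^-1%g =
  (cent_order c)%:R * (c == c')%:R.
Proof.
pose n := #|{: cclass gT}|.
have e : #|{: Irr}| = n by exact: card_Irr.
pose I (k : 'I_n) : Irr := enum_val (cast_ord (esym e) k).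
pose K (k : 'I_n) : cclass gT := enum_val k.
pose X : 'M[C]_n := \matrix_(k, l) irr_char (I k) (repr (val (K l))).
pose Y : 'M[C]_n := \matrix_(l, k)
  ((cent_order (K l))%:R^-1 * irr_char (I k) (repr (val (K l)))^-1%g).
have XY : X *m Y = 1%:M.
  apply/matrixP => k l; rewrite !mxE.
  have -> : (k == l) = (I k == I l) by rewrite (inj_eq enum_val_inj)
    (inj_eq (@cast_ord_inj _ _ _)).
  rewrite -irr_orthonormal_classes (reindex K) /=; last by apply: onW_bij;
    apply: enum_val_bij.
  by apply: eq_bigr => p _; rewrite !mxE mulrCA.
have /matrixP/(_ (enum_rank c') (enum_rank c)) := mulmx1C XY.
rewrite !mxE (inj_eq enum_rank_inj) eq_sym => E.
have := congr1 (fun z => (cent_order c')%:R * z) E => {}E.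
transitivity ((cent_order c')%:R * (c == c')%:R : C); last first.
  by case: eqP => [->|]; rewrite ?mulr0.
rewrite -E mulr_sumr (reindex I) /=; last first.
  apply: onW_bij; apply: bij_comp; first exact: enum_val_bij.
  by exists (cast_ord e) => k; rewrite ?cast_ordKV ?cast_ordK.
apply: eq_bigr => k _; rewrite !mxE /K !enum_rankK -mulrA mulVKf
  ?cent_order_neq0 //.
by rewrite mulrC.
Qed.

(** The coordinates in the basis of irreducible characters. *)
Definition cf_coords (f : classfun C gT) : {ffun Irr -> C} :=
  [ffun i => cf_form f (irr_char i)].

Lemma cf_addE (f g : classfun C gT) x : (f + g) x = f x + g x.
Proof. by rewrite /cf_fun -[cf_val (f + g)]/(val (f + g)) raddfD ffunE. Qed.

Lemma cf_scaleE a (f : classfun C gT) x : (a *: f) x = a * f x.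
Proof. by rewrite /cf_fun -[cf_val (a *: f)]/(val (a *: f)) linearZ ffunE. Qed.

Lemma cf_zeroE x : (0 : classfun C gT) x = 0.
Proof. by rewrite /cf_fun -[cf_val 0]/(val 0) raddf0 ffunE. Qed.

Lemma cf_sumE (I : Type) (r : seq I) (P : pred I) (F : I -> classfun C gT) x :
  (\sum_(i <- r | P i) F i) x = \sum_(i <- r | P i) F i x.
Proof.
exact: (big_morph (fun f : classfun C gT => f x) (fun f g => cf_addE f g x)
  (cf_zeroE x)).
Qed.

Lemma cf_ext (f g : classfun C gT) : (forall x, f x = g x) -> f = g.
Proof. by move=> E; apply: val_inj; apply/ffunP => x; apply: E. Qed.

Lemma cf_of_coordsE (a : {ffun Irr -> C}) x :
  cf_of_coords a x = \sum_i a i * irr_char i x.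
Proof. by rewrite cf_sumE; apply: eq_bigr => i _; rewrite cf_scaleE. Qed.

Lemma cf_coordsK f : cf_of_coords (cf_coords f) = f.
Proof.
apply: cf_ext => x; rewrite cf_of_coordsE -(cf_reprE f).
set c := conj_class x.
transitivity (\sum_d \sum_(i : Irr) (cent_order d)%:R^-1 * f (repr (val d)) *
    (irr_char i (repr (val c)) * irr_char i (repr (val d))^-1%g)).
  rewrite exchange_big /=; apply: eq_bigr => i _.
  rewrite ffunE /cf_form (sum_cclass (f := fun x => f x * irr_char i x^-1%g)).
    by rewrite mulr_suml (cf_reprE (irr_char i)); apply: eq_bigr => d _; ring.
  by move=> y z; rewrite -conjVg !cfJ.
under eq_bigr => d _ do rewrite -mulr_sumr second_orthogonality.
rewrite (bigD1 c) //= eqxx big1 ?addr0 => [|d /negbTE dc].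
  by rewrite mulr1 mulrAC mulVf ?mul1r ?cent_order_neq0.
by rewrite eq_sym dc !mulr0.
Qed.

(** Natural coordinates are those of a direct sum of irreducible
    representations. *)
Lemma repr_nat_coords (m : {ffun Irr -> nat}) :
  exists d (rG : mx_representation C [set: gT] d),
    repr_char rG = cf_of_coords [ffun i => (m i)%:R].
Proof.
pose chi (rG : character.representation C G) :=
  repr_char (character.mx_repr_of_repr rG).
have chiD r1 r2 : chi (character.dadd_grepr r1 r2) = chi r1 + chi r2.
  by apply: cf_ext => x; rewrite cf_addE !mkcfE /= mxtrace_block.
have chi0 : chi (@character.grepr0 _ _ _) = 0.
  by apply: cf_ext => x; rewrite cf_zeroE !mkcfE /= mxtrace1.
pose V := \big[@character.dadd_grepr C gT G/@character.grepr0 _ _ _]_(i : Irr)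
  \big[@character.dadd_grepr C gT G/@character.grepr0 _ _ _]_(k < m i)
    character.Representation (irr_repr i).
exists _, (character.mx_repr_of_repr V).
rewrite -/(chi V) /V (big_morph chi chiD chi0); apply: eq_bigr => i _.
rewrite (big_morph chi chiD chi0) sumr_const card_ord ffunE scaler_nat.
by [].
Qed.

End Irreducibles.

(** * Tensor powers and products over cycles *)

Section OrbitProd.
Variables (C : numClosedFieldType) (gT : finGroupType).
Local Notation G n := (wreath gT n).
Local Notation J := (nat * cclass gT)%type.

(** The product over the cycles of x of a function w of their types. *)
Definition orbit_prod n (w : J -> C) (x : G n) : C :=
  \prod_(o in porbits (wperm x)) w (orbit_type x o).

Lemma orbit_prodJ n w (x y : G n) : orbit_prod w (x ^ y)%g = orbit_prod w x.
Proof. exact: big_orbits_conj. Qed.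

Lemma orbit_prod0 w (x : G 0) : orbit_prod w x = 1.
Proof. exact: big_orbits0. Qed.

Lemma orbit_prod_wembed w k m n (e : (k + m)%N = n) (p : G k * G m) :
  orbit_prod w (wembed e p) = orbit_prod w p.1 * orbit_prod w p.2.
Proof. exact: big_orbits_wembed. Qed.

Lemma orbit_prod_std w k g : orbit_prod w (std_cycle k g) = w (k, conj_class g).
Proof. exact: big_orbits_std. Qed.

Lemma orbit_prodM n w w' (x : G n) :
  orbit_prod w x * orbit_prod w' x = orbit_prod (fun j => w j * w' j) x.
Proof. by rewrite /orbit_prod -big_split. Qed.

(** The product over the cycles of the values of f at the cycle-products, which
    turns out to be eta_n(f). *)
Definition eta_cf n (f : classfun C gT) : classfun C (G n) :=
  mkcf (@orbit_prodJ n (fun j => f (repr (val j.2)))).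

Section TensorTrace.
Variables (d : nat) (rG : mx_representation C [set: gT] d).

Lemma eta_charE n (x : G n) : eta_char n rG x =
  \sum_(b : {ffun 'I_n -> 'I_d})
     \prod_i rG (wbase x (wperm x i)) (b (wperm x i)) (b i).
Proof.
rewrite /eta_char mkcfE /mxtrace (reindex enum_rank) /=; last first.
  by apply: onW_bij; apply: enum_rank_bij.
apply: eq_bigr => b _; rewrite mxE /tens_basis !enum_rankK.
rewrite (reindex_inj (@perm_inj _ (wperm x))); apply: eq_bigr => i _.
by rewrite permK.
Qed.

Lemma eta_char_wembed k m n (e : (k + m)%N = n) (p : G k * G m) :
  eta_char n rG (wembed e p) = eta_char k rG p.1 * eta_char m rG p.2.
Proof.
rewrite !eta_charE big_distrlr pair_big /=.
pose h (b : {ffun 'I_k -> 'I_d} * {ffun 'I_m -> 'I_d}) : {ffun 'I_n -> 'I_d} :=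
  [ffun i => match isplit e i with inl a => b.1 a | inr a => b.2 a end].
have hb : bijective h.
  exists (fun b : {ffun 'I_n -> 'I_d} =>
    ([ffun a => b (ijoin e (inl a))], [ffun a => b (ijoin e (inr a))])).
    by move=> [b1 b2]; congr (_, _); apply/ffunP => a; rewrite !ffunE ijoinK.
  move=> b; apply/ffunP => i; rewrite !ffunE -{2}(isplitK e i).
  by case: (isplit e i) => a; rewrite ffunE.
rewrite (reindex h); last exact: onW_bij.
apply: eq_bigr => -[b1 b2] _ /=.
rewrite (reindex (ijoin e)) /=; last first.
  by apply: onW_bij; exists (isplit e); [exact: ijoinK|exact: isplitK].
rewrite big_sumType /=; congr (_ * _); apply: eq_bigr => a _.
  have := wembed_intertwines_l e p a; rewrite /wact /= mulg1 mul1g => -[-> ->].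
  by rewrite !ffunE !ijoinK.
have := wembed_intertwines_r e p a; rewrite /wact /= mulg1 mul1g => -[-> ->].
by rewrite !ffunE !ijoinK.
Qed.

(** The diagonal entries of the matrix of a standard cycle on a tensor power
    vanish except at the constant multi-indices. *)
Lemma eta_char_std k g : eta_char k.+1 rG (std_cycle k g) = \tr (rG g).
Proof.
rewrite eta_charE.
pose c (a : 'I_d) : {ffun 'I_k.+1 -> 'I_d} := [ffun=> a].
rewrite (bigID (fun b : {ffun 'I_k.+1 -> 'I_d} => b == c (b ord0))) /=.
have E i : wact (std_cycle k g) (i, 1%g) =
   (if (i < k)%N then (inord i.+1, 1%g) else (ord0, g)).
  case: ltnP => ik; first exact: wact_std_lt.
  have -> : i = ord_max by apply: val_inj; apply/eqP;
    rewrite eqn_leq ik -ltnS ltn_ord.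
  by rewrite wact_std_max mulg1.
have F (b : {ffun 'I_k.+1 -> 'I_d}) : 
  \prod_i rG (wbase (std_cycle k g) (wperm (std_cycle k g) i))
     (b (wperm (std_cycle k g) i)) (b i) =
  (\prod_(i < k) (b (inord i.+1) == b (inord i))%:R) *
    rG g (b ord0) (b ord_max).
  rewrite big_ord_recr /=; congr (_ * _).
    apply: eq_bigr => i _; have := E (widen_ord (leqnSn k) i).
    rewrite /wact /= ltn_ord mulg1 => -[-> ->].
    rewrite repr_mx1 mxE; congr ((_ == b _)%:R).
    by apply: val_inj; rewrite /= inordK // (leq_trans (ltn_ord i)).
  by have := E ord_max; rewrite /wact /= ltnn mulg1 => -[-> ->].
rewrite [X in _ + X]big1 ?addr0 => [|b nb]; last first.
  rewrite F; suff /forallPn[i ni] :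
    ~~ [forall i : 'I_k, b (inord i.+1) == b (inord i)].
    by rewrite (bigD1 i) //= (negbTE ni) !mul0r.
  apply: contra nb => /forallP H; apply/eqP/ffunP => i; rewrite ffunE.
  have K l : (l <= k)%N -> b (inord l) = b ord0.
    elim: l => [_|l IH lk]; first by congr (b _); apply: val_inj;
      rewrite /= inordK.
    by rewrite -IH ?(ltnW lk) //; apply/eqP; exact: (H (Ordinal lk)).
  by rewrite -(K i) ?inord_val // -ltnS.
rewrite (reindex_onto c (fun b => b ord0)) /=; last first.
  by move=> b /eqP ->; rewrite ffunE.
apply: eq_big => [a|a _]; first by rewrite /c ffunE !eqxx.
rewrite F big1 ?mul1r ?ffunE // => i _.
by rewrite !ffunE eqxx.
Qed.

(** The character of a tensor power is multiplicative for wembed and invariant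
    under conjugation, so standard cycles determine it. *)
Lemma eta_char_eq n : eta_char n rG = eta_cf n (repr_char rG).
Proof.
apply: cf_ext => x; rewrite [RHS]mkcfE.
elim/(@wreath_ind gT): n / x => [n x y IH|x|k m n e x g IH IHs|m g].
- by rewrite cfJ orbit_prodJ.
- rewrite orbit_prod0 eta_charE.
  under eq_bigr => b _ do rewrite big_ord0.
  by rewrite sumr_const card_ffun !card_ord expn0.
- by rewrite eta_char_wembed IH IHs orbit_prod_wembed.
rewrite eta_char_std orbit_prod_std.
exact: etrans (esym (mkcfE (repr_char_subproof rG) g))
  (esym (cf_reprE (repr_char rG) g)).
Qed.

End TensorTrace.

Section Stable.
Variables (n : nat) (x : G n).
Local Notation s := (wperm x).

Lemma stable_setC (A : {set 'I_n}) : stable x A -> stable x (~: A).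
Proof.
by move=> sA; apply/stableP => i; rewrite !inE (stable_mem _ sA).
Qed.

Lemma stable_orbitC (A : {set 'I_n}) o : stable x A -> o \in porbits s ->
  ~~ (o \subset A) = (o \subset ~: A).
Proof.
move=> sA /imsetP[i _ ->].
have H (B : {set 'I_n}) : stable x B -> (porbit s i \subset B) = (i \in B).
  move=> sB; apply/idP/idP => [/subsetP|]; first by apply; apply: porbit_id.
  exact: stable_porbit.
by rewrite !H ?inE //; apply: stable_setC.
Qed.

Lemma card_stable (A : {set 'I_n}) : stable x A ->
  #|A| = (\sum_(o in porbits s | o \subset A) #|o|)%N.
Proof.
move=> sA; rewrite -sum1_card.
rewrite (partition_big (porbit s) (fun o =>
  (o \in porbits s) && (o \subset A))) /=.
  apply: eq_bigr => o /andP[/imsetP[j _ ->] jA]; rewrite -sum1_card.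
  apply: eq_bigl => i; rewrite eq_porbit_mem andb_idl // => ij.
  exact: (subsetP jA).
by move=> i iA; rewrite imset_f //=; apply: stable_porbit.
Qed.

(** Expansion of a product of binomials over the orbits: a set of orbits is the
    same as a stable subset. *)
Lemma sum_stable (b c : {set 'I_n} -> C) :
  \sum_(A : {set 'I_n} | stable x A)
    (\prod_(o in porbits s | o \subset ~: A) b o) *
    (\prod_(o in porbits s | o \subset A) c o) =
  \prod_(o in porbits s) (b o + c o).
Proof.
pose F o := if o \in porbits s then c o else 0.
pose H o := if o \in porbits s then b o else 1.
transitivity (\prod_o (F o + H o)); last first.
  rewrite [RHS]big_mkcond; apply: eq_bigr => o _; rewrite /F /H.
  by case: ifP => _; rewrite ?add0r // addrC.
rewrite bigA_distr (bigID (fun K : {set {set 'I_n}} => K \subset porbits s)) /=.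
rewrite [X in _ + X]big1 ?addr0 => [|K /subsetPn[o oK oP]]; last first.
  by rewrite (bigD1 o) //= oK /F (negbTE oP) mul0r.
rewrite (reindex_onto (fun A : {set 'I_n} => [set o in porbits s | o \subset A])
  (fun K => finset.cover K)) /=; last first.
  move=> K sK; apply/setP => o; rewrite inE; apply/andP/idP => [[oP oK]|oK].
    case/imsetP: (oP) => i _ oE; have : i \in finset.cover K.
      by apply: (subsetP oK); rewrite oE porbit_id.
    case/finset.bigcupP => o' o'K io';
      have /imsetP[j _ o'E] := subsetP sK _ o'K.
    by move: io'; rewrite o'E -eq_porbit_mem -oE -o'E => /eqP ->.
  by split; [exact: (subsetP sK) | exact: finset.bigcup_sup oK].
apply: eq_big => [A|A sA].
  rewrite (_ : _ \subset _) /=; last by apply/subsetP => o;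
    rewrite inE => /andP[].
  apply/idP/eqP => [sA|<-].
    apply/setP => i; apply/finset.bigcupP/idP => [[o]|iA].
      by rewrite inE => /andP[_ /subsetP oA] /oA.
    by exists (porbit s i); rewrite ?porbit_id // inE imset_f //=;
      apply: stable_porbit.
  apply/stableP => i /finset.bigcupP[o oK io]; apply/finset.bigcupP;
    exists o => //.
  move: oK; rewrite inE => /andP[/imsetP[j _ oE] _]; move: io; rewrite oE.
  by rewrite -!eq_porbit_mem => /eqP <-;
    rewrite -[s i]/((s ^+ 1)%g i) porbit_perm.
rewrite [RHS](bigID (mem (porbits s))) /= [X in _ = _ * X]big1 ?mulr1;
  last first.
  by move=> o oP; rewrite inE (negbTE oP) /H (negbTE oP).
rewrite [RHS](bigID (fun o : {set 'I_n} => o \subset A)) /= mulrC;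
  congr (_ * _).
  by apply: eq_bigr => o /andP[oP oA]; rewrite inE oP oA /F oP.
rewrite [LHS](eq_bigl (fun o : {set 'I_n} =>
  (o \in porbits s) && ~~ (o \subset A))).
  by apply: eq_bigr => o /andP[oP /negbTE oA]; rewrite inE oP oA /H oP.
by move=> o /=; apply: andb_id2l => oP; rewrite (stable_orbitC sA oP).
Qed.

Lemma sign_orbits : (-1) ^+ odd_perm s =
  orbit_prod (fun j => (-1) ^+ j.1) x :> C.
Proof.
have sT : stable x [set: 'I_n] by apply/stableP => i; rewrite !inE.
have nE : n = (\sum_(o in porbits s) #|o|)%N.
  rewrite -[LHS]card_ord -cardsT (card_stable sT); apply: eq_bigl => o.
  by rewrite finset.subsetT andbT.
have -> : (-1) ^+ odd_perm s = (-1) ^+ (n + #|porbits s|) :> C.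
  by rewrite -[RHS]signr_odd oddD /odd_perm card_ord.
rewrite {1}nE -sum1_card -big_split /=.
rewrite (big_morph (fun k => (-1) ^+ k) (exprD (-1 : C)) (expr0 (-1 : C))).
apply: eq_bigr => o oP; rewrite (orbit_type_card oP) addn1 !exprS.
by rewrite !mulN1r opprK.
Qed.

End Stable.

End OrbitProd.

(** * Determination of the map eta *)

Section MonEval.
Variables (I : choiceType) (S : comNzRingType) (a : I -> S).

(** The value at a of the monomial m. *)
Definition mon_eval (m : {cmonom I}) : S := \prod_(i <- finsupp m) a i ^+ m i.

Lemma mon_evalEw (D : {fset I}) (m : {cmonom I}) : (finsupp m `<=` D)%fset ->
  mon_eval m = \prod_(i <- D) a i ^+ m i.
Proof.
move=> sD; rewrite /mon_eval (big_fset_incl _ sD) // => i _.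
by rewrite -cmE_eq0 => /eqP->.
Qed.

Lemma mon_eval_mmorphism : mmorphism mon_eval.
Proof.
split=> [m1 m2|]; last by rewrite /mon_eval mdom1 big_nil.
rewrite (mon_evalEw (fsubsetUl (finsupp m1) (finsupp m2))).
rewrite (mon_evalEw (fsubsetUr (finsupp m1) (finsupp m2))).
rewrite (@mon_evalEw (finsupp m1 `|` finsupp m2)%fset (mmul m1 m2)) ?mdomD //.
by rewrite -big_split; apply: eq_bigr => i _ /=; rewrite cmM exprD.
Qed.

HB.instance Definition _ :=
  isMultiplicative.Build {cmonom I} S mon_eval mon_eval_mmorphism.

Lemma mon_evalU i : mon_eval (ucm i) = a i.
Proof. by rewrite /mon_eval mdomU big_seq_fset1 cmUU expr1. Qed.

End MonEval.

Lemma mon_eval_fin (I : finType) (S : comNzRingType) (a : I -> S) m :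
  mon_eval a m = \prod_i a i ^+ m i.
Proof.
rewrite (@mon_evalEw _ _ _ [fset i in I]%fset); last first.
  by apply/fsubsetP => i _; rewrite !inE.
rewrite big_imfset //=.
by rewrite big_enum.
Qed.

Section CoordwisePolynomial.
Variables (C : numFieldType) (I : finType).

(** A function of several variables is polynomial in each of them. *)
Definition coord_polynomial (f : {ffun I -> C} -> C) :=
  forall (i : I) (a : {ffun I -> C}), exists q : {poly C},
  forall t, f [ffun j => if j == i then t else a j] = q.[t].

Lemma coord_polynomial_sub f g : coord_polynomial f -> coord_polynomial g ->
  coord_polynomial (fun a => f a - g a).
Proof.
move=> Pf Pg i a; have [p pE] := Pf i a; have [q qE] := Pg i a.
by exists (p - q) => t; rewrite pE qE hornerD hornerN.
Qed.

Lemma coord_polynomial_mmap (p : {malg C[{cmonom I}]}) :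
  coord_polynomial (fun a => mmap idfun (mon_eval a) p).
Proof.
move=> i a.
exists (\sum_(m <- msupp p) p@_m *:
   \prod_j (if j == i then 'X^(m j) else (a j ^+ m j)%:P)) => t.
rewrite horner_sum mmapE; apply: eq_bigr => m _; rewrite hornerZ; congr (_ * _).
rewrite mon_eval_fin horner_prod; apply: eq_bigr => j _; rewrite ffunE.
by case: ifP => _; rewrite ?hornerXn ?hornerC.
Qed.

Lemma poly_nat_roots (q : {poly C}) : (forall n : nat, q.[n%:R] = 0) -> q = 0.
Proof.
move=> q0; apply/eqP; apply: contraT => nq.
have := max_poly_roots (rs := [seq k%:R | k <- iota 0 (size q)]) nq.
rewrite size_map size_iota ltnn; apply.
  by apply/allP => _ /mapP[k _ ->]; rewrite rootE q0.
rewrite map_inj_uniq ?iota_uniq // => k l /eqP.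
by rewrite eqr_nat => /eqP.
Qed.

(** A function polynomial in each variable which vanishes at the points with
    natural coordinates is zero.  The coordinates are freed one at a time: s
    lists those which need not be natural. *)
Lemma coord_polynomial_eq0 f : coord_polynomial f ->
  (forall m : {ffun I -> nat}, f [ffun i => (m i)%:R] = 0) ->
  forall a, f a = 0.
Proof.
move=> Pf f0.
suff H (s : seq I) (a : {ffun I -> C}) :
    (forall i, i \notin s -> exists n : nat, a i = n%:R) -> f a = 0.
  by move=> a; apply: (H (enum I)) => i; rewrite mem_enum.
elim: s a => [|i s IH] a Ha.
  have [m mE] := fin_all_exists (fun i => Ha i isT).
  rewrite -(f0 [ffun i => m i]); congr f; apply/ffunP => i.
  by rewrite !ffunE mE.
have [q qE] := Pf i a.
have q0 : q = 0.
  apply: poly_nat_roots => n; rewrite -qE; apply: IH => j js; rewrite ffunE.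
  case: eqP => [_|/eqP ji]; first by exists n.
  by apply: Ha; rewrite inE negb_or ji.
rewrite (_ : a = [ffun j => if j == i then a i else a j]) ?qE ?q0 ?horner0 //.
by apply/ffunP => j; rewrite ffunE; case: eqP => [->|].
Qed.

End CoordwisePolynomial.

Section EtaIsEta.
Variables (C : numClosedFieldType) (gT : finGroupType).
Local Notation G n := (wreath gT n).

(** The induced characters in the definition of eta at a virtual character are
    sums over stable subsets A, and the signs (-1)^|A| and the signature of the
    restriction to A combine into one sign for each orbit contained in A. *)
Lemma eta_cf_virtual n d1 d2 (rB : mx_representation C [set: gT] d1)
    (rG : mx_representation C [set: gT] d2) :
  eta_cf n (repr_char rB - repr_char rG) = virtual_eta n rB rG.
Proof.
apply: cf_ext => x; rewrite mkcfE /virtual_eta cf_sumE.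
pose b (o : {set 'I_n}) := repr_char rB (repr (val (orbit_type x o).2)).
pose c (o : {set 'I_n}) := repr_char rG (repr (val (orbit_type x o).2)).
pose F (A : {set 'I_n}) := (\prod_(o in porbits (wperm x) | o \subset ~: A) b
  o) *
  (\prod_(o in porbits (wperm x) | o \subset A)
    ((-1) ^+ (orbit_type x o).1 * c o)).
have -> : orbit_prod (fun j => (repr_char rB - repr_char rG) (repr (val j.2)))
  x =
    \prod_(o in porbits (wperm x)) (b o + - c o).
  apply: eq_bigr => o _; rewrite cf_addE; congr (_ + _).
  by rewrite -scaleN1r cf_scaleE mulN1r.
rewrite -sum_stable.
transitivity (\sum_(m < n.+1) \sum_(A : {set 'I_n} | stable x A && (#|A| == m))
   (-1) ^+ m * F A).
  rewrite (partition_big (fun A : {set 'I_n} => inord #|A| : 'I_n.+1)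
    xpredT) //=.
  apply: eq_bigr => m _; rewrite [LHS](eq_bigl
    (fun A : {set 'I_n} => stable x A && (#|A| == m))); last first.
    move=> A; congr (_ && _); rewrite -val_eqE /= inordK //.
    by rewrite ltnS -[X in (_ <= X)%N]card_ord max_card.
  apply: eq_bigr => A /andP[sA /eqP <-].
  rewrite /F mulrCA; congr (_ * _); rewrite (card_stable sA).
  rewrite (big_morph (fun k => (-1) ^+ k) (exprD (-1 : C)) (expr0 (-1 : C)))
    -big_split /=.
  apply: eq_bigr => o /andP[oP _];
    rewrite (orbit_type_card oP) exprS mulN1r mulrA mulNr.
  by rewrite -exprD -signr_odd oddD addbb mulN1r.
apply: eq_bigr => m _; rewrite cf_scaleE mkcfE -mulr_sumr; congr (_ * _).
rewrite (ind_fun_stable (F := F)) // => y h hE.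
rewrite !eta_char_eq; congr (_ * _).
  rewrite mkcfE; exact: (big_orbits_l _
    (fun j => repr_char rB (repr (val j.2))) hE).
rewrite /eps_char mkcfE mkcfE sign_orbits eta_char_eq mkcfE orbit_prodM.
exact: (big_orbits_r _ (fun j => (-1) ^+ j.1 * repr_char rG (repr (val j.2)))
  hE).
Qed.

Lemma eta_cf_polynomial n : polynomial_map (@eta_cf C gT n).
Proof.
move=> x; pose L (c : cclass gT) : {malg C[{cmonom Irr C gT}]} :=
  \sum_i irr_char i (repr (val c)) *: << ucm i >>.
exists (\prod_(o in porbits (wperm x)) L (orbit_type x o).2) => a.
have -> : (fun m : {cmonom Irr C gT} => \prod_i a i ^+ m i) = mon_eval a.
  by apply: boolp.funext => m; rewrite mon_eval_fin.
rewrite rmorph_prod mkcfE; apply: eq_bigr => o _.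
rewrite cf_of_coordsE rmorph_sum; apply: eq_bigr => i _.
by rewrite /= mmapZ mmapU /= mul1r [mon_eval a _]mon_evalU mulrC.
Qed.

Lemma eta_cf_is_eta n : is_eta (@eta_cf C gT n).
Proof.
split; first exact: eta_cf_polynomial.
  by move=> d rG; rewrite eta_char_eq.
exact: eta_cf_virtual.
Qed.

Lemma polynomial_map_coord n (F : classfun C gT -> classfun C (G n)) x :
  polynomial_map F -> coord_polynomial (fun a => F (cf_of_coords a) x).
Proof.
move=> /(_ x)[p pE] i a; have [q qE] := coord_polynomial_mmap p i a.
exists q => t; rewrite pE -qE; congr (mmap _ _ p).
by apply: boolp.funext => m; rewrite mon_eval_fin.
Qed.

Lemma is_eta_unique n (F : classfun C gT -> classfun C (G n)) :
  is_eta F -> F = @eta_cf C gT n.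
Proof.
case=> PF RF _; apply: boolp.funext => f; apply: cf_ext => x.
rewrite -(cf_coordsK f); move: (cf_coords f) => a; apply/eqP; rewrite -subr_eq0.
apply/eqP; apply: (coord_polynomial_eq0
  (f := fun a => F (cf_of_coords a) x - eta_cf n (cf_of_coords a) x)).
  by apply: coord_polynomial_sub; apply: polynomial_map_coord => //;
    apply: eta_cf_polynomial.
move=> m; have [d [rG rE]] := repr_nat_coords m.
by rewrite -rE RF eta_char_eq subrr.
Qed.

Lemma etaE n f : eta n f = eta_cf n f :> classfun C (G n).
Proof.
rewrite /eta; case: xgetP => [F _ FP|/(_ (@eta_cf C gT n))[]].
  by rewrite (is_eta_unique FP).
exact: eta_cf_is_eta.
Qed.

End EtaIsEta.

(** * A pairing on a polynomial algebra *)

Lemma mul_linr (C : comNzRingType) (A : comAlgType C) (a : C) (x y z : A) :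
  x * (a *: y + z) = a *: (x * y) + x * z.
Proof. by rewrite mulrDr scalerAr. Qed.

Section MalgGenerators.
Variables (C : comNzRingType) (I : choiceType).
Local Notation S := {malg C[{cmonom I}]}.

Lemma mmap_lin (K : choiceType) (h : K -> C) :
  scalar (mmap idfun h : {malg C[K]} -> C).
Proof.
move=> a p q; rewrite raddfD /=; congr (_ + _).
rewrite (mmapEw (msuppZ_le a p)) mmapE mulr_sumr; apply: eq_bigr => m _.
by rewrite mcoeffZ /= mulrA.
Qed.

(** A linear property of polynomials stable under multiplication by the
    variables holds everywhere once it holds for 1. *)
Lemma malg_gen_ind (P : S -> Prop) : P 0 ->
  (forall a p q, P p -> P q -> P (a *: p + q)) -> P 1 ->
  (forall i p, P p -> P (<< ucm i >> * p)) -> forall p, P p.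
Proof.
move=> P0 Pl P1 Pm.
have Pm1 (m : {cmonom I}) : P << m >>; last first.
  apply: (@malg_lin_ind C I P P0) => a m p Pp.
  exact: (Pl a << m >> p (Pm1 m) Pp).
move: {2}(mdeg m) (erefl (mdeg m)) => n; elim: n m => [|n IH] m mn.
  by have -> : m = mone by exact: mdeg_eq0I.
have [i mi] : exists i, m i != 0%N.
  apply/not_existsP => H; suff m1 : m = mone by rewrite m1 mdeg1 in mn.
  by apply/eqP/cmP => i; have /negP := H i; rewrite negbK cm1 => /eqP.
have mE : m = mulcm (ucm i) (divcm m (ucm i)).
  apply/eqP/cmP => j; rewrite mulcmE divcmE ucmE.
  by case: eqP => [<-|_]; rewrite ?subn0 // addnC subnK // lt0n.
have -> : << m >> = << ucm i >> * << divcm m (ucm i) >> :> S.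
  by rewrite {1}mE; apply/esym; apply: monM.
by apply: Pm; apply: IH; move: mn; rewrite {1}mE [mdeg _]mdegM mdegU => -[].
Qed.

Lemma derivation1 (d : I -> C) : derivation d 1 = 0.
Proof. by rewrite derivationU /mon_deriv mdom1 big_nil. Qed.

Lemma derivation0 (d : I -> C) : derivation d 0 = 0.
Proof. by have := derivation_linear d (-1) 0 0;
  rewrite scaler0 addr0 scaleN1r addNr. Qed.

End MalgGenerators.

Section Pairing.
Variables (C : numFieldType) (J : choiceType) (tau : J -> J) (q : J -> C).
Hypotheses (tauK : involutive tau) (qtau : forall j, q (tau j) = q j).
Local Notation P := {malg C[{cmonom J}]}.

(** The value of the pairing of a monomial with its image under tau. *)
Definition mon_weight (m : {cmonom J}) : C :=
  \prod_(j <- finsupp m) ((m j)`!%:R * q j ^+ m j).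

Lemma mon_weightEw (D : {fset J}) (m : {cmonom J}) : (finsupp m `<=` D)%fset ->
  mon_weight m = \prod_(j <- D) ((m j)`!%:R * q j ^+ m j).
Proof.
move=> sD; rewrite /mon_weight (big_fset_incl _ sD) // => i _.
by rewrite -cmE_eq0 => /eqP->; rewrite mulr1.
Qed.

Lemma mon_weightU (m : {cmonom J}) j :
  mon_weight (mulcm (ucm j) m) = (m j).+1%:R * q j * mon_weight m.
Proof.
pose D := (j |` finsupp m)%fset.
have jD : j \in D by rewrite !inE eqxx.
rewrite (@mon_weightEw D) ?[in RHS](@mon_weightEw D) ?fsubsetUr //; last first.
  by rewrite (mdomD (ucm j) m) mdomU.
rewrite !(big_fsetD1 j jD) /= mulcmE ucmE eqxx add1n factS natrM exprS.
rewrite (eq_big_seq (fun i => (m i)`!%:R * q i ^+ m i)).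
  by rewrite [LHS]*%R.[AC (2*2*1) (1*3*(2*4*5))%AC].
move=> i; rewrite in_fsetD1 => /andP[ij _].
by rewrite mulcmE ucmE eq_sym (negbTE ij).
Qed.

(** A monomial m pairs only with the monomial obtained by applying tau to its
    variables. *)
Definition mon_pairing (m m' : {cmonom J}) : C :=
  if `[< forall j, m' (tau j) = m j >] then mon_weight m else 0.

Lemma mon_pairingC m m' : mon_pairing m m' = mon_pairing m' m.
Proof.
rewrite /mon_pairing.
have E : (forall j, m' (tau j) = m j) <-> (forall j, m (tau j) = m' j).
  by split=> H j; rewrite -H tauK.
case: asboolP => [H|H]; case: asboolP => [H'|H'] //; last 2 first.
- by case: H'; apply/E.
- by case: H; apply/E.
rewrite /mon_weight.
have -> : finsupp m' = [fset tau j | j in finsupp m]%fset.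
  apply/fsetP => j; rewrite -cmE_neq0; apply/idP/imfsetP => [mj|[i im ->]] /=.
    by exists (tau j); rewrite ?tauK // -cmE_neq0 H'.
  by rewrite H cmE_neq0.
rewrite big_imfset /=; last by move=> i j _ _; apply: (can_inj tauK).
by apply: eq_bigr => j _; rewrite H qtau.
Qed.

Lemma mon_pairingU j m m' :
  mon_pairing (mulcm (ucm j) m) m' =
  (m' (tau j))%:R * q j * mon_pairing m (divcm m' (ucm (tau j))).
Proof.
rewrite /mon_pairing.
have [m0|m0] := eqVneq (m' (tau j)) 0%N.
  rewrite m0 !mul0r; case: asboolP => // /(_ j).
  by rewrite m0 mulcmE ucmE eqxx.
have E : (forall i, m' (tau i) = mulcm (ucm j) m i) <->
         (forall i, divcm m' (ucm (tau j)) (tau i) = m i).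
  have A i : divcm m' (ucm (tau j)) (tau i) = (m' (tau i) - (j == i))%N.
    by rewrite divcmE ucmE (inj_eq (can_inj tauK)).
  split=> H i; first by rewrite A H mulcmE ucmE addKn.
  rewrite mulcmE ucmE -H A subnKC //.
  by case: eqP => [<-|//]; rewrite lt0n.
case: asboolP => [H|H]; case: asboolP => [H'|H'].
- by rewrite mon_weightU H mulcmE ucmE eqxx add1n.
- by case: H'; apply/E.
- by case: H; apply/E.
by rewrite mulr0.
Qed.

(** The bilinear extension of mon_pairing. *)
Definition pairing (u v : P) : C :=
  mmap idfun (fun m => mmap idfun (mon_pairing m) v) u.

Lemma pairing_linl v : scalar (pairing^~ v).
Proof. exact: mmap_lin. Qed.

Lemma pairingC u v : pairing u v = pairing v u.
Proof.
rewrite /pairing !mmapE.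
under eq_bigr => m _ do rewrite mmapE mulr_sumr.
rewrite exchange_big /=; apply: eq_bigr => m _; rewrite mmapE mulr_sumr.
by apply: eq_bigr => m' _; rewrite mulrCA mon_pairingC.
Qed.

Lemma pairing_linr u : scalar (pairing u).
Proof. by move=> a v w; rewrite ![pairing u _]pairingC pairing_linl. Qed.

Lemma pairingU m m' : pairing << m >> << m' >> = mon_pairing m m'.
Proof. by rewrite /pairing !mmapU /= !mul1r. Qed.

(** The derivation mapping the variable tau j to q j and the others to 0. *)
Definition pairing_deriv (j : J) : P -> P :=
  derivation (fun i => (i == tau j)%:R * q j).

Lemma pairing_derivU j m : pairing_deriv j << m >> =
  ((m (tau j))%:R * q j) *: << divcm m (ucm (tau j)) >>.
Proof.
rewrite /pairing_deriv derivationU /mon_deriv.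
have [mj|mj] := boolP (tau j \in finsupp m); last first.
  have /eqP-> : m (tau j) == 0%N by rewrite cmE_eq0.
  rewrite mul0r scale0r big_seq big1 // => i im.
  case: eqP => [ij|_]; last by rewrite mul0r mulr0 scale0r.
  by rewrite -ij im in mj.
rewrite (big_fsetD1 _ mj) /= eqxx mul1r big_seq big1 ?addr0 // => i.
by rewrite in_fsetD1 => /andP[/negbTE-> _]; rewrite mul0r mulr0 scale0r.
Qed.

Lemma pairing_adjointl j u v :
  pairing (<< ucm j >> * u) v = pairing u (pairing_deriv j v).
Proof.
have pl0 w : pairing 0 w = 0 by rewrite /pairing mmap0.
have pr0 w : pairing w 0 = 0 by rewrite pairingC.
have p0 : << ucm j >> * 0 = 0 :> P by exact: mulr0.
have d0 : pairing_deriv j 0 = 0 by exact: derivation0.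
elim/malg_lin_ind: u => [|a m u IH].
  exact: etrans (congr1 (pairing^~ v) p0) (etrans (pl0 _) (esym (pl0 _))).
apply: etrans (congr1 (pairing^~ v)
  (mul_linr (A := P) a << ucm j >> << m >> u)) _.
apply: etrans (pairing_linl v a _ _) (etrans _ (esym (pairing_linl _ a _ _))).
congr (_ + _); last exact: IH.
congr (a * _).
elim/malg_lin_ind: v {IH} => [|b m' v IHv].
  exact: etrans (pr0 _) (esym (etrans (congr1 (pairing << m >>) d0) (pr0 _))).
have dE : pairing_deriv j (b *: << m' >> + v) =
    b *: pairing_deriv j << m' >> +
      pairing_deriv j v by exact: derivation_linear.
apply: etrans (pairing_linr _ b _ _) _.
apply: etrans _ (esym (congr1 (pairing << m >>) dE)).
apply: etrans _ (esym (pairing_linr _ b _ _)).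
congr (_ + _); last exact: IHv.
congr (b * _).
have mE : << ucm j >> * << m >> = << mulcm (ucm j) m >> :> P by exact: monM.
apply: etrans (congr1 (pairing^~ << m' >>) mE) _.
apply: etrans (pairingU _ _) _.
apply: etrans (mon_pairingU j m m') _.
apply: etrans _ (esym (congr1 (pairing << m >>) (pairing_derivU j m'))).
have pz c w : pairing << m >> (c *: w) = c * pairing << m >> w.
  by have := pairing_linr << m >> c w 0; rewrite pr0 addr0 addr0.
by rewrite pz pairingU.
Qed.

Lemma pairing_adjointr j u v :
  pairing (pairing_deriv j u) v = pairing u (<< ucm j >> * v).
Proof. by rewrite pairingC -pairing_adjointl pairingC. Qed.

Lemma pairing11 : pairing 1 1 = 1.
Proof.
rewrite pairingU /mon_pairing; case: asboolP => [_|[]].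
  by rewrite /mon_weight mdom1 big_nil.
by move=> j; rewrite !cm1.
Qed.

End Pairing.

(** * Linear maps on polynomial algebras *)

Section LinearSums.
Variables (C : comNzRingType).

Lemma linear_at0 (U V : lmodType C) (f : U -> V) : linear f -> f 0 = 0.
Proof.
by move=> lf; have := lf (-1) 0 0; rewrite scaler0 addr0 scaleN1r addNr.
Qed.

Lemma linear_sumZ (U V : lmodType C) (f : U -> V) (lf : linear f)
    (T : Type) (r : seq T) (F : T -> C) (p : T -> U) :
  f (\sum_(t <- r) F t *: p t) = \sum_(t <- r) F t *: f (p t).
Proof.
elim: r => [|t r IH]; first by rewrite !big_nil linear_at0.
by rewrite !big_cons lf IH.
Qed.

Lemma scalar_sumZ (U : lmodType C) (f : U -> C) (lf : scalar f)
    (T : Type) (r : seq T) (F : T -> C) (p : T -> U) :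
  f (\sum_(t <- r) F t *: p t) = \sum_(t <- r) F t * f (p t).
Proof. exact: (linear_sumZ (V := C^o)). Qed.

Lemma scale_sum_sum (V : lmodType C) (I J : finType) (x : I -> C)
  (w : I -> J -> C)
    (y : J -> V) :
  \sum_i x i *: (\sum_j w i j *: y j) = \sum_j (\sum_i x i * w i j) *: y j.
Proof.
under eq_bigr => i _ do rewrite scaler_sumr.
rewrite exchange_big; apply: eq_bigr => j _ /=; rewrite scaler_suml.
by apply: eq_bigr => i _; rewrite scalerA.
Qed.

Lemma scale_sum_const (V : lmodType C) (I : finType) (x w : I -> C) (y : V) :
  \sum_i x i *: (w i *: y) = (\sum_i x i * w i) *: y.
Proof. by rewrite scaler_suml; apply: eq_bigr => i _; rewrite scalerA. Qed.

Lemma scale_sum_delta (V : lmodType C) (J : finType) (w : J -> C) (y : J -> V)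
  j0 :
  (forall j, w j = (j0 == j)%:R) -> \sum_j w j *: y j = y j0.
Proof.
move=> wE; rewrite (bigD1 j0) //= wE eqxx scale1r big1 ?addr0 // =>
  j /negbTE nj.
by rewrite wE eq_sym nj scale0r.
Qed.

Lemma linear_sum_expand (U V : lmodType C) (f : U -> V) (lf : linear f)
    (I J : finType) (x : I -> C) (p : I -> U) (w : I -> J -> C) (y : J -> V) :
  (forall i, f (p i) = \sum_j w i j *: y j) ->
  f (\sum_i x i *: p i) = \sum_j (\sum_i x i * w i j) *: y j.
Proof.
move=> fE; rewrite (linear_sumZ lf) -scale_sum_sum.
by apply: eq_bigr => i _; rewrite fE.
Qed.

Lemma eq_scale_sum (V : lmodType C) (J : finType) (w w' : J -> C) (y : J -> V) :
  w =1 w' -> \sum_j w j *: y j = \sum_j w' j *: y j.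
Proof. by move=> E; apply: eq_bigr => j _; rewrite E. Qed.

Lemma linear_sum_line (U V : lmodType C) (f : U -> V) (lf : linear f)
    (I : finType) (x : I -> C) (p : I -> U) (w : I -> C) (y : V) :
  (forall i, f (p i) = w i *: y) ->
  f (\sum_i x i *: p i) = (\sum_i x i * w i) *: y.
Proof.
move=> fE; rewrite (linear_sumZ lf) -scale_sum_const.
by apply: eq_bigr => i _; rewrite fE.
Qed.

Lemma leibniz_sum (A : comAlgType C) (I : finType) (w : I -> C) (d d' : I -> A)
  (p q : A) :
  \sum_i w i *: (d i * q + p * d' i) =
    (\sum_i w i *: d i) * q + p * (\sum_i w i *: d' i).
Proof.
rewrite mulr_suml mulr_sumr -big_split; apply: eq_bigr => i _ /=.
by rewrite scalerDr scalerAl scalerAr.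
Qed.

Lemma sum_scale_mul (A : comAlgType C) (I : finType) (w : I -> C) (d : I -> A)
  (q : A) :
  (\sum_i w i *: d i) * q = \sum_i w i *: (d i * q).
Proof. by rewrite mulr_suml; apply: eq_bigr => i _; rewrite scalerAl. Qed.

Lemma sum_scale_linear (U V : lmodType C) (I : finType) (w : I -> C)
  (f : I -> U -> V) :
  (forall i, linear (f i)) -> linear (fun u => \sum_i w i *: f i u).
Proof.
move=> lf a u v; rewrite scaler_sumr -big_split; apply: eq_bigr => i _ /=.
by rewrite lf scalerDr !scalerA mulrC.
Qed.

Lemma linear_scale (U V : lmodType C) (f : U -> V) a u : linear f ->
  f (a *: u) = a *: f u.
Proof. by move=> lf; rewrite -[in LHS](addr0 (a *: u)) lf linear_at0 ?addr0.
  Qed.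

Lemma morph_leibniz (A B : comAlgType C) (f : A -> B) (d q p e : A) :
  linear f ->
  (forall u v, f (u * v) = f u * f v) -> f (d * q + p * e) =
    f d * f q + f p * f e.
Proof. by move=> lf fM; have := lf 1 (d * q) (p * e); rewrite !scale1r !fM. Qed.

Lemma leibniz_at1 (A : comAlgType C) (h : A -> A) :
  (forall p q, h (p * q) = h p * q + p * h q) -> h 1 = 0.
Proof.
move=> hM; have := hM 1 1; rewrite !mulr1 mul1r => /eqP.
by rewrite -[X in X == _]addr0 => /eqP/addrI.
Qed.

End LinearSums.

Section MalgEval.
Variables (C : comNzRingType) (I : choiceType) (S : comAlgType C) (a : I -> S).
Local Notation P := {malg C[{cmonom I}]}.

(** The algebra morphism substituting a i for the variable i. *)
Definition malg_eval (p : P) : S := mmap (in_alg S) (mon_eval a) p.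

Lemma malg_evalM p q : malg_eval (p * q) = malg_eval p * malg_eval q.
Proof. exact: (rmorphM (mmap (in_alg S) (mon_eval a))). Qed.

Lemma malg_eval1 : malg_eval 1 = 1.
Proof. exact: (rmorph1 (mmap (in_alg S) (mon_eval a))). Qed.

Lemma malg_eval_linear : linear malg_eval.
Proof.
move=> c p q; rewrite /malg_eval mmapD; congr (_ + _).
by rewrite mmapZ /= -scalerAl mul1r.
Qed.

Lemma malg_evalU m : malg_eval << m >> = mon_eval a m.
Proof. by rewrite /malg_eval mmapU /= scale1r mul1r. Qed.

End MalgEval.

Section MalgExt.
Variables (C : comNzRingType) (I : choiceType).
Local Notation P := {malg C[{cmonom I}]}.

Lemma malg_morph_id (f : P -> P) : linear f -> f 1 = 1 ->
  (forall p q, f (p * q) = f p * f q) ->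
  (forall i, f << ucm i >> = << ucm i >>) -> forall p, f p = p.
Proof.
move=> lf f1 fM fU; apply: (@malg_gen_ind C I (fun p => f p = p)).
- exact: (linear_at0 lf).
- move=> c p q pE qE.
  exact: etrans (lf c p q) (congr2 (fun x y => c *: x + y) pE qE).
- exact: f1.
move=> i p pE.
exact: etrans (fM _ _) (congr2 (fun x y => x * y) (fU i) pE).
Qed.

(** Derivations are determined by their values on the variables. *)
Lemma malg_leibniz_ext (f g : P -> P) : linear f -> linear g ->
  (forall p q, f (p * q) = f p * q + p * f q) ->
  (forall p q, g (p * q) = g p * q + p * g q) ->
  (forall i, f << ucm i >> = g << ucm i >>) -> forall p, f p = g p.
Proof.
move=> lf lg fM gM E; apply: (@malg_gen_ind C I (fun p => f p = g p)).
- exact: etrans (linear_at0 lf) (esym (linear_at0 lg)).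
- move=> c p q pE qE; apply: etrans (lf c p q) (etrans _ (esym (lg c p q))).
  exact: (congr2 (fun x y => c *: x + y) pE qE).
- exact: etrans (leibniz_at1 fM) (esym (leibniz_at1 gM)).
move=> i p pE; apply: etrans (fM _ _) (etrans _ (esym (gM _ _))).
exact: (congr2 (fun x y => x * p + << ucm i >> * y) (E i) pE).
Qed.

Lemma malgC_scale (c : C) : c%:MP = c *: 1 :> P.
Proof. exact: etrans (esym (mulr1 _)) (mul_malgC c 1). Qed.

End MalgExt.

(** * The Fock form in the variables of the classes *)

Section ClassInverse.
Variable gT : finGroupType.
Implicit Type c : cclass gT.

(** The class of the inverses of the elements of c. *)
Definition cclass_inv c : cclass gT := conj_class (repr (val c))^-1%g.

Lemma cclass_inv_class (g : gT) : cclass_inv (conj_class g) = conj_class g^-1%g.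
Proof.
have [u uE] := conj_class_eq (conj_class_repr (conj_class g)).
by rewrite [in RHS]uE -conjVg conj_classJ.
Qed.

Lemma cclass_invK : involutive cclass_inv.
Proof. by move=> c; rewrite [cclass_inv c]/cclass_inv cclass_inv_class invgK
  conj_class_repr. Qed.

Lemma conj_class_repr_inv c : conj_class (repr (val c)^-1%g) = cclass_inv c.
Proof.
have H (g : gT) : (g \in (val c)^-1%g) = (conj_class g == cclass_inv c).
  rewrite mem_invg mem_cclass -cclass_inv_class.
  by rewrite (can2_eq cclass_invK cclass_invK).
apply/eqP; rewrite -H; apply: mem_repr (_ : (repr (val c))^-1%g \in _).
by rewrite mem_invg invgK mem_cclass conj_class_repr.
Qed.

Lemma cent_order_class (g : gT) : cent_order (conj_class g) = #|'C[g]%g|.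
Proof.
have [u uE] := conj_class_eq (conj_class_repr (conj_class g)).
by rewrite [in RHS]uE -conjg_set1 normJ cardJg.
Qed.

Lemma cent_order_inv c : cent_order (cclass_inv c) = cent_order c.
Proof.
by rewrite {1}/cclass_inv cent_order_class /cent_order -!cent_cycle cycleV.
Qed.

End ClassInverse.

Section Theta.
Variables (C : numClosedFieldType) (gT : finGroupType).
Local Notation J := (nat * cclass gT)%type.
Local Notation PJ := {malg C[{cmonom J}]}.
Local Notation SG := (SGamma C gT).

Lemma cf_class_repr (f : classfun C gT) g h : conj_class g = conj_class h ->
  f g = f h.
Proof. by case/conj_class_eq => u ->; rewrite cfJ. Qed.

Lemma cf_reprV (f : classfun C gT) (c : cclass gT) : f (repr (val c)^-1%g) =
  f (repr (val c))^-1%g.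
Proof. by apply: cf_class_repr; rewrite conj_class_repr_inv. Qed.

(** The substitution of a_{-k-1}(c) for the variable (k, c). *)
Definition theta : PJ -> SG := malg_eval (fun j : J => a_class C j.1 j.2).

(** The inverse substitution, given by the inverse of the character table. *)
Definition theta_inv : SG -> PJ :=
  malg_eval (fun v : nat * Irr C gT =>
    \sum_c ((cent_order c)%:R^-1 * irr_char v.2 (repr (val c))) *: << ucm
      (v.1, c) >>).

Lemma theta_linear : linear theta. Proof. exact: malg_eval_linear. Qed.
Lemma theta_inv_linear : linear theta_inv. Proof. exact: malg_eval_linear. Qed.

Lemma thetaU k c : theta << ucm (k, c) >> = a_class C k c.
Proof. exact: etrans (malg_evalU _ _) (mon_evalU _ _). Qed.

Lemma theta_invU k i : theta_inv << ucm (k, i) >> =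
  \sum_c ((cent_order c)%:R^-1 * irr_char i (repr (val c))) *: << ucm (k, c) >>.
Proof. exact: etrans (malg_evalU _ _) (mon_evalU _ _). Qed.

Lemma theta_inv_a_neg k (x : {ffun Irr C gT -> C}) : theta_inv (a_neg k x) =
  \sum_c ((cent_order c)%:R^-1 * cf_of_coords x (repr (val c))) *: << ucm
    (k, c) >>.
Proof.
apply: etrans (linear_sum_expand theta_inv_linear _ (theta_invU k)) _.
apply: eq_scale_sum => c.
rewrite cf_of_coordsE mulr_sumr; apply: eq_bigr => i _; ring.
Qed.

Lemma a_class_coords (c d : cclass gT) :
  cf_of_coords [ffun i : Irr C gT => irr_char i (repr (val c)^-1%g)]
    (repr (val d)) =
  (cent_order c)%:R * (c == d)%:R.
Proof.
rewrite cf_of_coordsE; under eq_bigr => i _ do rewrite ffunE cf_reprV mulrC.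
by rewrite second_orthogonality eq_sym; case: eqP => [->|]; rewrite ?mulr0.
Qed.

Lemma thetaK : cancel theta theta_inv.
Proof.
move=> p; apply: (malg_morph_id (f := theta_inv \o theta)).
- by move=> a u v /=; rewrite theta_linear theta_inv_linear.
- exact: etrans (congr1 theta_inv (malg_eval1 _)) (malg_eval1 _).
- move=> u v; exact: etrans (congr1 theta_inv (malg_evalM _ _ _))
  (malg_evalM _ _ _).
move=> [k c] /=; apply: etrans (congr1 theta_inv (thetaU k c)) _.
apply: etrans (theta_inv_a_neg _ _) _.
apply: (scale_sum_delta (fun d => << ucm (k, d) >> : PJ)) => d.
rewrite a_class_coords.
case: eqP => [<-|]; rewrite ?mulr0 // mulr1 mulVf //.
exact: cent_order_neq0.
Qed.

Lemma theta_invK : cancel theta_inv theta.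
Proof.
move=> p; apply: (malg_morph_id (f := theta \o theta_inv)).
- by move=> a u v /=; rewrite theta_inv_linear theta_linear.
- exact: etrans (congr1 theta (malg_eval1 _)) (malg_eval1 _).
- move=> u v; exact: etrans (congr1 theta (malg_evalM _ _ _))
  (malg_evalM _ _ _).
move=> [k i] /=; apply: etrans (congr1 theta (theta_invU k i)) _.
apply: etrans (linear_sum_expand theta_linear _ (thetaU k)) _.
apply: (scale_sum_delta (fun l => << ucm (k, l) >> : SG)) => l.
rewrite -irr_orthonormal_classes; apply: eq_bigr => c _.
by rewrite ffunE cf_reprV mulrA.
Qed.

End Theta.

Section Fock.
Variables (C : numClosedFieldType) (gT : finGroupType).
Local Notation J := (nat * cclass gT)%type.
Local Notation PJ := {malg C[{cmonom J}]}.
Local Notation SG := (SGamma C gT).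
Variable xi : classfun C gT.
Hypothesis xi_self_dual : self_dual xi.

(** Inversion of the class of a variable. *)
Definition jinv (j : J) : J := (j.1, cclass_inv j.2).

(** The weight (k + 1) zeta_c xi(c) of the variable (k, c).  It is invariant
    under jinv because xi is self-dual. *)
Definition jnorm (j : J) : C :=
  j.1.+1%:R * (cent_order j.2)%:R * xi (repr (val j.2)).

Lemma jinvK : involutive jinv.
Proof. by case=> k c; rewrite /jinv /= cclass_invK. Qed.

Lemma jnorm_inv j : jnorm (jinv j) = jnorm j.
Proof.
rewrite /jnorm /= cent_order_inv; congr (_ * _).
by rewrite cf_reprE -xi_self_dual.
Qed.

Local Notation D k c := (pairing_deriv jinv jnorm (k, c)).
Local Notation w f c := ((cent_order c)%:R^-1 * f (repr (val c))).

Lemma a_posU k (f : classfun C gT) l c :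
  a_pos xi k f (a_class C l c) =
  (l.+1%:R * (k == l)%:R * (xi (repr (val (cclass_inv c))) *
    f (repr (val (cclass_inv c))))) *: 1.
Proof.
pose d v := (k.+1%:R * (k == v.1)%:R * wform xi f (irr_char v.2)) : C.
have E i : derivation d << ucm (l, i) >> = d (l, i) *: 1.
  exact: etrans (derivation_var _ _) (malgC_scale _ _).
apply: etrans (linear_sum_line (derivation_linear d) _ E) _.
apply: (congr1 (fun z : C => z *: (1 : SG))).
rewrite /d /=; case: eqP => [<-|_]; last first.
  by rewrite !mulr0 mul0r big1 // => i _; rewrite mul0r mulr0.
rewrite mulr1; under eq_bigr => i _ do rewrite mulrCA.
rewrite -mulr_sumr; congr (_ * _).
transitivity (\sum_d (cent_order d)%:R^-1 *
  (xi (repr (val d)) * f (repr (val d))) *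
   (\sum_(i : Irr C gT) irr_char i (repr (val (cclass_inv c))) *
     irr_char i (repr (val d))^-1%g)).
  have W (i : Irr C gT) : wform xi f (irr_char i) =
    \sum_d (cent_order d)%:R^-1 *
      (xi (repr (val d)) * f (repr (val d)) * irr_char i (repr (val d))^-1%g).
    rewrite /wform /cf_form (sum_cclass
      (f := fun x => cf_mul xi f x * irr_char i x^-1%g)).
      by apply: eq_bigr => e _; rewrite mkcfE.
    by move=> x y; rewrite -conjVg !cfJ.
  under eq_bigr => i _ do rewrite W mulr_sumr.
  rewrite exchange_big; apply: eq_bigr => e _; rewrite mulr_sumr;
    apply: eq_bigr => i _ /=.
  rewrite ffunE (@cf_class_repr _ _ _ (repr (val c)^-1%g)
    (repr (val (cclass_inv c)))).
    by ring.
  by rewrite conj_class_repr_inv conj_class_repr.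
under eq_bigr => e _ do rewrite second_orthogonality.
rewrite (bigD1 (cclass_inv c)) //= eqxx mulr1 big1 ?addr0 => [|e /negbTE ec].
  rewrite mulrAC mulVf ?mul1r //; exact: cent_order_neq0.
by rewrite eq_sym ec !mulr0.
Qed.

(** In the variables of the classes, the annihilation operators are combinations
    of the derivations adjoint to the variables. *)
Lemma theta_inv_a_pos k (f : classfun C gT) (p : PJ) :
  theta_inv (a_pos xi k f (theta p)) = \sum_c w f c *: D k c p.
Proof.
pose g (p : PJ) := theta_inv (a_pos xi k f (theta p)).
pose h (p : PJ) := \sum_c w f c *: D k c p.
apply: (malg_leibniz_ext (f := g) (g := h)).
- move=> a u v.
  apply: etrans (congr1 (fun z => theta_inv (a_pos xi k f z))
    (theta_linear a u v)) _.
  apply: etrans (congr1 (@theta_inv C gT) (derivation_linear _ _ _ _)) _.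
  exact: theta_inv_linear.
- apply: (sum_scale_linear (U := PJ) (V := PJ)) => c; exact: derivation_linear.
- move=> u v.
  apply: etrans (congr1 (fun z => theta_inv (a_pos xi k f z))
    (malg_evalM _ u v)) _.
  apply: etrans (congr1 (@theta_inv C gT) (derivationM _ _ _)) _.
  apply: etrans (morph_leibniz _ _ _ _ (@theta_inv_linear C gT) (malg_evalM _))
    _.
  exact: (congr2 (fun x y => g u * x + y * g v) (thetaK v) (thetaK u)).
- move=> u v; apply: etrans _ (leibniz_sum _ _ _ _ _).
  apply: eq_bigr => c _.
  exact: (congr1 (fun z => w f c *: z) (derivationM _ u v)).
move=> [l c].
apply: etrans (congr1 (fun z => theta_inv (a_pos xi k f z)) (thetaU C l c)) _.
apply: etrans (congr1 (@theta_inv C gT) (a_posU k f l c)) _.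
apply: etrans (linear_scale _ _ (@theta_inv_linear C gT)) _.
apply: etrans (congr1 (fun z => _ *: z) (malg_eval1 _)) _.
pose z e := ((l, c) == jinv (k, e))%:R * jnorm (k, e).
have E e : D k e << ucm (l, c) >> = z e *: 1.
  exact: etrans (derivation_var _ _) (malgC_scale _ _).
apply: esym; apply: etrans (eq_bigr _
  (fun e _ => congr1 (fun v => w f e *: v) (E e))) _.
apply: etrans (scale_sum_const _ _ (1 : PJ)) _.
apply: (congr1 (fun y : C => y *: (1 : PJ))).
rewrite (bigD1 (cclass_inv c)) //= [X in _ + X]big1 ?addr0 => [|e ec];
  last first.
  rewrite /z /jinv /= xpair_eqE (_ : (c == cclass_inv e) = false) ?andbF ?mul0r
    ?mulr0 //.
  by apply/negbTE; apply: contra ec => /eqP->; rewrite cclass_invK.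
rewrite /z /jinv /= xpair_eqE cclass_invK eqxx andbT [k == l]eq_sym.
case: eqP => [->|_]; last by rewrite !mulr0 !mul0r mulr0.
rewrite /jnorm /=; field; exact: cent_order_neq0.
Qed.

Lemma theta_inv_mul_a_neg k (x : {ffun Irr C gT -> C}) (v : SG) :
  theta_inv (a_neg k x * v) =
  \sum_c w (cf_of_coords x) c *: (<< ucm (k, c) >> * theta_inv v).
Proof.
apply: etrans (malg_evalM _ _ _) _.
apply: etrans (congr1 (fun z => z * theta_inv v) (theta_inv_a_neg k x)) _.
exact: sum_scale_mul.
Qed.

(** The transport to S_Gamma of the pairing with involution jinv and weights
    jnorm. *)
Definition fock_pairing (u v : SG) : C :=
  pairing jinv jnorm (theta_inv u) (theta_inv v).

Local Notation pairC := (pairingC jinvK jnorm_inv).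

Lemma fock_pairingC u v : fock_pairing u v = fock_pairing v u.
Proof. exact: pairC. Qed.

Lemma fock_pairing_adjoint k (x : {ffun Irr C gT -> C}) u v :
  fock_pairing (a_pos xi k (cf_of_coords x) u) v =
    fock_pairing u (a_neg k x * v).
Proof.
have sl := @pairing_linl C _ jinv jnorm (theta_inv v).
have sr := pairing_linr jinvK jnorm_inv (theta_inv u).
have E1 : theta_inv (a_pos xi k (cf_of_coords x) u) =
    \sum_c w (cf_of_coords x) c *: D k c (theta_inv u).
  apply: etrans _ (theta_inv_a_pos k (cf_of_coords x) (theta_inv u)).
  exact: (congr1 (fun z => theta_inv (a_pos xi k (cf_of_coords x) z))
    (esym (theta_invK u))).
apply: etrans (congr1 (fun z => pairing jinv jnorm z (theta_inv v)) E1) _.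
apply: etrans (scalar_sumZ sl _ _ _) _.
apply: esym.
apply: etrans (congr1 (pairing jinv jnorm (theta_inv u))
  (theta_inv_mul_a_neg k x v)) _.
apply: etrans (scalar_sumZ sr _ _ _) _.
apply: eq_bigr => c _; congr (_ * _).
exact: esym (pairing_adjointr jinvK jnorm_inv _ _ _).
Qed.

Lemma fock_pairing_is_fock_form : is_fock_form xi fock_pairing.
Proof.
have lin v : scalar (fock_pairing^~ v).
  move=> a u u'; apply: etrans (congr1
    (fun z => pairing jinv jnorm z (theta_inv v)) (theta_inv_linear a u u')) _.
  exact: pairing_linl.
split.
- exact: lin.
- move=> u a v v'; apply: etrans (fock_pairingC _ _) (etrans (lin u a v v') _).
  exact: (congr2 (fun x y => a * x + y) (fock_pairingC _ _)
    (fock_pairingC _ _)).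
- apply: etrans (congr2 (pairing jinv jnorm) (malg_eval1 _) (malg_eval1 _)) _.
  exact: pairing11.
- exact: fock_pairing_adjoint.
move=> k x u v; apply: etrans (fock_pairingC _ _)
  (etrans _ (fock_pairingC _ _)).
exact: esym (fock_pairing_adjoint _ _ _ _).
Qed.

Lemma ucm_a_neg k (i : Irr C gT) :
  << ucm (k, i) >> = a_neg k [ffun j => (i == j)%:R] :> SG.
Proof.
apply: esym; apply: (scale_sum_delta (fun j => << ucm (k, j) >> : SG)) => j.
by rewrite ffunE.
Qed.

(** The adjunctions reduce the computation of a Fock form to its value at
    (1, 1). *)
Lemma is_fock_form_unique (B B' : SG -> SG -> C) :
  is_fock_form xi B -> is_fock_form xi B' -> forall u v, B u v = B' u v.
Proof.
move=> [l1 r1 o1 p1 n1] [l2 r2 o2 p2 n2].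
have z1 v : B 0 v = 0 by have := linear_at0 (V := C^o) (l1 v).
have z2 v : B' 0 v = 0 by have := linear_at0 (V := C^o) (l2 v).
apply: (@malg_gen_ind C _ (fun u => forall v, B u v = B' u v)).
- by move=> v; exact: etrans (z1 v) (esym (z2 v)).
- move=> a p q pE qE v; apply: etrans (l1 v a p q)
  (etrans _ (esym (l2 v a p q))).
  exact: (congr2 (fun x y => a * x + y) (pE v) (qE v)).
- apply: (@malg_gen_ind C _ (fun v => B 1 v = B' 1 v)).
  + apply: etrans (linear_at0 (V := C^o) (r1 1)) (esym _).
    exact: (linear_at0 (V := C^o) (r2 1)).
  + move=> a p q pE qE; apply: etrans (r1 1 a p q)
    (etrans _ (esym (r2 1 a p q))).
    exact: (congr2 (fun x y => a * x + y) pE qE).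
  + exact: etrans o1 (esym o2).
  move=> [k i] v _.
  have E : << ucm (k, i) >> * v = a_neg k [ffun j => (i == j)%:R] * v :> SG.
    exact: (congr1 (fun z => z * v) (ucm_a_neg k i)).
  have D1 : a_pos xi k (cf_of_coords [ffun j => (i == j)%:R]) 1 =
    0 by exact: derivation1.
  apply: etrans (congr1 (B 1) E) (etrans _ (esym (congr1 (B' 1) E))).
  apply: etrans (esym (p1 _ _ _ _)) (etrans _ (p2 _ _ _ _)).
  apply: etrans (congr1 (B^~ v) D1) (etrans _ (esym (congr1 (B'^~ v) D1))).
  exact: etrans (z1 v) (esym (z2 v)).
move=> [k i] p pE v.
have E : << ucm (k, i) >> * p = a_neg k [ffun j => (i == j)%:R] * p :> SG.
  exact: (congr1 (fun z => z * p) (ucm_a_neg k i)).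
apply: etrans (congr1 (B^~ v) E) (etrans _ (esym (congr1 (B'^~ v) E))).
apply: etrans (n1 _ _ _ _) (etrans _ (esym (n2 _ _ _ _))).
exact: pE.
Qed.

Lemma fock_formE u v : fock_form xi u v = fock_pairing u v.
Proof.
rewrite /fock_form; case: xgetP => [B _ BP|/(_ fock_pairing)[]].
  exact: is_fock_form_unique BP fock_pairing_is_fock_form u v.
exact: fock_pairing_is_fock_form.
Qed.

End Fock.

(** * The characteristic map in the variables of the classes *)

Section Partitions.
Variable C : comNzRingType.

Lemma scale_partition (V : lmodType C) (X R : finType) (t : X -> R) (F : X -> C)
    (y : R -> V) :
  \sum_x F x *: y (t x) = \sum_r (\sum_(x | t x == r) F x) *: y r.
Proof.
rewrite (partition_big t xpredT) //=; apply: eq_bigr => r _.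
by rewrite scaler_suml; apply: eq_bigr => x /eqP <-.
Qed.

Lemma scale_sum_cond (V : lmodType C) (R : finType) (P : pred R) (z : R -> C)
    (y : R -> V) :
  \sum_(r | P r) z r *: y r = \sum_r (if P r then z r else 0) *: y r.
Proof.
by rewrite big_mkcond; apply: eq_bigr => r _; case: ifP; rewrite ?scale0r.
Qed.

Lemma linear_pred_sum (U V : lmodType C) (f : U -> V) (T : Type) (r : seq T)
  (p : T -> U) :
  linear f -> f (\sum_(t <- r) p t) = \sum_(t <- r) f (p t).
Proof.
move=> lf; have := linear_sumZ lf r (fun=> 1) p.
by under eq_bigr do rewrite scale1r;
  under [X in _ = X]eq_bigr do rewrite scale1r.
Qed.

Lemma fsbig_nat (V : zmodType) (F : nat -> V) N :
  (forall n, (N <= n)%N -> F n = 0) ->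
  \sum_(n \in [set: nat]%classic) F n = \sum_(n < N) F n.
Proof.
move=> F0; rewrite fsbig_ord; apply/esym/fsbig_widen => // n /= [_ /negP].
by rewrite -leqNgt => /F0.
Qed.

Lemma mcoeff_scalar (K : choiceType) (m : K) :
  scalar (mcoeff m : {malg C[K]} -> C).
Proof. by move=> a p q; rewrite mcoeffD mcoeffZ. Qed.

End Partitions.

Section InverseMonomial.
Variable gT : finGroupType.
Local Notation G n := (wreath gT n).

Lemma cycle_elt_inv n (x : G n) i : cycle_elt x^-1%g i = (cycle_elt x i)^-1%g.
Proof.
have K k p : iter k (wact x^-1%g) (iter k (wact x) p) = p.
  elim: k p => // k IH p.
  by rewrite iterSr [iter k.+1 (wact x) p]iterS -wactM mulVg wact1 IH.
have := K #|porbit (wperm x) i| (i, (cycle_elt x i)^-1%g).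
rewrite iter_wact_cycle mulgV => E.
rewrite {1}/cycle_elt wpermV porbitV.
by have := congr1 snd E.
Qed.

Lemma cycle_monom_inv n (x : G n) j :
  cycle_monom x^-1%g (jinv j) = cycle_monom x j.
Proof.
rewrite [LHS]cycle_monomE [RHS]cycle_monomE.
rewrite (wpermV x) porbitsV.
apply: eq_card => o; rewrite [LHS]finset.in_set [RHS]finset.in_set.
apply: andb_id2l => /imsetP[i _ ->].
rewrite orbit_type_porbit -porbitV -(wpermV x) orbit_type_porbit.
have -> : cycle_type x^-1%g i = jinv (cycle_type x i).
  by rewrite /cycle_type /jinv /= cycle_elt_inv (wpermV x) porbitV
    cclass_inv_class.
by rewrite (inj_eq (can_inj (@jinvK gT))).
Qed.

Lemma cycle_monom_degree m n (x : G m) (y : G n) :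
  cycle_monom x = cycle_monom y -> m = n.
Proof.
move=> E; rewrite -(cycle_monom_weight x (leq_maxl m n)) E.
exact: cycle_monom_weight (leq_maxr m n).
Qed.

End InverseMonomial.

Section Characteristic.
Variables (C : numClosedFieldType) (gT : finGroupType).
Local Notation G n := (wreath gT n).
Local Notation J := (nat * cclass gT)%type.
Local Notation PJ := {malg C[{cmonom J}]}.
Local Notation SG := (SGamma C gT).
Local Notation "#G n" := (#|{: G n}|%:R : C) (at level 10, n at level 8).

Lemma cycle_monom_cf n (f : classfun C (G n)) x y :
  cycle_monom x = cycle_monom y -> f x = f y.
Proof. by case/cycle_monom_conj => z ->; rewrite cfJ. Qed.

(** The number of elements with the same type as x. *)
Definition type_size n (x : G n) : C :=
  #|[set y : G n | cycle_monom y == cycle_monom x]|%:R.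

Lemma type_sizeM n (x : G n) :
  type_size x * (monom_cent n (cycle_monom x))%:R = #G n.
Proof.
apply: count_cycle_monom => //; first exact: cycle_monom_bounded.
exact: cycle_monom_weight.
Qed.

Lemma type_size_neq0 n (x : G n) : type_size x != 0.
Proof.
by rewrite pnatr_eq0 -lt0n; apply/card_gt0P; exists x; rewrite inE.
Qed.

Lemma sum_type n (f : classfun C (G n)) x m : cycle_monom x = m ->
  \sum_(y | cycle_monom y == m) f y = type_size x * f x.
Proof.
move=> <-.
transitivity (\sum_(y in [set y : G n | cycle_monom y == cycle_monom x]) f x).
  apply: eq_big => [y|y /eqP/cycle_monom_cf //].
  by rewrite finset.in_set.
by rewrite sumr_const /type_size mulr_natl.
Qed.

(** The average of f(x) times the cycle monomial of x. *)
Definition cycle_index n (f : classfun C (G n)) : PJ :=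
  \sum_x ((#G n)^-1 * f x) *: << cycle_monom x >>.

Lemma a_primeE n (rho : Defs.pfamily gT n) :
  a_prime C rho = theta << pf_monom rho >>.
Proof.
apply: esym; apply: etrans (malg_evalU _ _) _.
rewrite /mon_eval (big_bounded_monom _ (pf_monom_bounded (rho := rho))) =>
  [|j ->].
  apply: eq_bigr => c _; apply: eq_bigr => k _.
  by rewrite pf_monomE.
exact: expr0.
Qed.

Lemma ch_nE n (f : classfun C (G n)) : ch_n f = theta (cycle_index f).
Proof.
apply: esym; apply: etrans (linear_sumZ (@theta_linear C gT) _ _ _) _.
have E (x : G n) : theta << cycle_monom x >> = a_prime C (wtype x).
  rewrite -pf_monom_wtype. exact: esym (a_primeE (wtype x)).
apply: etrans (eq_bigr _ (fun x _ => congr1 (fun z => _ *: z) (E x))) _.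
apply: etrans (scale_partition (@wtype gT n) (fun x => (#G n)^-1 * f x)
  (a_prime C (n := n))) _.
apply: esym; apply: etrans (scale_sum_cond _ _ _) _.
apply: eq_scale_sum => rho.
under [RHS]eq_bigl => x do rewrite wtype_eq.
rewrite -mulr_sumr /value_at_type.
case: pickP => [x0|none].
  rewrite wtype_eq => /eqP xE; rewrite psize_weight -xE cycle_monom_weight //
    eqxx.
  rewrite (sum_type f (erefl (cycle_monom x0))) Zpart_cent -xE -(type_sizeM x0).
  have t0 := type_size_neq0 x0.
  have c0 : (monom_cent n (cycle_monom x0))%:R != 0 :> C.
    by have := card_wreath_neq0 gT C n;
      rewrite -(type_sizeM x0) mulf_eq0 negb_or => /andP[].
  by field; rewrite t0 c0.
rewrite [in RHS]big1 ?mulr0 => [|x]; last by rewrite -wtype_eq none.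
by case: ifP; rewrite ?mulr0.
Qed.

Lemma cycle_index_linear n : linear (@cycle_index n).
Proof.
move=> a f g; apply: esym; rewrite /cycle_index.
have G1 (V : lmodType C) (y : G n -> V) :
   a *: (\sum_x ((#G n)^-1 * f x) *: y x) + \sum_x ((#G n)^-1 * g x) *: y x =
   \sum_x ((#G n)^-1 * (a *: f + g) x) *: y x.
  rewrite scaler_sumr -big_split; apply: eq_bigr => x _ /=.
  by rewrite scalerA -scalerDl cf_addE cf_scaleE; congr (_ *: _); ring.
exact: G1.
Qed.

Lemma cycle_index0 n : cycle_index (0 : classfun C (G n)) = 0.
Proof. exact: (linear_at0 (@cycle_index_linear n)). Qed.

Lemma cycle_index_coef n (f : classfun C (G n)) m :
  (cycle_index f)@_m = (#G n)^-1 * \sum_(x | cycle_monom x == m) f x.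
Proof.
have E := scalar_sumZ (@mcoeff_scalar C _ m) (index_enum (G n))
  (fun x => (#G n)^-1 * f x) (fun x => << cycle_monom x >>).
apply: etrans E _.
rewrite mulr_sumr [RHS]big_mkcond; apply: eq_bigr => x _.
by rewrite mcoeffU; case: eqP => _; rewrite ?mulr1 ?mulr0.
Qed.

Lemma ch_trunc (u : RGamma C gT) N : (forall n, (N <= n)%N -> u n = 0) ->
  ch u = theta (\sum_(n < N) cycle_index (u n)).
Proof.
move=> u0; apply: etrans (fsbig_nat (N := N) _) _ => [n /u0 ->|].
  by apply: etrans (ch_nE _) _; apply: etrans
    (congr1 (@theta C gT) (cycle_index0 n)) _;
     apply: (linear_at0 (@theta_linear C gT)).
apply: etrans (eq_bigr _ (fun n _ => ch_nE (u (val n)))) _.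
apply: esym; exact: (linear_pred_sum _ _ (@theta_linear C gT)).
Qed.

Lemma rg_bound (u v : RGamma C gT) : exists N,
  (forall n, (N <= n)%N -> u n = 0) /\ (forall n, (N <= n)%N -> v n = 0).
Proof.
case: (rg_fin u) (rg_fin v) => [N HN] [M HM]; exists (maxn N M).
by split=> n; rewrite geq_max => /andP[a b]; [exact: HN|exact: HM].
Qed.

End Characteristic.

(** * Bijectivity and isometry *)

Lemma sum_lin (C : nzRingType) (V : lmodType C) (I : finType) (a : C)
  (y z : I -> V) :
  \sum_i (a *: y i + z i) = a *: (\sum_i y i) + \sum_i z i.
Proof. by rewrite big_split scaler_sumr. Qed.

Section Isomorphism.
Variables (C : numClosedFieldType) (gT : finGroupType).
Local Notation G n := (wreath gT n).
Local Notation J := (nat * cclass gT)%type.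
Local Notation PJ := {malg C[{cmonom J}]}.
Local Notation SG := (SGamma C gT).
Local Notation "#G n" := (#|{: G n}|%:R : C) (at level 10, n at level 8).
Local Notation cidx := (@cycle_index C gT _).

Lemma rg_linE a (u v : RGamma C gT) n : (a *: u + v) n = a *: u n + v n.
Proof. by rewrite /= scale1r addr0. Qed.

Lemma ch_linear : linear (ch : RGamma C gT -> SG).
Proof.
move=> a u v; have [N [uN vN]] := rg_bound u v.
have wN n : (N <= n)%N -> (a *: u + v) n = 0.
  by move=> nN; rewrite rg_linE uN // vN // scaler0 addr0.
apply: etrans (ch_trunc wN) _.
apply: etrans _ (esym (congr2 (fun x y : SG => a *: x + y) (ch_trunc uN)
  (ch_trunc vN))).
apply: etrans _ (theta_linear _ _ _).
apply: (congr1 (@theta C gT)).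
apply: etrans _ (sum_lin _ _ _); apply: eq_bigr => n _.
exact: etrans (congr1 (@cycle_index C gT n) (rg_linE a u v n))
  (cycle_index_linear _ _ _).
Qed.

Lemma cycle_index_coef_cycle n (f : classfun C (G n)) (x : G n) :
  (cycle_index f)@_(cycle_monom x) = (#G n)^-1 * (type_size C x * f x).
Proof.
by apply: etrans (cycle_index_coef _ _) _;
  rewrite (sum_type f (erefl (cycle_monom x))).
Qed.

Lemma cycle_index_coef_neq n n0 (f : classfun C (G n)) (x : G n0) : n != n0 ->
  (cycle_index f)@_(cycle_monom x) = 0.
Proof.
move=> nn; apply: etrans (cycle_index_coef _ _) _.
rewrite big1 ?mulr0 // => y /eqP/cycle_monom_degree E.
by rewrite E eqxx in nn.
Qed.

Lemma total_coef (u : forall n, classfun C (G n)) N n0 (x : G n0) :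
  (n0 < N)%N ->
  (\sum_(n < N) cycle_index (u n))@_(cycle_monom x) =
  (#G n0)^-1 * (type_size C x * u n0 x).
Proof.
move=> nN.
have E := linear_pred_sum (index_enum 'I_N) (fun n => cycle_index (u (val n)))
  (@mcoeff_scalar C _ (cycle_monom x) : linear (_ : PJ -> C^o)).
apply: etrans E _.
rewrite (bigD1 (Ordinal nN)) //=.
apply: etrans (congr2 (fun a b : C => a + b) (cycle_index_coef_cycle (u n0) x)
  (_ : _ = 0)) _.
  apply: big1 => n nn; apply: cycle_index_coef_neq.
  by move: nn; rewrite -val_eqE.
by rewrite addr0.
Qed.

Lemma ch_injective : injective (ch : RGamma C gT -> SG).
Proof.
move=> u v E; have [N [uN vN]] := rg_bound u v.
apply: rg_ext => n; apply: cf_ext => x.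
pose M := maxn N n.+1.
have nM : (n < M)%N by rewrite leq_max leqnn orbT.
have uM k : (M <= k)%N -> u k = 0 by rewrite geq_max => /andP[/uN].
have vM k : (M <= k)%N -> v k = 0 by rewrite geq_max => /andP[/vN].
have E1 : \sum_(k < M) cycle_index (u k) = \sum_(k < M) cycle_index (v k).
  apply: (can_inj (@thetaK C gT)).
  exact: etrans (esym (ch_trunc uM)) (etrans E (ch_trunc vM)).
have := congr1 (mcoeff (cycle_monom x)) E1.
move/(etrans (esym (total_coef (fun k => u k) x nM))).
move/esym/(etrans (esym (total_coef (fun k => v k) x nM))) => /mulfI H.
apply/esym; apply: (mulfI (type_size_neq0 C x)); apply: H.
by rewrite invr_eq0 card_wreath_neq0.
Qed.

(** The weighted degree, without a bound on the indices. *)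
Definition monom_degree (m : {cmonom J}) : nat :=
  (\sum_(j <- finsupp m) j.1.+1 * m j)%N.

Lemma bounded_monom_weight B (m : {cmonom J}) :
  bounded_monom B m -> monom_weight B m = monom_degree m.
Proof.
move=> bm; rewrite /monom_degree (big_bounded_monom _ bm) // => j ->.
by rewrite muln0.
Qed.

Lemma monom_degree_cycle n (x : G n) : monom_degree (cycle_monom x) = n.
Proof.
by rewrite -(bounded_monom_weight (@cycle_monom_bounded _ _ x))
  cycle_monom_weight.
Qed.

Lemma monom_degree_bounded (m : {cmonom J}) : bounded_monom (monom_degree m) m.
Proof.
move=> j mj; have jm : j \in finsupp m by rewrite -cmE_neq0.
rewrite /monom_degree (big_fsetD1 j jm) /=.
apply: leq_trans (leq_addr _ _); rewrite -[X in (X <= _)%N]muln1.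
by rewrite leq_mul2l /= lt0n.
Qed.

(** Every monomial is the type of an element of some wreath product. *)
Lemma monom_realized (m : {cmonom J}) : exists n (x : G n), cycle_monom x = m.
Proof.
have bm := @monom_degree_bounded m.
have := count_cycle_monom C (leqnn _) bm (bounded_monom_weight bm).
set k := #|_| => E; have : (0 < k)%N.
  rewrite lt0n; apply: contraNneq (card_wreath_neq0 gT C (monom_degree m)) =>
    k0.
  by rewrite -E k0 mul0r.
case/card_gt0P => x; rewrite finset.in_set => /eqP xm.
by exists (monom_degree m), x.
Qed.

Lemma ch_surjective (p : SG) : exists u : RGamma C gT, ch u = p.
Proof.
pose q := theta_inv p.
(* The weighted degree of a cycle monomial is n, so those in the support of q
   come from n < N. *)
pose N := (\sum_(m <- msupp q) monom_degree m).+1.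
have qN n (x : G n) : (N <= n)%N -> q@_(cycle_monom x) = 0.
  move=> nN; apply/eqP; rewrite mcoeff_eq0; apply: contraTN nN => xq.
  rewrite -ltnNge ltnS -{1}(monom_degree_cycle x) (big_fsetD1 _ xq) /=.
  exact: leq_addr.
pose f n (x : G n) : C := #G n * q@_(cycle_monom x) / type_size C x.
have fJ n (x y : G n) : f n (x ^ y)%g = f n x.
  by rewrite /f /type_size cycle_monomJ.
pose U n : classfun C (G n) := mkcf (fJ n).
have U0 n : (N <= n)%N -> U n = 0.
  by move=> nN; apply: cf_ext => x;
    rewrite mkcfE /f (qN _ _ nN) mulr0 mul0r cf_zeroE.
pose V := MkRGamma (ex_intro (fun N => forall n, (N <= n)%N -> U n = 0) N U0).
exists V.
apply: etrans (@ch_trunc _ _ V N U0) _.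
apply: etrans _ (theta_invK p); apply: (congr1 (@theta C gT)).
apply/malgP => m; have [n [x <-]] := monom_realized m.
have [nN|Nn] := ltnP n N.
  apply: etrans (total_coef U x nN) _; rewrite mkcfE /f.
  have := type_size_neq0 C x; have := card_wreath_neq0 gT C n.
  move: (q@_ _) (type_size C x) (#|{: G n}|%:R : C) => z t a a0 t0.
  by field; rewrite a0 t0.
rewrite -/q qN //.
have E := linear_pred_sum (index_enum 'I_N) (fun k => cycle_index (U (val k)))
  (@mcoeff_scalar C _ (cycle_monom x) : linear (_ : PJ -> C^o)).
apply: etrans E _; apply: big1 => k _; apply: cycle_index_coef_neq.
by rewrite neq_ltn (leq_trans (ltn_ord k)).
Qed.

Lemma ch_bijective : bijective (ch : RGamma C gT -> SG).
Proof.
have [g gE] := boolp.choice ch_surjective.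
exists g => [u|p]; last exact: gE.
by apply: ch_injective; rewrite gE.
Qed.

Section Isometry.
Variable xi : classfun C gT.
Hypothesis xi_self_dual : self_dual xi.
Local Notation jn := (jnorm xi).

Lemma mon_weight_cycle n (x : G n) : mon_weight jn (cycle_monom x) =
  (monom_cent n (cycle_monom x))%:R *
    orbit_prod (fun j => xi (repr (val j.2))) x.
Proof.
have -> : orbit_prod (fun j => xi (repr (val j.2))) x =
    mon_eval (fun j => xi (repr (val j.2))) (cycle_monom x).
  rewrite cycle_monom.unlock (big_morph _ (mmorphM _) (mmorph1 _)).
  by apply: eq_bigr => o _; rewrite [RHS]mon_evalU.
have bx := @cycle_monom_bounded _ _ x.
rewrite /mon_weight (big_bounded_monom _ bx) => [|j ->]; last by rewrite mulr1.
rewrite /mon_eval (big_bounded_monom _ bx) => [|j ->]; last by rewrite expr0.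
rewrite /monom_cent natr_prod -big_split; apply: eq_bigr => c _ /=.
rewrite natr_prod -big_split; apply: eq_bigr => k _ /=.
rewrite !natrM !natrX /jnorm /= !exprMn.
by rewrite [LHS]*%R.[AC (1*(2*1)) (2*1*3*4)%AC].
Qed.

Lemma mon_pairing_cycle m n (x : G m) (y : G n) :
  mon_pairing (@jinv gT) jn (cycle_monom x) (cycle_monom y) =
  (if cycle_monom y == cycle_monom x^-1%g then mon_weight jn (cycle_monom x)
    else 0).
Proof.
rewrite /mon_pairing; case: asboolP => [H|H]; case: eqP => [E|E] //.
- case: E; apply/eqP/cmP => j; rewrite -(jinvK j) H.
  exact: esym (cycle_monom_inv x (jinv j)).
- case: H => j; rewrite E; exact: cycle_monom_inv.
Qed.

Lemma pairing_cycle_index m n (f : classfun C (G m)) (g : classfun C (G n)) :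
  pairing (@jinv gT) jn (cycle_index f) (cycle_index g) =
  \sum_x (#G m)^-1 * f x * \sum_y (#G n)^-1 * g y *
     mon_pairing (@jinv gT) jn (cycle_monom x) (cycle_monom y).
Proof.
have E1 := scalar_sumZ (@pairing_linl C _ (@jinv gT) jn (cycle_index g))
  (index_enum (G m))
  (fun x => (#G m)^-1 * f x) (fun x => << cycle_monom x >>).
apply: etrans E1 _; apply: eq_bigr => x _; congr (_ * _).
have E2 := scalar_sumZ (pairing_linr (@jinvK gT) (jnorm_inv xi_self_dual) <<
  cycle_monom x >>)
  (index_enum (G n)) (fun x => (#G n)^-1 * g x) (fun x => << cycle_monom x >>).
apply: etrans E2 _; apply: eq_bigr => y _; congr (_ * _).
exact: pairingU.
Qed.

Lemma pairing_cycle_index_neq m n (f : classfun C (G m)) (g : classfun C (G n))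
  :
  m != n -> pairing (@jinv gT) jn (cycle_index f) (cycle_index g) = 0.
Proof.
move=> mn; apply: etrans (pairing_cycle_index _ _) _.
apply: big1 => x _; rewrite big1 ?mulr0 // => y _.
rewrite mon_pairing_cycle; case: eqP => [/cycle_monom_degree E|_];
  last by rewrite mulr0.
by rewrite E eqxx in mn.
Qed.

Lemma type_size_inv n (x : G n) : type_size C x^-1%g = type_size C x.
Proof.
have H (y z : G n) : (cycle_monom y^-1%g == cycle_monom z^-1%g) =
  (cycle_monom y == cycle_monom z).
  apply/eqP/eqP => E; apply/eqP/cmP => j.
    by rewrite -!(cycle_monom_inv _ j) E.
  by rewrite -(jinvK j) !cycle_monom_inv E.
have cE := card_imset (mem [set y : G n | cycle_monom y == cycle_monom x])
  (@invg_inj (G n)).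
apply: (congr1 (fun k : nat => k%:R : C)); apply: etrans _ cE.
apply: eq_card => y; rewrite finset.in_set.
apply/idP/imsetP => [yx|[z]].
  by exists y^-1%g; rewrite ?invgK // finset.in_set -H invgK.
by rewrite finset.in_set => zx ->; rewrite H.
Qed.

Lemma pairing_cycle_index_eq n (f g : classfun C (G n)) :
  pairing (@jinv gT) jn (cycle_index f) (cycle_index g) = wreath_form xi f g.
Proof.
apply: etrans (pairing_cycle_index _ _) _.
rewrite /wreath_form /cf_form mulr_sumr; apply: eq_bigr => x _.
under eq_bigr => y _ do rewrite mon_pairing_cycle.
have -> : \sum_y (#G n)^-1 * g y * (if cycle_monom y == cycle_monom x^-1%g
     then mon_weight jn (cycle_monom x) else 0) =
   (#G n)^-1 * mon_weight jn (cycle_monom x) *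
     \sum_(y | cycle_monom y == cycle_monom x^-1%g) g y.
  rewrite mulr_sumr [RHS]big_mkcond; apply: eq_bigr => y _.
  by case: ifP => _; rewrite ?mulr0 // mulrAC.
rewrite (sum_type g (erefl (cycle_monom x^-1%g))) type_size_inv
  mon_weight_cycle.
rewrite mkcfE etaE mkcfE.
have gn := card_wreath_neq0 gT C n; have E := type_sizeM C x.
set o := orbit_prod _ _; set t := type_size _ _ in E *; set z := _%:R in E *.
rewrite -E in gn *.
by move: gn; rewrite mulf_eq0 negb_or => /andP[t0 z0]; field; rewrite t0 z0.
Qed.

Lemma ch_isometry (u v : RGamma C gT) : fock_form xi (ch u) (ch v) =
  RGamma_form xi u v.
Proof.
have [N [uN vN]] := rg_bound u v.
apply: etrans (fock_formE xi_self_dual _ _) _.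
apply: etrans (congr2 (fock_pairing xi) (ch_trunc uN) (ch_trunc vN)) _.
apply: etrans (congr2 (pairing (@jinv gT) jn) (thetaK _) (thetaK _)) _.
have E1 w := linear_pred_sum (index_enum 'I_N)
  (fun n => cycle_index (u (val n)))
  (@pairing_linl C _ (@jinv gT) jn w : linear (_ : PJ -> C^o)).
have E2 w := linear_pred_sum (index_enum 'I_N)
  (fun n => cycle_index (v (val n)))
  (pairing_linr (@jinvK gT) (jnorm_inv xi_self_dual) w :
    linear (_ : PJ -> C^o)).
apply: etrans (E1 _) _.
have -> : RGamma_form xi u v = \sum_(n < N) wreath_form xi (u n) (v n).
  apply: (fsbig_nat (V := C)) => n /uN ->.
  rewrite /wreath_form /cf_form big1 ?mulr0 // => x _.
  by rewrite mkcfE cf_zeroE mulr0 mul0r.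
apply: eq_bigr => n _; apply: etrans (E2 _) _.
rewrite (bigD1 n) //=.
apply: etrans (congr2 (fun a b : C => a + b) (pairing_cycle_index_eq _ _)
  (_ : _ = 0)) _.
  apply: big1 => k kn; apply: pairing_cycle_index_neq.
  by move: kn; rewrite eq_sym -val_eqE.
by rewrite addr0.
Qed.

End Isometry.
End Isomorphism.

Theorem theorem5p5 (R : realType) (gT : finGroupType)
    (xi : classfun R[i] gT) (xi_self_dual : self_dual xi) :
  [/\ linear (ch : RGamma R[i] gT -> SGamma R[i] gT),
      bijective (ch : RGamma R[i] gT -> SGamma R[i] gT)
    & forall u v : RGamma R[i] gT,
        fock_form xi (ch u) (ch v) = RGamma_form xi u v].
Proof.
split; [exact: ch_linear | exact: ch_bijective | exact: ch_isometry].
Qed.
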